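(* Let $(G,G_0,G_{\mathrm f})$ be a condensing IMG group triplet with hyperfinite abelian ambient group $G$. Then the canonical homomorphism $G_0^{\sim}/G_{\mathrm f}^{\sim}\to\widehat{G_{\mathrm f}/G_0}$, $\gamma G_{\mathrm f}^{\sim}\mapsto\gamma^\flat$, is an isomorphism of topological groups.
   Context: Nonstandard setting: one works in a $\kappa$-saturated nonstandard universe (elementary extension $X\mapsto{}^*X$ of a superstructure), $\kappa$ uncountable. ''Admissible size'' means external cardinality $<\kappa$. A monadic set is the intersection, and a galactic set the union, of a family of admissible size of internal sets. A hyperfinite set is an internal set in internal bijection with $\{1,\dots,n\}$ for some $n\in{}^*\mathbb N$. For hypercomplex numbers, $a\approx b$ means that $a-b$ is infinitesimal, and ${}^\circ a$ is the standard part of a finite $a$. $\mathbb T$ is the multiplicative group of complex numbers of modulus 1. Triplets: an IMG group triplet with hyperfinite abelian ambient group is $(G,G_0,G_{\mathrm f})$, where $G$ is an internal hyperfinite abelian group (written additively), $G_0\subseteq G_{\mathrm f}$ are subgroups of $G$, $G_0$ is monadic and $G_{\mathrm f}$ is galactic. It is condensing if for every internal $A\subseteq G_{\mathrm f}$ and every symmetric internal $B$ with $G_0\subseteq B\subseteq G$, $A$ is covered by a (standardly) finite number of translates of $B$; equivalently, $|A|/|B|$ is finite and noninfinitesimal for any internal sets $A,B$ with $G_0\subseteq A,B\subseteq G_{\mathrm f}$. The observable trace is $G^\flat=G_{\mathrm f}/G_0$, with $x^\flat=x+G_0$ for $x\in G_{\mathrm f}$. A set $Y\subseteq G^\flat$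 is open iff for each $x\in G_{\mathrm f}$ with $x^\flat\in Y$ there is an internal $A$ with $x+G_0\subseteq A\subseteq\{y\in G_{\mathrm f}: y^\flat\in Y\}$. For condensing triplets $G^\flat$ is a Hausdorff locally compact abelian (LCA) group. Dual: $\widehat G$ is the (hyperfinite abelian) group of all internal homomorphisms $G\to{}^*\mathbb T$. For $A\subseteq G$, $A^{\sim}=\{\gamma\in\widehat G:\gamma(a)\approx1\text{ for all }a\in A\}$. The triplet $(\widehat G,G_{\mathrm f}^{\sim},G_0^{\sim})$ is again a condensing IMG group triplet with hyperfinite abelian ambient group (the dual triplet), and $G_0^{\sim}/G_{\mathrm f}^{\sim}$ carries its observable trace topology. For an LCA group $\mathbf G$, $\widehat{\mathbf G}$ is its dual group of continuous homomorphisms $\mathbf G\to\mathbb T$ with the compact-open topology. For $\gamma\in G_0^{\sim}$, $\gamma^\flat\in\widehat{G_{\mathrm f}/G_0}$ is defined by $\gamma^\flat(x^\flat)={}^\circ\gamma(x)$, $x\in G_{\mathrm f}$. *)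

(* Defs.v *)
From HB Require Import structures.
From mathcomp Require Import all_boot all_order all_algebra complex.
From mathcomp Require Import all_classical all_reals all_analysis.

Set Implicit Arguments.
Unset Strict Implicit.
Unset Printing Implicit Defensive.

Import Order.TTheory GRing.Theory Num.Theory.
Local Open Scope classical_set_scope.
Local Open Scope ring_scope.
Local Open Scope quotient_scope.
Local Open Scope complex_scope.

(* The superstructure over the urelements X, N, R and C is presented in typed
   form: a sort is an iterated sum, product, power set or function space of
   the four base sets, and [El X R s] is the set of standard objects of that
   sort.  Every V_n embeds into such a sort. *)
Inductive ssort : Set :=
| sBase | sNat | sReal | sCplx
| sSum of ssort & ssort | sProd of ssort & ssort
| sPow of ssort | sFun of ssort & ssort.

Fixpoint El (X : Type) (R : realType) (s : ssort) : Type :=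
  match s with
  | sBase => X
  | sNat => nat
  | sReal => R
  | sCplx => R[i]
  | sSum s t => (El X R s + El X R t)%type
  | sProd s t => (El X R s * El X R t)%type
  | sPow s => set (El X R s)
  | sFun s t => El X R s -> El X R t
  end.

Fixpoint env (F : ssort -> Type) (Γ : seq ssort) : Type :=
  if Γ is s :: Δ then (F s * env F Δ)%type else unit.

Fixpoint env_map (F F' : ssort -> Type) (f : forall s, F s -> F' s)
    (Γ : seq ssort) : env F Γ -> env F' Γ :=
  if Γ is s :: Δ then fun e => (f s e.1, env_map f e.2) else fun=> tt.

(* Typed de Bruijn variables: [var Γ s] are the variables of sort s in Γ. *)
Inductive var : seq ssort -> ssort -> Type :=
| vz s Γ : var (s :: Γ) s
| vs s t Γ : var Γ t -> var (s :: Γ) t.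

Fixpoint lookup (F : ssort -> Type) Γ t (v : var Γ t) : env F Γ -> F t :=
  match v with
  | vz _ _ => fun e => e.1
  | vs _ _ _ w => fun e => lookup w e.2
  end.

Definition select (F : ssort -> Type) Γ Δ (v : env (var Γ) Δ) (e : env F Γ) :
  env F Δ := env_map (fun t w => lookup w e) v.

Section formulas.
Context (X : Type) (R : realType).
Local Notation El := (El X R).

(* The first-order language with one relation (function) symbol for every
   relation (function) on the superstructure.  Equality, membership and
   evaluation of functions are among these symbols: a = b is the atom f(a) = b
   with f the identity. *)
Inductive form : seq ssort -> Type :=
| fRel Γ Δ of (env El Δ -> Prop) & env (var Γ) Δ : form Γ
| fFun Γ Δ t of (env El Δ -> El t) & env (var Γ) Δ & var Γ t : form Γ
| fNot Γ of form Γ : form Γ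
| fAnd Γ of form Γ & form Γ : form Γ
| fOr Γ of form Γ & form Γ : form Γ
| fImp Γ of form Γ & form Γ : form Γ
| fAll Γ s of form (s :: Γ) : form Γ
| fEx Γ s of form (s :: Γ) : form Γ.

Record structure := Structure {
  dom :> ssort -> Type;
  rel_star : forall Δ, (env El Δ -> Prop) -> env dom Δ -> Prop;
  fun_star : forall Δ t, (env El Δ -> El t) -> env dom Δ -> dom t }.

Fixpoint sat (M : structure) Γ (φ : form Γ) : env M Γ -> Prop :=
  match φ with
  | fRel _ _ r v => fun e => rel_star r (select v e)
  | fFun _ _ _ f v y => fun e => fun_star f (select v e) = lookup y e
  | fNot _ ψ => fun e => ~ sat ψ e
  | fAnd _ ψ χ => fun e => sat ψ e /\ sat χ e
  | fOr _ ψ χ => fun e => sat ψ e \/ sat χ e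
  | fImp _ ψ χ => fun e => sat ψ e -> sat χ e
  | fAll _ s ψ => fun e => forall x : M s, @sat M (s :: _) ψ (x, e)
  | fEx _ s ψ => fun e => exists x : M s, @sat M (s :: _) ψ (x, e)
  end.

Definition standard : structure :=
  @Structure El (fun _ r => r) (fun _ _ f => f).

(* [nsstr s] is the set *(El s); [star] is the elementary embedding.  Since
   quantifiers range over whole sorts, those over [sPow s] and [sFun s t] range
   in [nsstr] over internal sets and internal functions only. *)
Record nsuniverse := NSUniverse {
  nsstr :> structure;
  star : forall s, El s -> nsstr s;
  elementary : forall Γ (φ : form Γ) (e : env El Γ),
    @sat nsstr Γ φ (env_map star e) <-> @sat standard Γ φ e }.

End formulas.
Arguments star {X R} n s _.

Section transfer.
Context (X : Type) (R : realType) (U : nsuniverse X R).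
Local Notation El := (El X R).

Fixpoint closure_form (Γ : seq ssort) : form X R Γ -> form X R [::] :=
  if Γ is s :: Δ then fun φ => @closure_form Δ (fAll φ) else id.

Lemma sat_closure (M : structure X R) Γ (φ : form X R Γ) :
  @sat _ _ M [::] (closure_form φ) tt <-> forall e, @sat _ _ M Γ φ e.
Proof.
elim: Γ φ => [|s Γ IH] φ /=; first by split=> [? []|/(_ tt)].
by rewrite IH /=; split=> [h [x e]|h e x]; exact: h.
Qed.

Lemma transfer Γ (φ : form X R Γ) :
  (forall e, @sat _ _ (standard X R) Γ φ e) -> forall e, @sat _ _ U Γ φ e.
Proof. by move=> /sat_closure/(elementary U)/sat_closure. Qed.

End transfer.

Section internal.
Context (X : Type) (R : realType) (U : nsuniverse X R).
Local Notation El := (El X R).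

(* x is a member of the internal set A. *)
Definition inn s (x : U s) (A : U (sPow s)) : Prop :=
  @rel_star _ _ U [:: s; sPow s] (fun e => e.2.1 e.1) (x, (A, tt)).

Definition ext s (A : U (sPow s)) : set (U s) := [set x | inn x A].

Definition app s t (f : U (sFun s t)) (x : U s) : U t :=
  @fun_star _ _ U [:: sFun s t; s] t (fun e => e.1 e.2.1) (f, (x, tt)).

Definition leN (m n : U sNat) : Prop :=
  @rel_star _ _ U [:: sNat; sNat] (fun e => e.1 <= e.2.1)%N (m, (n, tt)).

Definition hyperfinite s (A : U (sPow s)) : Prop :=
  exists (n : U sNat) (f : U (sFun s sNat)),
    set_bij (ext A) [set k | leN (star U sNat 1%N) k /\ leN k n] (app f).

Definition internal s (S : set (U s)) : Prop := exists A, S = ext A.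

Definition fIn Γ s (x : var Γ s) (A : var Γ (sPow s)) : form X R Γ :=
  @fRel X R Γ [:: s; sPow s] (fun e => e.2.1 e.1) (x, (A, tt)).

Fixpoint idvars (Γ : seq ssort) : env (var Γ) Γ :=
  match Γ return env (var Γ) Γ with
  | [::] => tt
  | s :: Δ => (vz s Δ, env_map (fun t w => vs s w) (idvars Δ))
  end.

Lemma env_map_comp (F F' F'' : ssort -> Type) (f : forall s, F s -> F' s)
    (g : forall s, F' s -> F'' s) Γ (e : env F Γ) :
  env_map g (env_map f e) = env_map (fun s x => g s (f s x)) e.
Proof. by elim: Γ e => //= s Γ IH e; rewrite IH. Qed.

Lemma select_idvars (F : ssort -> Type) Γ Δ (f : forall t, var Γ t -> var Δ t)
    (e : env F Γ) (e' : env F Δ) :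
  (forall t (w : var Γ t), lookup (f t w) e' = lookup w e) ->
  select (env_map f (idvars Γ)) e' = e.
Proof.
elim: Γ f e => [|s Γ IH] f e /= h; first by case: e {h}.
case: e h => x e h; congr pair; first exact: (h _ (vz s Γ)).
rewrite env_map_comp; apply: IH => t w.
by rewrite h.
Qed.

Lemma env_map_id (F : ssort -> Type) Γ (e : env F Γ) :
  env_map (fun _ x => x) e = e.
Proof. by elim: Γ e => [[]|s Γ IH [x e]] //=; rewrite IH. Qed.

Lemma select_id (F : ssort -> Type) Γ (e : env F Γ) : select (idvars Γ) e = e.
Proof.
by rewrite -[idvars Γ]env_map_id; exact: select_idvars.
Qed.

Lemma rel_star_sat Γ (φ : form X R Γ) (e : env U Γ) :
  @rel_star _ _ U Γ (@sat _ _ (standard X R) Γ φ) e <-> @sat _ _ U Γ φ e.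
Proof.
pose r := @sat _ _ (standard X R) Γ φ.
have := @transfer X R U Γ (fAnd (fImp (@fRel X R Γ Γ r (idvars Γ)) φ)
  (fImp φ (@fRel X R Γ Γ r (idvars Γ)))) _ e.
case=> [a|]; first by split; cbn; rewrite select_id.
by cbn; rewrite select_id => h1 h2; split.
Qed.

Lemma internal_definition s Γ (φ : form X R (s :: Γ)) (e : env U Γ) :
  internal [set x | @sat _ _ U (s :: Γ) φ (x, e)].
Proof.
pose r := @sat _ _ (standard X R) (s :: Γ) φ.
pose c (a : env El Γ) : El (sPow s) := [set x | r (x, a)].
pose A := @fun_star _ _ U Γ (sPow s) c e; exists A.
pose Δ := [:: s, sPow s & Γ].
pose vx : var Δ s := vz _ _; pose vA : var Δ (sPow s) := vs _ (vz _ _).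
pose w : env (var Δ) Γ := env_map (fun t v => vs s (vs (sPow s) v)) (idvars Γ).
pose φ1 := @fFun X R Δ Γ (sPow s) c w vA.
pose φ2 := @fRel X R Δ (s :: Γ) r (vx, w).
have wE F (x : F s) (B : F (sPow s)) (a : env F Γ) :
  @select F Δ Γ w (x, (B, a)) = a by exact: select_idvars.
have w2E F (x : F s) (B : F (sPow s)) (a : env F Γ) :
    @select F Δ (s :: Γ) (vx, w) (x, (B, a)) = (x, a).
  by congr pair; exact: wE.
have T x : @sat _ _ U Δ (fImp φ1 (fAnd (fImp (fIn vx vA) φ2)
    (fImp φ2 (fIn vx vA)))) (x, (A, e)).
  apply: transfer => -[y [B a]].
  rewrite /φ1 /φ2; cbn -[select]; rewrite wE w2E => cB.
  by rewrite -cB.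
have {}T x : (inn x A -> rel_star r (x, e)) /\ (rel_star r (x, e) -> inn x A).
  move: (T x); rewrite /φ1 /φ2; cbn -[select]; rewrite wE w2E; exact.
apply/seteqP; split=> x /=; first by move=> /rel_star_sat; exact: (T x).2.
by move=> Ax; apply/rel_star_sat; exact: (T x).1.
Qed.

Lemma internalI s (S T : set (U s)) :
  internal S -> internal T -> internal (S `&` T).
Proof.
move=> [A ->] [B ->].
exact: (@internal_definition s [:: sPow s; sPow s]
  (fAnd (fIn (vz _ _) (vs _ (vz _ _))) (fIn (vz _ _) (vs _ (vs _ (vz _ _)))))
  (A, (B, tt))).
Qed.

Lemma internalC s (S : set (U s)) : internal S -> internal (~` S).
Proof.
move=> [A ->].
exact: (@internal_definition s [:: sPow s]
  (fNot (fIn (vz _ _) (vs _ (vz _ _)))) (A, tt)).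
Qed.

Lemma internal_preim s t (f : U (sFun s t)) (S : set (U t)) :
  internal S -> internal (app f @^-1` S).
Proof.
move=> [A ->].
pose Γ := [:: t; s; sFun s t; sPow t].
pose y : var Γ t := vz _ _; pose x : var Γ s := vs _ (vz _ _).
pose g : var Γ (sFun s t) := vs _ (vs _ (vz _ _)).
pose a : var Γ (sPow t) := vs _ (vs _ (vs _ (vz _ _))).
have [B hB] := @internal_definition s [:: sFun s t; sPow t]
  (fAll (fImp (@fFun X R Γ [:: sFun s t; s] t (fun e => e.1 e.2.1)
     (g, (x, tt)) y) (fIn y a))) (f, (A, tt)).
exists B; rewrite -hB; apply/seteqP; split=> z /=.
  by move=> fz v <-.
by move=> /(_ (app f z)); apply.
Qed.

End internal.

Section fun_star_theory.
Context (X : Type) (R : realType) (U : nsuniverse X R).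
Local Notation El := (El X R).

Lemma fun_star_proj Γ t (v : var Γ t) (e : env U Γ) :
  @fun_star _ _ U Γ t (fun a => lookup v a) e = lookup v e.
Proof.
have := @transfer X R U Γ
  (@fFun X R Γ Γ t (fun a => lookup v a) (idvars Γ) v) _ e.
by cbn; rewrite select_id; apply => a; cbn; rewrite select_id.
Qed.

Lemma app_inj s t (f g : U (sFun s t)) :
  (forall x, app f x = app g x) -> f = g.
Proof.
move=> fg; pose Γ := [:: sFun s t; sFun s t].
pose Δ := [:: t, s & Γ].
pose y : var Δ t := vz _ _; pose x : var Δ s := vs _ (vz _ _).
pose vf : var Δ (sFun s t) := vs _ (vs _ (vz _ _)).
pose vg : var Δ (sFun s t) := vs _ (vs _ (vs _ (vz _ _))).
pose ap (f : var Δ (sFun s t)) :=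
  @fFun X R Δ [:: sFun s t; s] t (fun e => e.1 e.2.1) (f, (x, tt)) y.
pose id2 := @fFun X R Γ [:: sFun s t] (sFun s t) (fun a => a.1)
  (vz _ _, tt) (vs _ (vz _ _)).
have := @transfer X R U Γ (fImp (fAll (fAll (fImp (ap vf) (ap vg)))) id2) _
  (f, (g, tt)).
cbn; rewrite (@fun_star_proj [:: sFun s t] _ (vz _ _)); cbn; apply.
  by move=> [a [b []]] /= h; apply/funext => z; rewrite (h z _ erefl).
by move=> a b <-; rewrite -[LHS]/(app g a) -fg.
Qed.

End fun_star_theory.

Section saturation.
Context (X : Type) (R : realType).

(* The cardinal κ is given as the cardinality of a type K; [admissible K F]
   says card F < κ. *)
Definition admissible (K T : Type) (F : set T) : Prop := ~~ ([set: K] #<= F)%card.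

Record satuniverse (K : Type) := SatUniverse {
  satuniv :> nsuniverse X R;
  kappa_uncountable : ~ countable [set: K];
  saturated : forall s (F : set (satuniv (sPow s))), admissible K F ->
    (forall D, finite_set D -> D `<=` F ->
      \bigcap_(A in D) ext A !=set0) ->
    \bigcap_(A in F) ext A !=set0 }.

Context (K : Type) (U : satuniverse K).

Definition monadic s (S : set (U s)) : Prop :=
  exists2 F : set (U (sPow s)), admissible K F & S = \bigcap_(A in F) ext A.

Definition galactic s (S : set (U s)) : Prop :=
  exists2 F : set (U (sPow s)), admissible K F & S = \bigcup_(A in F) ext A.

(* A form of comparability of cardinals, used below to merge two families of
   admissible size into one. *)
Lemma partial_matching (T T' : Type) (A : set T) (B : set T') :
  exists M : set (T * T'),
  [/\ forall p q, M p -> M q -> (p.1 = q.1 <-> p.2 = q.2),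
      M `<=` A `*` B &
      (forall a, A a -> exists b, M (a, b)) \/
      (forall b, B b -> exists a, M (a, b))].
Proof.
pose P := [set M : set (T * T') | (forall p q, M p -> M q ->
  (p.1 = q.1 <-> p.2 = q.2)) /\ M `<=` A `*` B].
have [|M [[Minj MAB] Mmax]] := @Zorn_bigcup _ P.
  move=> F FP totF; split=> [p q [M FM Mp] [N FN Nq]|p [M /FP[_ MAB] /MAB//]].
  have [MN|NM] := totF _ _ FM FN.
    by apply: (FP _ FN).1 => //; exact: MN.
  by apply: (FP _ FM).1 => //; exact: NM.
exists M; split => //; apply: contrapT => /not_orP[].
move=> /existsNP[a /not_implyP[Aa Ma]] /existsNP[b /not_implyP[Bb Mb]].
apply: (Mmax (M `|` [set (a, b)])).
  split; first exact: subsetUl.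
  by move=> MU; apply: Ma; exists b; apply: MU; right.
split; last by move=> _ [/MAB//|->].
move=> p q [Mp|->] [Mq|->] //=; first exact: Minj.
  split=> [pa|pb]; first by case: Ma; exists p.2; rewrite -pa -surjective_pairing.
  by case: Mb; exists p.1; rewrite -pb -surjective_pairing.
split=> [pa|pb]; first by case: Ma; exists q.2; rewrite pa -surjective_pairing.
by case: Mb; exists q.1; rewrite pb -surjective_pairing.
Qed.

Lemma admissible_image (T T' : Type) (f : T -> T') (F : set T) :
  admissible K F -> admissible K (f @` F).
Proof. by apply: contra => /card_le_trans; apply; exact: card_image_le. Qed.

Lemma monadic_galactic_separation s (g : U (sPow s)) (S0 S1 : set (U s)) :
  monadic S0 -> galactic S1 -> S0 `<=` S1 -> S0 `<=` ext g ->
  exists C, S0 `<=` ext C /\ ext C `<=` S1.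
Proof.
move=> [F0 F0K S0E] [F1 F1K S1E] S01 S0g.
have [z zE] : internal (ext g `&` ~` ext g).
  by apply: internalI; [exists g|apply: internalC; exists g].
have z0 : ext z = set0 by rewrite -zE setICr.
have [J [p [q [JK pJ qJ p0 q1]]]] : exists (J : set (U (sPow s)))
    (p q : U (sPow s) -> U (sPow s)), [/\ admissible K J,
    forall j, J j -> S0 `<=` ext (p j), forall j, J j -> ext (q j) `<=` S1,
    forall a, F0 a -> exists2 j, J j & p j = a &
    forall b, F1 b -> exists2 j, J j & q j = b].
  have F0S a : F0 a -> S0 `<=` ext a.
    by move=> F0a; rewrite S0E => x; apply.
  have F1S b : F1 b -> ext b `<=` S1.
    by move=> F1b; rewrite S1E => x bx; exists b.
  have [M [Minj MF [tot|tot]]] := partial_matching F0 F1.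
    exists F1, (fun j => @xget {classic U (sPow s)} g [set a | M (a, j)]), id; split => //.
    - move=> j F1j; case: xgetP => [a _ /= Maj|_//].
      by apply: F0S; have [] := MF _ Maj.
    - move=> a F0a; have [b Mab] := tot a F0a.
      have [_ F1b] := MF _ Mab; exists b => //.
      case: xgetP => [a' _ /= Ma'b|/(_ a)//].
      by have /(_ erefl) := (Minj _ _ Ma'b Mab).2.
    - by move=> b F1b; exists b.
  exists F0, id, (fun j => @xget {classic U (sPow s)} z [set b | M (j, b)]); split => //.
  - move=> j F0j; case: xgetP => [b _ /= Mjb|_]; last by rewrite z0.
    by apply: F1S; have [] := MF _ Mjb.
  - by move=> a F0a; exists a.
  - move=> b F1b; have [a Mab] := tot b F1b.
    have [F0a _] := MF _ Mab; exists a => //.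
    case: xgetP => [b' _ /= Mab'|/(_ b)//].
    by have /(_ erefl) := (Minj _ _ Mab' Mab).1.
have /choice[d dE] : forall j, exists A, ext (p j) `&` ~` ext (q j) = ext A.
  by move=> j; apply: internalI; [exists (p j)|apply: internalC; exists (q j)].
apply: contrapT => noC.
have [|x xP] := @saturated K U s (d @` J) (admissible_image d JK); last first.
  have S0x : S0 x.
    rewrite S0E => a /p0[j Jj <-].
    have : ext (d j) x by apply: xP; exists j.
    by rewrite -dE => -[].
  have [b F1b bx] : (\bigcup_(A in F1) ext A) x by rewrite -S1E; exact: S01.
  have [j Jj qb] := q1 _ F1b.
  have : ext (d j) x by apply: xP; exists j.
  by rewrite -dE qb => -[].
move=> D finD DJ; apply/set0P/eqP => D0; apply: noC.
have [P [Q [S0P QS1 PQ]]] : exists P Q : U (sPow s),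
    [/\ S0 `<=` ext P, ext Q `<=` S1 &
        ext P `&` ~` ext Q `<=` \bigcap_(A in D) ext A].
  have /finite_seqP[l lD] := finD : finite_set (D : set {classic _}).
  have {DJ} : [set` l] `<=` d @` J by rewrite -lD.
  rewrite lD {D finD lD D0}; elim: l => [|a l IH] lJ.
    by exists g, z; split; rewrite ?z0.
  have [|P [Q [S0P QS1 PQ]]] := IH.
    by move=> x /= xl; apply: lJ; rewrite /= inE xl orbT.
  have [j Jj ja] : (d @` J) a by apply: lJ; rewrite /= inE eqxx.
  have [P' P'E] : internal (ext P `&` ext (p j)).
    by apply: internalI; [exists P|exists (p j)].
  have [Q' Q'E] : internal (~` (~` ext Q `&` ~` ext (q j))).
    by apply: internalC; apply: internalI; apply: internalC;
       [exists Q|exists (q j)].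
  exists P', Q'; split.
  - by rewrite -P'E subsetI; split => //; exact: pJ.
  - by rewrite -Q'E setCI !setCK subUset; split => //; exact: qJ.
  - rewrite -P'E -Q'E setCK => x [[Px px] [Qx qx]] A /=; rewrite inE.
    move=> /orP[/eqP ->|Al]; last exact: PQ.
    by rewrite -ja -dE.
exists P; split => // x Px; apply: QS1; apply: contrapT => nQx.
by have := PQ x (conj Px nQx); rewrite D0.
Qed.

End saturation.

Section internal_group.
Context (X : Type) (R : realType) (U : nsuniverse X R).

Definition app2 s t u (f : U (sFun s (sFun t u))) x y : U u := app (app f x) y.

(* Internal hyperfinite abelian groups: an internal set with internal
   operations.  The operations are internal functions on the whole sort, of
   which only the restriction to [gset] matters. *)
Record higroup := HIGroup {
  gsort : ssort;
  gset : U (sPow gsort);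
  gadd : U (sFun gsort (sFun gsort gsort));
  gzero : U gsort;
  gopp : U (sFun gsort gsort);
  gset0 : ext gset gzero;
  gsetN : forall x, ext gset x -> ext gset (app gopp x);
  gsetD : forall x y, ext gset x -> ext gset y -> ext gset (app2 gadd x y);
  gaddA : forall x y z, ext gset x -> ext gset y -> ext gset z ->
    app2 gadd x (app2 gadd y z) = app2 gadd (app2 gadd x y) z;
  gaddC : forall x y, ext gset x -> ext gset y ->
    app2 gadd x y = app2 gadd y x;
  gadd0 : forall x, ext gset x -> app2 gadd gzero x = x;
  gaddN : forall x, ext gset x -> app2 gadd (app gopp x) x = gzero;
  ghyperfinite : hyperfinite gset }.

Definition elt (G : higroup) : Type := {x : U (gsort G) | ext (gset G) x}.
HB.instance Definition _ G := gen_eqMixin (elt G).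
HB.instance Definition _ G := gen_choiceMixin (elt G).

Section elt_zmodType.
Context (G : higroup).
Implicit Types x y z : elt G.

Lemma elt_inj x y : sval x = sval y -> x = y.
Proof. exact: eq_sig_hprop. Qed.

Definition elt0 : elt G := exist _ _ (gset0 G).
Definition eltN x : elt G := exist _ _ (gsetN (svalP x)).
Definition eltD x y : elt G := exist _ _ (gsetD (svalP x) (svalP y)).

Lemma eltDA : associative eltD.
Proof. by move=> x y z; apply: elt_inj; apply: gaddA; exact: svalP. Qed.
Lemma eltDC : commutative eltD.
Proof. by move=> x y; apply: elt_inj; apply: gaddC; exact: svalP. Qed.
Lemma elt0D : left_id elt0 eltD.
Proof. by move=> x; apply: elt_inj; apply: gadd0; exact: svalP. Qed.
Lemma eltND : left_inverse elt0 eltN eltD.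
Proof. by move=> x; apply: elt_inj; apply: gaddN; exact: svalP. Qed.

HB.instance Definition _ := GRing.isZmodule.Build (elt G) eltDA eltDC elt0D eltND.
End elt_zmodType.

(* The trace on V of the internal sets, along an embedding i of V in U s. *)
Definition internal_in s (V : Type) (i : V -> U s) (S : set V) : Prop :=
  exists A : U (sPow s), S = i @^-1` ext A.

End internal_group.

Section trace.
Context (V : zmodType).

Definition subgroup (A : set V) : Prop :=
  A 0 /\ forall x y, A x -> A y -> A (x - y).

(* Two subgroups lower <= upper, and the quotient upper / lower. *)
Record subpair := SubPair {
  lower : set V;
  upper : set V;
  lower_upper : lower `<=` upper;
  lower_subgroup : subgroup lower;
  upper_subgroup : subgroup upper }.

Context (P : subpair).

Definition upper_pred : {pred V} := fun x => x \in upper P.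

Lemma upper_zmod_closed : zmod_closed upper_pred.
Proof.
have [P0 PB] := upper_subgroup P.
split=> [|x y /set_mem Px /set_mem Py]; first exact/mem_set.
by apply/mem_set; exact: PB.
Qed.
HB.instance Definition _ := GRing.isZmodClosed.Build V upper_pred
  upper_zmod_closed.

Definition upperT : Type := {x : V | upper_pred x}.
HB.instance Definition _ := [isSub of upperT for @sval V upper_pred].
HB.instance Definition _ := [Choice of upperT by <:].
HB.instance Definition _ := [SubChoice_isSubZmodule of upperT by <:].

Definition lower_pred : {pred upperT} := fun x => val x \in lower P.

Lemma lower_zmod_closed : zmod_closed lower_pred.
Proof.
have [P0 PB] := lower_subgroup P.
split=> [|x y /set_mem Px /set_mem Py]; first exact/mem_set.
by apply/mem_set; exact: PB.
Qed.
HB.instance Definition _ := GRing.isZmodClosed.Build upperT lower_pred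
  lower_zmod_closed.

Definition trace : Type := Quotient.quot lower_pred.
HB.instance Definition _ := GRing.Zmodule.on trace.
HB.instance Definition _ := EqQuotient.on trace.

Definition cls (x : upperT) : trace := \pi x.

(* [int] is the family of internal subsets of V. *)
Definition trace_open (int : set V -> Prop) (Y : set trace) : Prop :=
  forall x : upperT, Y (cls x) -> exists2 A : set V, int A &
    [set val x + z | z in lower P] `<=` A /\
    A `<=` [set val y | y in [set y : upperT | Y (cls y)]].

End trace.

Section triplets.
Context (X : Type) (R : realType) (K : Type) (U : satuniverse X R K).

(* (G, G_0, G_f) with G_0 = lower and G_f = upper. *)
Record triplet := Triplet {
  ambient :> higroup U;
  pair0f : subpair (elt ambient);
  lower_monadic : monadic (sval @` lower pair0f);
  upper_galactic : galactic (sval @` upper pair0f) }.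

Section triplet_theory.
Context (T : triplet).
Local Notation G := (elt T).
Local Notation G0 := (lower (pair0f T)).
Local Notation Gf := (upper (pair0f T)).

Definition internalG : set G -> Prop := @internal_in X R U _ G sval.

Definition condensing : Prop :=
  forall A B : set G, internalG A -> A `<=` Gf ->
    internalG B -> G0 `<=` B -> (forall x, B x -> B (- x)) ->
    exists2 D : set G, finite_set D & A `<=` \bigcup_(d in D) [set d + b | b in B].

Definition obs : Type := trace (pair0f T).
HB.instance Definition _ := GRing.Zmodule.on obs.

Definition obs_open : set_system obs := trace_open internalG.

Lemma internalG_shift (x : G) (A : set G) :
  internalG A -> internalG [set x + a | a in A].
Proof.
move=> [a ->].
have [b bE] : internal (app (app (gadd T) (app (gopp T) (sval x))) @^-1` ext a).
  by apply: internal_preim; exists a.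
exists b; rewrite -bE; apply/seteqP; split=> [_ [y ay <-] /=|y /= ay].
  suff -> : app (app (gadd T) (app (gopp T) (sval x))) (sval (x + y)) = sval y.
    by [].
  by rewrite -[LHS]/(sval (- x + (x + y))) addKr.
by exists (- x + y); rewrite ?addNKr.
Qed.

Lemma obs_openT : obs_open setT.
Proof.
move=> x _.
have [||C [G0C CGf]] := monadic_galactic_separation (g := gset T)
    (lower_monadic T) (upper_galactic T).
- by move=> _ [y /lower_upper Gy <-]; exists y.
- by move=> _ [y _ <-]; exact: svalP.
exists [set val x + a | a in sval @^-1` ext C].
  by apply: internalG_shift; exists C.
split=> [_ [z G0z <-]|_ [a /= Ca <-]].
  by exists z => //; apply: G0C; exists z.
have [y Gfy ya] := CGf _ Ca.
have {ya}Gfa : Gf a by rewrite -(elt_inj ya).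
have h : upper_pred (pair0f T) a by exact: mem_set.
by exists (x + exist _ a h).
Qed.

Lemma obs_openI : setI_closed obs_open.
Proof.
move=> Y Z oY oZ x [Yx Zx].
have [_ [a ->] [xa aY]] := oY x Yx; have [_ [b ->] [xb bZ]] := oZ x Zx.
have [c cE] : internal (ext a `&` ext b).
  by apply: internalI; [exists a|exists b].
exists (sval @^-1` ext c); first by exists c.
rewrite -cE; split=> [y xy|y [/aY[u Yu uy] /bZ[v Zv vy]]].
  by split; [exact: xa|exact: xb].
exists u => //; split => //.
by have -> : u = v by apply: val_inj; rewrite /= uy vy.
Qed.

Lemma obs_open_bigU (I : Type) (f : I -> set obs) :
  (forall i, obs_open (f i)) -> obs_open (\bigcup_i f i).
Proof.
move=> fo x [i _ fix_]; have [A iA [xA Af]] := fo i x fix_.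
by exists A => //; split=> // y /Af[u fu uy]; exists u => //; exists i.
Qed.

HB.instance Definition _ := EqQuotient.on obs.
HB.instance Definition _ := Choice.on obs.
HB.instance Definition _ :=
  isOpenTopological.Build obs obs_openT obs_openI obs_open_bigU.

End triplet_theory.
End triplets.

Definition unit_circle (R : realType) : set R[i]^o := [set z | `|z| = 1].
Arguments unit_circle R : clear implicits.

Section dual.
Context (X : Type) (R : realType) (U : nsuniverse X R).
Local Notation El := (El X R).
Local Notation v0 := (vz _ _).
Local Notation v1 := (vs _ v0).
Local Notation v2 := (vs _ v1).
Local Notation v3 := (vs _ v2).
Local Notation v4 := (vs _ v3).
Local Notation v5 := (vs _ v4).
Local Notation v6 := (vs _ v5).

Definition cmul (a b : U sCplx) : U sCplx :=
  @fun_star _ _ U [:: sCplx; sCplx] sCplx (fun e => e.1 * e.2.1) (a, (b, tt)).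

Definition in_circle (z : U sCplx) : Prop :=
  @rel_star _ _ U [:: sCplx] (fun e => unit_circle R e.1) (z, tt).

(* The relation |a - b| < ε is taken in *C, for every standard ε > 0. *)
Definition approx (a b : U sCplx) : Prop := forall ε : R, 0 < ε ->
  @rel_star _ _ U [:: sCplx; sCplx] (fun e => `|e.1 - e.2.1| < ε%:C) (a, (b, tt)).

(* The value is 0 when a has no standard part; standard parts are unique. *)
Definition stdpart (a : U sCplx) : R[i] :=
  xget 0 [set c | approx a (star U sCplx c)].

Definition cinv (a : U sCplx) : U sCplx :=
  @fun_star _ _ U [:: sCplx] sCplx (fun e => e.1^-1) (a, tt).

Local Notation cone := (star U sCplx 1).

Lemma fun_star_const s (c : El s) : @fun_star _ _ U [::] s (fun=> c) tt = star U s c.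
Proof.
exact: (elementary U (@fFun X R [:: s] [::] s (fun=> c) tt v0) (c, tt)).2.
Qed.

Local Notation C := sCplx.
Local Notation fM x y z :=
  (@fFun X R _ [:: C; C] C (fun e => e.1 * e.2.1) (x, (y, tt)) z).
Local Notation fV x y := (@fFun X R _ [:: C] C (fun e => e.1^-1) (x, tt) y).
Local Notation f1 x := (@fFun X R _ [::] C (fun=> 1) tt x).
Local Notation fT x := (@fRel X R _ [:: C] (fun e => unit_circle R e.1) (x, tt)).
Local Notation fN ε x y :=
  (@fRel X R _ [:: C; C] (fun e => `|e.1 - e.2.1| < ε%:C) (x, (y, tt))).
Local Notation fA s f x y :=
  (@fFun X R _ [:: sFun s C; s] C (fun e => e.1 e.2.1) (f, (x, tt)) y).

Lemma cmulA : associative cmul.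
Proof.
move=> a b c; pose Γ := [:: C; C; C; C; C; C].
have := @transfer X R U Γ
  (fImp (fM v1 v2 v3) (fImp (fM v0 v3 v4) (fImp (fM v0 v1 v5)
    (fM v5 v2 v4)))) _
  (a, (b, (c, (cmul b c, (cmul a (cmul b c), (cmul a b, tt)))))).
move=> /= h; apply/esym/h => //.
by move=> [? [? [? [? [? [? []]]]]]] /= <- <- <-; rewrite mulrA.
Qed.

Lemma cmulC : commutative cmul.
Proof.
move=> a b; pose Γ := [:: C; C; C].
have := @transfer X R U Γ (fImp (fM v0 v1 v2) (fM v1 v0 v2)) _
  (a, (b, (cmul a b, tt))).
move=> /= h; apply/esym/h => //.
by move=> [? [? [? []]]] /= <-; rewrite mulrC.
Qed.

Lemma cmul1 : left_id cone cmul.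
Proof.
move=> a; pose Γ := [:: C; C].
have := @transfer X R U Γ (fImp (f1 v1) (fM v1 v0 v0)) _ (a, (cone, tt)).
move=> /=; apply; last exact: fun_star_const.
by move=> [? [? []]] /= <-; rewrite mul1r.
Qed.

Lemma cmulV a : in_circle a -> cmul (cinv a) a = cone.
Proof.
pose Γ := [:: C; C; C].
have := @transfer X R U Γ
  (fImp (fV v0 v1) (fImp (f1 v2) (fImp (fT v0) (fM v1 v0 v2)))) _
  (a, (cinv a, (cone, tt))).
move=> /=; apply => //; last exact: fun_star_const.
move=> [z [? [? []]]] /= <- <- z1; rewrite mulVf // -normr_eq0 z1.
exact: oner_neq0.
Qed.

Lemma cinvM a b : cinv (cmul a b) = cmul (cinv a) (cinv b).
Proof.
pose Γ := [:: C; C; C; C; C; C].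
have := @transfer X R U Γ
  (fImp (fM v0 v1 v2) (fImp (fV v0 v3) (fImp (fV v1 v4) (fImp (fV v2 v5)
    (fM v3 v4 v5))))) _
  (a, (b, (cmul a b, (cinv a, (cinv b, (cinv (cmul a b), tt)))))).
move=> /= h; apply/esym/h => //.
by move=> [? [? [? [? [? [? []]]]]]] /= <- <- <- <-; rewrite invfM.
Qed.

Lemma in_circle1 : in_circle cone.
Proof.
have := @transfer X R U [:: C] (fImp (f1 v0) (fT v0)) _ (cone, tt).
move=> /=; apply; last exact: fun_star_const.
by move=> [? []] /= <-; exact: normr1.
Qed.

Lemma in_circleM a b : in_circle a -> in_circle b -> in_circle (cmul a b).
Proof.
have := @transfer X R U [:: C; C; C]
  (fImp (fM v0 v1 v2) (fImp (fT v0) (fImp (fT v1) (fT v2)))) _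
  (a, (b, (cmul a b, tt))).
move=> /=; apply => //.
move=> [x [y [? []]]] /= <-; rewrite /unit_circle /= => x1 y1.
by rewrite normrM x1 y1 mulr1.
Qed.

Lemma in_circleV a : in_circle a -> in_circle (cinv a).
Proof.
have := @transfer X R U [:: C; C]
  (fImp (fV v0 v1) (fImp (fT v0) (fT v1))) _ (a, (cinv a, tt)).
move=> /=; apply => //.
by move=> [x [? []]] /= <-; rewrite /unit_circle /= => x1; rewrite normfV x1 invr1.
Qed.

Lemma cinv1 : cinv cone = cone.
Proof. by rewrite -[LHS]cmul1 cmulC cmulV //; exact: in_circle1. Qed.

Lemma approx11 : approx cone cone.
Proof.
move=> ε ε0; have := @transfer X R U [:: C] (fN ε v0 v0) _ (cone, tt).
by move=> /=; apply; move=> [x []] /=; rewrite subrr normr0 ltcR.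
Qed.

Lemma approx_div a b : in_circle b -> approx a cone -> approx b cone ->
  approx (cmul a (cinv b)) cone.
Proof.
move=> b1 a1 bb1 ε ε0; have e20 : 0 < ε / 2 by rewrite divr_gt0.
have := @transfer X R U [:: C; C; C; C; C]
  (fImp (f1 v0) (fImp (fV v2 v3) (fImp (fM v1 v3 v4) (fImp (fT v2)
    (fImp (fN (ε / 2) v1 v0) (fImp (fN (ε / 2) v2 v0) (fN ε v4 v0))))))) _
  (cone, (a, (b, (cinv b, (cmul a (cinv b), tt))))).
move=> /=; apply => //; [|exact: fun_star_const|exact: a1|exact: bb1].
move=> [? [x [y [? [? []]]]]] /= <- <- <-; rewrite /unit_circle /= => y1 xe ye.
have y0 : y != 0 by rewrite -normr_eq0 y1 oner_neq0.
have -> : x / y - 1 = (x - y) / y by rewrite mulrBl divff.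
rewrite normrM normfV y1 invr1 mulr1.
rewrite (le_lt_trans (ler_distD 1 x y)) // (distrC 1 y).
rewrite [ε](splitr ε) rmorphD /=.
exact: ltrD.
Qed.

Definition fmul s (f g : U (sFun s C)) : U (sFun s C) :=
  @fun_star _ _ U [:: sFun s C; sFun s C] (sFun s C)
    (fun e x => e.1 x * e.2.1 x) (f, (g, tt)).

Definition finv s (f : U (sFun s C)) : U (sFun s C) :=
  @fun_star _ _ U [:: sFun s C] (sFun s C) (fun e x => (e.1 x)^-1) (f, tt).

Definition fone s : U (sFun s C) := star U (sFun s C) (fun=> 1).

Lemma app_fmul s (f g : U (sFun s C)) x :
  app (fmul f g) x = cmul (app f x) (app g x).
Proof.
have := @transfer X R U [:: s; sFun s C; sFun s C; sFun s C; C; C; C]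
  (fImp (@fFun X R _ [:: sFun s C; sFun s C] (sFun s C)
    (fun e x => e.1 x * e.2.1 x) (v1, (v2, tt)) v3)
    (fImp (fA s v1 v0 v4) (fImp (fA s v2 v0 v5) (fImp (fM v4 v5 v6)
    (fA s v3 v0 v6))))) _
  (x, (f, (g, (fmul f g, (app f x, (app g x,
    (cmul (app f x) (app g x), tt))))))).
move=> /=; apply => //.
by move=> [? [? [? [? [? [? [? []]]]]]]] /= <- <- <- <-.
Qed.

Lemma app_finv s (f : U (sFun s C)) x : app (finv f) x = cinv (app f x).
Proof.
have := @transfer X R U [:: s; sFun s C; sFun s C; C; C]
  (fImp (@fFun X R _ [:: sFun s C] (sFun s C)
    (fun e x => (e.1 x)^-1) (v1, tt) v2)
    (fImp (fA s v1 v0 v3) (fImp (fV v3 v4) (fA s v2 v0 v4)))) _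
  (x, (f, (finv f, (app f x, (cinv (app f x), tt))))).
move=> /=; apply => //.
by move=> [? [? [? [? [? []]]]]] /= <- <- <-.
Qed.

Lemma app_fone s x : app (fone s) x = cone.
Proof.
have := @transfer X R U [:: s; sFun s C; C]
  (fImp (@fFun X R _ [::] (sFun s C) (fun=> fun=> 1) tt v1)
    (fImp (f1 v2) (fA s v1 v0 v2))) _ (x, (fone s, (cone, tt))).
move=> /=; apply; rewrite ?fun_star_const //.
by move=> [? [? [? []]]] /= <- <-.
Qed.

Section chars.
Context (G : higroup U).

(* Internal homomorphisms G -> *T are coded as internal functions on the whole
   sort of G, normalized to be 1 outside G so that the coding is one-to-one. *)
Definition is_char (γ : U (sFun (gsort G) sCplx)) : Prop :=
  [/\ forall x, in_circle (app γ x),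
      forall x, ~ ext (gset G) x -> app γ x = cone &
      forall x y, ext (gset G) x -> ext (gset G) y ->
        app γ (app2 (gadd G) x y) = cmul (app γ x) (app γ y)].

(* The internal dual group; like every abelian group here it is a zmodType, so
   its pointwise multiplication is written additively. *)
Definition char : Type := {γ : U (sFun (gsort G) sCplx) | is_char γ}.
HB.instance Definition _ := gen_eqMixin char.
HB.instance Definition _ := gen_choiceMixin char.

Lemma char_inj (γ δ : char) :
  (forall x, app (sval γ) x = app (sval δ) x) -> γ = δ.
Proof. by move=> /app_inj; exact: eq_sig_hprop. Qed.

Lemma char1_subproof : is_char (fone (gsort G)).
Proof.
split=> *; rewrite !app_fone ?cmul1 //; exact: in_circle1.
Qed.

Lemma charV_subproof (γ : char) : is_char (finv (sval γ)).
Proof.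
have [γ1 γ2 γ3] := svalP γ.
split=> [x|x Gx|x y Gx Gy]; rewrite !app_finv; first exact: in_circleV.
  by rewrite γ2 // cinv1.
by rewrite γ3 // cinvM.
Qed.

Lemma charM_subproof (γ δ : char) : is_char (fmul (sval γ) (sval δ)).
Proof.
have [γ1 γ2 γ3] := svalP γ; have [δ1 δ2 δ3] := svalP δ.
split=> [x|x Gx|x y Gx Gy]; rewrite !app_fmul; first exact: in_circleM.
  by rewrite γ2 // δ2 // cmul1.
rewrite γ3 // δ3 // -!cmulA; congr cmul.
by rewrite !cmulA [X in cmul X _]cmulC.
Qed.

Definition char1 : char := exist _ _ char1_subproof.
Definition charV γ : char := exist _ _ (charV_subproof γ).
Definition charM γ δ : char := exist _ _ (charM_subproof γ δ).

Lemma charMA : associative charM.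
Proof. by move=> *; apply: char_inj => x; rewrite /= !app_fmul cmulA. Qed.
Lemma charMC : commutative charM.
Proof. by move=> *; apply: char_inj => x; rewrite /= !app_fmul cmulC. Qed.
Lemma char1M : left_id char1 charM.
Proof.
by move=> *; apply: char_inj => x; rewrite /= app_fmul app_fone cmul1.
Qed.
Lemma charVM : left_inverse char1 charV charM.
Proof.
move=> γ; apply: char_inj => x; rewrite /= app_fmul app_finv app_fone cmulV //.
by have [] := svalP γ.
Qed.
HB.instance Definition _ :=
  GRing.isZmodule.Build char charMA charMC char1M charVM.

(* The set A^~ of internal characters infinitesimally close to 1 on A. *)
Definition polar (A : set (elt G)) : set char :=
  [set γ | forall a, A a -> approx (app (sval γ) (sval a)) cone].

Lemma polar_subgroup A : subgroup (polar A).
Proof.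
split=> [a _|γ δ γA δA a Aa] /=; first by rewrite app_fone; exact: approx11.
rewrite app_fmul app_finv; apply: approx_div; [|exact: γA|exact: δA].
by have [] := svalP δ.
Qed.

Lemma polarS A B : A `<=` B -> polar B `<=` polar A.
Proof. by move=> AB γ γB a /AB; exact: γB. Qed.

(* (G_f^~, G_0^~), where G_0 = lower P and G_f = upper P. *)
Definition dual_pair (P : subpair (elt G)) : subpair char :=
  SubPair (polarS (@lower_upper _ P)) (polar_subgroup (upper P))
    (polar_subgroup (lower P)).

Definition internal_char : set char -> Prop := @internal_in X R U _ char sval.

End chars.
End dual.

Definition circle (R : realType) : Type := unit_circle R.
HB.instance Definition _ (R : realType) := Topological.on (circle R).

Section circle.
Context (R : realType).

Definition cval (z : circle R) : R[i]^o := set_val z.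

Lemma cvalP (z : circle R) : `|cval z| = 1.
Proof. exact: (@set_valP _ (unit_circle R) z). Qed.

Lemma cval_inj : injective cval.
Proof. exact: (@val_inj _ _ (set_type (unit_circle R))). Qed.

Definition circle_of (z : R[i]^o) (z1 : unit_circle R z) : circle R :=
  exist _ z (mem_set z1).

End circle.

Section pontryagin.
Context (R : realType) (A : PreTopologicalZmodule.type).

Definition continuous_char : set {compact-open, A -> circle R} :=
  [set χ | continuous (χ : A -> circle R) /\
           forall x y, cval (χ (x + y)) = cval (χ x) * cval (χ y)].

(* The dual group, with the subspace topology of the compact-open topology. *)
Definition pontryagin : Type := continuous_char.
HB.instance Definition _ := Topological.on pontryagin.

Definition pval (χ : pontryagin) : A -> circle R := set_val χ.

Lemma pvalP (χ : pontryagin) : continuous_char (pval χ).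
Proof. exact: (@set_valP _ continuous_char χ). Qed.

Lemma pval_inj (χ ξ : pontryagin) :
  (forall x, cval (pval χ x) = cval (pval ξ x)) -> χ = ξ.
Proof.
move=> h; apply: (@val_inj _ _ (set_type continuous_char)).
by apply/funext => x; apply: cval_inj; exact: h.
Qed.

Lemma mul_subproof (χ ξ : pontryagin) x :
  unit_circle R (cval (pval χ x) * cval (pval ξ x)).
Proof. by rewrite /unit_circle /= normrM !cvalP mulr1. Qed.
Lemma inv_subproof (χ : pontryagin) x : unit_circle R (cval (pval χ x))^-1.
Proof. by rewrite /unit_circle /= normfV cvalP invr1. Qed.
Lemma one_subproof : unit_circle R 1.
Proof. exact: normr1. Qed.

Definition chi_mul (χ ξ : pontryagin) : {compact-open, A -> circle R} :=
  fun x => circle_of (mul_subproof χ ξ x).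
Definition chi_inv (χ : pontryagin) : {compact-open, A -> circle R} :=
  fun x => circle_of (inv_subproof χ x).
Definition chi_one : {compact-open, A -> circle R} :=
  fun=> circle_of one_subproof.

Lemma continuous_circle (f : A -> circle R) :
  continuous (fun x => cval (f x)) -> continuous f.
Proof.
move=> cf; apply/continuousP => _ [B oB <-].
by move/continuousP : cf => /(_ _ oB).
Qed.

Lemma continuous_val (χ : pontryagin) :
  continuous (fun x => cval (pval χ x)).
Proof.
have [cχ _] := pvalP χ.
move=> x; apply: (@continuous_comp _ _ _ (pval χ) (@cval R)).
  exact: cχ.
exact: initial_continuous.
Qed.

Lemma chi_mulP χ ξ : continuous_char (chi_mul χ ξ).
Proof.
split=> [|x y]; last first.
  rewrite -[LHS]/(cval (pval χ (x + y)) * cval (pval ξ (x + y))).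
  by rewrite (pvalP χ).2 (pvalP ξ).2 mulrACA.
apply: continuous_circle => x.
exact: (cvgM (@continuous_val χ x) (@continuous_val ξ x)).
Qed.

Lemma chi_invP χ : continuous_char (chi_inv χ).
Proof.
split=> [|x y]; last first.
  by rewrite -[LHS]/(cval (pval χ (x + y)))^-1 (pvalP χ).2 invfM.
apply: continuous_circle => x.
apply: (cvgV _ (@continuous_val χ x)).
by rewrite -normr_eq0 cvalP oner_neq0.
Qed.

Lemma chi_oneP : continuous_char chi_one.
Proof. by split=> [x|x y]; [exact: cvg_cst|exact/esym/mulr1]. Qed.

Definition pont (χ : {compact-open, A -> circle R}) (χP : continuous_char χ) :
  pontryagin := exist _ χ (mem_set χP).
Definition pmul χ ξ := pont (chi_mulP χ ξ).
Definition pinv χ := pont (chi_invP χ).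
Definition pone := pont chi_oneP.

Lemma pmulA : associative pmul.
Proof. by move=> ? ? ?; apply: pval_inj => x; exact: mulrA. Qed.
Lemma pmulC : commutative pmul.
Proof. by move=> ? ?; apply: pval_inj => x; exact: mulrC. Qed.
Lemma pmul1 : left_id pone pmul.
Proof. by move=> ?; apply: pval_inj => x; exact: mul1r. Qed.
Lemma pmulV : left_inverse pone pinv pmul.
Proof.
move=> χ; apply: pval_inj => x; apply: mulVf.
by rewrite -normr_eq0 cvalP oner_neq0.
Qed.
HB.instance Definition _ := GRing.isZmodule.Build pontryagin pmulA pmulC pmul1 pmulV.

End pontryagin.

Section dual_triplet.
Context (X : Type) (R : realType) (K : Type) (U : satuniverse X R K).
Context (T : triplet U).

Definition dual_obs : Type := trace (dual_pair (pair0f T)).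
HB.instance Definition _ := GRing.Zmodule.on dual_obs.

Definition dual_obs_open : set (set dual_obs) := trace_open (@internal_char X R U T).

End dual_triplet.

(* Main.v *)
Require Import Defs.
From HB Require Import structures.
From mathcomp Require Import all_boot all_order all_algebra complex spectral.
From mathcomp Require Import all_classical all_reals all_analysis.
From mathcomp Require Import zify ring lra.
Set Implicit Arguments.
Unset Strict Implicit.
Unset Printing Implicit Defensive.
Import Order.TTheory GRing.Theory Num.Theory.

(** The canonical map is easily seen to be a well defined injective
    homomorphism.  Its surjectivity is the heart of the matter: a continuous
    character χ of G_f/G_0 has to be lifted to an internal character of G.  It
    rests on a stability property of finite abelian groups
    ([finite_stability]), proved by Fourier analysis.  Let A be a subset of a
    finite abelian group, containing 0, such that A + A is covered by k
    translates of A.  If f is unimodular and almost multiplicative on a large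
    multiple NA, then f is close on A to a genuine character; N and the
    tolerance depend on k and on the desired precision only.

    For the proof let nA be the n-fold sum of A.  By orthogonality of characters
    the sum over all characters g of F(g)^2 H(g)^*, where F and H are the Fourier
    transforms of f on nA and on 2nA, is essentially |G| |nA|^2, while Parseval
    bounds it by |G| |nA| max |H|.  Hence some g correlates with f on 2nA: the
    sum of f g^* over 2nA has modulus at least |nA|/2
    ([correlated_character]).  Translating that sum by a in A multiplies it by
    almost f(a) g(a)^*, but changes it only by the boundary of 2nA; so g(a) is
    close to f(a) as soon as |(2n+1)A| - |2nA| is small compared with |nA|
    ([correlation_invariance]).  As A + A is covered by k translates of A, the
    group being abelian makes |nA| grow at most like n^k, and some bounded scale
    n is of this kind ([pigeonhole_growth]).

    By transfer the same holds for internal hyperfinite G, internal A and f and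
    standard k ([internal_stability]).  The condensing property provides, for
    each symmetric internal A with G_0 <= A <= G_f, a finite k as above, and an
    internal f approximating χ on a multiple of A, since such a multiple is
    covered by finitely many translates of a neighbourhood of G_0 on which χ is
    nearly 1.  So χ is approximated on each internal subset of G_f, hence by
    saturation on all of G_f, by one internal character.  A fixed precision suffices: a
    homomorphism from G_f to the circle that stays within 1/2 of 1 is trivial,
    because the circle has no small subgroups ([no_small_subgroup]).

    For the topologies the point is that the images of internal subsets of G_f
    are compact ([flat_compact]) and absorb every compact set
    ([compact_flat_set]).  Therefore the compact-open neighbourhoods of the image
    of γ correspond to the internal sets of all characters that are close to γ
    on an internal subset of G_f; saturation shows that these are cofinal among
    the internal sets containing γ + G_f^~, and the absence of small subgroups
    that they are contained in G_0^~ once that subset contains G_0. *)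

(** * Growth of sumsets *)

(** If the boundary from 2n to 2n + 1 were large at every scale, summing it for n
    in [L, 2L) would give m s(4L) >= L s(L); as soon as L >= 2 m 4^k this makes s
    grow by the factor 2 * 4^k from L to 4L, which beats the growth n^k. *)
Lemma pigeonhole_growth (k m : nat) : 0 < m -> exists N, forall s : nat -> nat,
  (forall i j, i <= j -> s i <= s j) -> 0 < s 1 ->
  (forall i, s i.+1 <= i.+1 ^ k * s 1) ->
  exists n, [/\ 0 < n, n <= N & m * (s n.*2.+1 - s n.*2) <= s n].
Proof.
move=> m0; pose M := m * (2 * 4 ^ k); pose j := M ^ k.
have M0 : 0 < M by rewrite !muln_gt0 m0 expn_gt0.
exists (2 * (4 ^ j * M)) => s sm s1 sk.
have [/existsP[n nP]|] := boolP [exists n : 'I_(2 * (4 ^ j * M)).+1,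
    (0 < n) && (m * (s n.*2.+1 - s n.*2) <= s n)].
  by exists n; case/andP: nP => ? ?; split=> //; rewrite -ltnS.
rewrite negb_exists => /forallP H.
have {}H n : 0 < n -> n <= 2 * (4 ^ j * M) -> s n < m * (s n.*2.+1 - s n.*2).
  by move=> n0 nN; have := H (inord n); rewrite !inordK // n0 /= -ltnNge.
(* The failures at L, L + 1, ..., L + i - 1 add up. *)
have step L i : 0 < L -> L + i <= 2 * (4 ^ j * M) ->
    i * s L <= m * (s (L + i).*2 - s L.*2).
  move=> L0; elim: i => [|i IH] Li; first by rewrite mul0n.
  have {}IH : i * s L <= m * (s (L + i).*2 - s L.*2) by apply: IH; lia.
  have h := H (L + i) ltac:(lia) ltac:(lia).
  have e1 : s L.*2 <= s (L + i).*2 by apply: sm; lia.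
  have e2 : s (L + i).*2 <= s (L + i).*2.+1 by apply: sm; lia.
  have e3 : s (L + i).*2.+1 <= s (L + i.+1).*2 by apply: sm; lia.
  have e4 : s L <= s (L + i) by apply: sm; lia.
  have : i * s L + s L <= m * (s (L + i).*2 - s L.*2) + m * (s (L + i).*2.+1 - s (L + i).*2) by lia.
  rewrite -mulSnr -mulnDr => /leq_trans; apply.
  by rewrite leq_mul2l; apply/orP; right; lia.
(* Iteration along the scales 4^i M, where M = 2 m 4^k. *)
have dbl i : i <= j -> (2 * 4 ^ k) ^ i * s M <= s (4 ^ i * M).
  elim: i => [|i IH] ij; first by rewrite !expn0 !mul1n.
  have {}IH := IH (ltnW ij).
  have L0 : 0 < 4 ^ i * M by rewrite muln_gt0 expn_gt0.
  have LN : 4 ^ i * M <= 4 ^ j * M by rewrite leq_mul2r leq_pexp2l ?orbT // ltnW.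
  have := step _ (4 ^ i * M) L0 ltac:(lia).
  have -> : (4 ^ i * M + 4 ^ i * M).*2 = 4 ^ i.+1 * M by rewrite expnS; lia.
  move=> h.
  have h2 : 4 ^ i * M * s (4 ^ i * M) <= m * s (4 ^ i.+1 * M).
    by apply: (leq_trans h); rewrite leq_mul2l leq_subr orbT.
  have h3 : M * s (4 ^ i * M) <= m * s (4 ^ i.+1 * M).
    apply: leq_trans h2; rewrite leq_mul2r; apply/orP; right.
    by rewrite leq_pmull // expn_gt0.
  rewrite -(leq_pmul2l m0); apply: leq_trans h3.
  apply: leq_trans (leq_mul (leqnn M) IH).
  by rewrite /M expnS !mulnA.
have := dbl j (leqnn _).
have Lj : 0 < 4 ^ j * M by rewrite muln_gt0 expn_gt0.
have := sk (4 ^ j * M).-1; rewrite prednK // => h1 /leq_trans /(_ h1).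
have -> : (4 ^ j * M) ^ k * s 1 = (4 ^ k) ^ j * (M ^ k * s 1).
  by rewrite expnMn -!expnM [j * k]mulnC -mulnA.
rewrite expnMn [X in X <= _]mulnAC [X in X <= _]mulnC leq_pmul2l ?expn_gt0 // => h.
have sM : s 1 <= s M by apply: sm.
have : 2 ^ j * s 1 <= M ^ k * s 1.
  by apply: leq_trans h; rewrite leq_mul2l sM orbT.
by rewrite leq_pmul2r // leqNgt ltn_expl.
Qed.

Local Open Scope ring_scope.

(** * Fourier analysis on finite abelian groups *)

Definition unitary_hom (C : numClosedFieldType) (V : zmodType) (g : V -> C) :=
  (forall x, `|g x| = 1) /\ forall x y, g (x + y) = g x * g y.

Section characters.
Context (C : numClosedFieldType) (V : finZmodType).

(** Translation by x permutes the factors of the product of all values of g, so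
    g(x)^|V| = 1. *)
Lemma multiplicative_unitary_hom (g : V -> C) : g 0 = 1 ->
  (forall x y, g (x + y) = g x * g y) -> unitary_hom g.
Proof.
move=> g0 gD; split=> // x.
have gn0 y : g y != 0.
  apply/eqP => y0; have := gD y (- y); rewrite subrr g0 y0 mul0r => /eqP.
  by rewrite oner_eq0.
have : \prod_(y : V) g y = g x ^+ #|V| * \prod_(y : V) g y.
  rewrite {1}(reindex_inj (addrI x)) -prodr_const -big_split /=.
  by apply: eq_bigr => y _; rewrite gD.
move/eqP; rewrite -[X in X == _]mul1r (inj_eq (mulIf _)); last first.
  by apply/prodf_neq0 => y _; exact: gn0.
move=> /eqP /esym gx; apply/eqP.
rewrite -(@pexpr_eq1 _ _ #|V|) //; first by rewrite -normrX gx normr1.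
by apply/card_gt0P; exists 0.
Qed.

Definition translation_mx (x : V) : 'M[C]_#|V| :=
  \matrix_(i, j) (enum_val j == enum_val i + x)%:R.

Lemma translation_mxD x y :
  translation_mx (x + y) = translation_mx x *m translation_mx y.
Proof.
apply/matrixP => i j; rewrite !mxE.
rewrite (bigD1 (enum_rank (enum_val i + x))) //= !mxE enum_rankK eqxx mul1r.
rewrite big1 ?addr0 ?addrA // => l li; rewrite !mxE.
case: eqP => [e|_]; last by rewrite mul0r.
by move: li; rewrite -e enum_valK eqxx.
Qed.

Lemma translation_mx0 : translation_mx 0 = 1%:M.
Proof.
apply/matrixP => i j; rewrite !mxE addr0.
by rewrite (inj_eq enum_val_inj) eq_sym.
Qed.

Lemma translation_mx_trace x : \tr (translation_mx x) = (#|V| * (x == 0))%:R.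
Proof.
rewrite /mxtrace (eq_bigr (fun=> (x == 0)%:R)); last first.
  by move=> i _; rewrite mxE addrC -subr_eq subrr eq_sym.
by rewrite sumr_const card_ord natrM mulr_natl.
Qed.

(** The translation operators commute, hence are simultaneously triangular in a
    suitable basis.  Each diagonal entry is then a character, and the
    orthogonality relation is the computation of a trace.  The family may list a
    character several times; only the sum relation is used. *)
Lemma enough_characters : exists g : 'I_#|V| -> V -> C,
  (forall i, unitary_hom (g i)) /\
  (forall x, \sum_i g i x = (#|V| * (x == 0))%:R).
Proof.
pose As := [seq translation_mx x | x : V].
have [|P Pu /allP PA] := @cotrigonalization C _ As.
  move=> _ _ /mapP[x _ ->] /mapP[y _ ->].
  by rewrite /comm_mx -!translation_mxD addrC.
have Punit := unitarymx_unit Pu.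
pose L x := P *m translation_mx x *m invmx P.
have LE x : L x = conjmx P (translation_mx x) by rewrite conjumx.
have Ltr x : is_trig_mx (L x).
  by have /PA := map_f translation_mx (mem_enum V x); rewrite /similar_to LE.
have LD x y : L (x + y) = L x *m L y.
  by rewrite /L translation_mxD !mulmxA mulmxKV.
have L0 : L 0 = 1%:M by rewrite /L translation_mx0 mulmx1 mulmxV.
exists (fun i x => L x i i); split=> [i|x].
  apply: multiplicative_unitary_hom => [|x y]; first by rewrite L0 mxE eqxx.
  rewrite LD mxE (bigD1 i) //= big1 ?addr0 // => j ji.
  move/is_trig_mxP: (Ltr x) => hx; move/is_trig_mxP: (Ltr y) => hy.
  move: ji; rewrite neq_ltn => /orP[ij|ij].
    by rewrite hy ?mulr0.
  by rewrite hx ?mul0r.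
by rewrite -translation_mx_trace -/(mxtrace (L x)) /L mxtrace_mulC mulKmx.
Qed.

End characters.

Section unitary.
Context (C : numClosedFieldType) (V : zmodType) (g : V -> C).
Hypothesis gP : unitary_hom g.

Lemma unitary_hom_neq0 x : g x != 0.
Proof. by rewrite -normr_eq0 gP.1 oner_neq0. Qed.

Lemma unitary_hom0 : g 0 = 1.
Proof.
apply: (mulfI (unitary_hom_neq0 0)).
by rewrite -gP.2 addr0 mulr1.
Qed.

Lemma unitary_homN x : g (- x) = (g x)^*.
Proof.
apply: (mulfI (unitary_hom_neq0 x)).
by rewrite -gP.2 subrr unitary_hom0 -normCK gP.1 expr1n.
Qed.

End unitary.

Section correlation.
Context (C : numClosedFieldType) (V : finZmodType).

Lemma parseval (g : 'I_#|V| -> V -> C) (f : V -> C) (B : {set V}) :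
  (forall i, unitary_hom (g i)) ->
  (forall x, \sum_i g i x = (#|V| * (x == 0))%:R) ->
  (forall x, `|f x| = 1) ->
  \sum_i `|\sum_(a in B) f a * (g i a)^*| ^+ 2 = (#|V| * #|B|)%:R.
Proof.
move=> gU gS f1.
have E i : `|\sum_(a in B) f a * (g i a)^*| ^+ 2 =
    \sum_(a in B) \sum_(b in B) f a * (f b)^* * g i (b - a).
  rewrite normCK rmorph_sum mulr_suml; apply: eq_bigr => a _.
  rewrite mulr_sumr; apply: eq_bigr => b _.
  rewrite (gU i).2 unitary_homN // rmorphM /= conjCK; ring.
rewrite (eq_bigr _ (fun i _ => E i)) exchange_big /=.
rewrite (eq_bigr (fun=> #|V|%:R)); first by rewrite sumr_const natrM mulr_natr.
move=> a aB; rewrite exchange_big /= (bigD1 a) //=.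
rewrite [X in _ + X]big1 ?addr0.
  rewrite -mulr_sumr gS subrr eqxx muln1 -normCK f1 expr1n mul1r //.
move=> b /andP[_ ba]; rewrite -mulr_sumr gS subr_eq0 (negbTE ba) muln0.
exact: mulr0.
Qed.

(** With F and H the Fourier transforms of f on B and on S, orthogonality turns
    the sum of F^2 H^* over all characters into |V| times the sum over B of
    f(a) f(b) f(a + b)^*, whose terms are within 1/2 of 1.  By Parseval this
    cannot be so large unless |H| is at least |B|/2 somewhere. *)
Lemma correlated_character (f : V -> C) (B S : {set V}) :
  (forall x, `|f x| = 1) -> (0 < #|B|)%N ->
  (forall a b, a \in B -> b \in B -> a + b \in S) ->
  (forall a b, a \in B -> b \in B -> `|f (a + b) - f a * f b| <= 2^-1) ->
  exists2 g : V -> C, unitary_hom g &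
    #|B|%:R / 2 <= `|\sum_(x in S) f x * (g x)^*|.
Proof.
move=> f1 B0 BS fBB; have [g [gU gS]] := enough_characters C V.
have cB0 : (0 : C) < #|B|%:R by rewrite ltr0n.
have cV0 : (0 : C) < #|V|%:R by rewrite ltr0n; apply/card_gt0P; exists 0.
pose F i := \sum_(a in B) f a * (g i a)^*.
pose H i := \sum_(x in S) f x * (g i x)^*.
have E i : F i ^+ 2 * (H i)^* = \sum_(a in B) \sum_(b in B) \sum_(x in S)
    f a * f b * (f x)^* * g i (x - (a + b)).
  rewrite expr2 -mulrA {1}/F mulr_suml; apply: eq_bigr => a _.
  rewrite /F mulr_suml mulr_sumr; apply: eq_bigr => b _.
  rewrite /H rmorph_sum !mulr_sumr; apply: eq_bigr => x _.
  rewrite (gU i).2 unitary_homN // (gU i).2 !rmorphM /= conjCK; ring.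
have FH : \sum_i F i ^+ 2 * (H i)^* =
    #|V|%:R * \sum_(a in B) \sum_(b in B) f a * f b * (f (a + b))^*.
  rewrite (eq_bigr _ (fun i _ => E i)) exchange_big mulr_sumr /=.
  apply: eq_bigr => a aB; rewrite exchange_big mulr_sumr /=.
  apply: eq_bigr => b bB; rewrite exchange_big (bigD1 (a + b)) ?BS //=.
  rewrite [X in _ + X]big1 ?addr0 => [|x /andP[_ xab]].
    by rewrite -mulr_sumr gS subrr eqxx muln1 mulrC.
  by rewrite -mulr_sumr gS subr_eq0 (negbTE xab) muln0 mulr0.
have FH_ge : #|V|%:R * (#|B|%:R ^+ 2 / 2) <= `|\sum_i F i ^+ 2 * (H i)^*|.
  rewrite FH normrM ger0_norm ?ler0n // ler_pM2l //.
  have -> : #|B|%:R ^+ 2 / 2 = #|B|%:R ^+ 2 - \sum_(a in B) \sum_(b in B) (2^-1 : C).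
    by rewrite !sumr_const -mulrnA -[_ *+ (_ * _)]mulr_natl natrM; field.
  pose D := \sum_(a in B) \sum_(b in B) (1 - f a * f b * (f (a + b))^*).
  have DE : D = #|B|%:R ^+ 2 -
      \sum_(a in B) \sum_(b in B) f a * f b * (f (a + b))^*.
    rewrite /D (eq_bigr (fun a =>
        #|B|%:R - \sum_(b in B) f a * f b * (f (a + b))^*)).
      by rewrite sumrB sumr_const -[#|B|%:R *+ #|B|]mulr_natl -expr2.
    by move=> a _; rewrite sumrB sumr_const.
  have -> : \sum_(a in B) \sum_(b in B) f a * f b * (f (a + b))^* =
      #|B|%:R ^+ 2 - D by rewrite DE; ring.
  have DB : `|D| <= \sum_(a in B) \sum_(b in B) (2^-1 : C).
    apply: le_trans (ler_norm_sum _ _ _) _; apply: ler_sum => a aB.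
    apply: le_trans (ler_norm_sum _ _ _) _; apply: ler_sum => b bB.
    have -> : 1 - f a * f b * (f (a + b))^* = (f (a + b) - f a * f b) * (f (a + b))^*.
      by rewrite mulrBl -normCK f1 expr1n.
    by rewrite normrM norm_conjC f1 mulr1; exact: fBB.
  apply: le_trans (lerB_dist _ _).
  rewrite ger0_norm ?exprn_ge0 ?ler0n // lerD2l lerN2 //.
have [/existsP[i iP]|] := boolP [exists i, #|B|%:R / 2 <= `|H i|].
  by exists (g i).
rewrite negb_exists => /forallP Hlt; exfalso.
have {}Hlt i : `|H i| < #|B|%:R / 2.
  by rewrite real_ltNge ?Hlt // ?ger0_real // mulr_ge0 ?invr_ge0 ?ler0n.
have par : \sum_i `|F i| ^+ 2 = (#|V| * #|B|)%:R by exact: parseval.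
have le i : `|F i ^+ 2 * (H i)^*| <= `|F i| ^+ 2 * (#|B|%:R / 2).
  by rewrite normrM norm_conjC normrX ler_wpM2l ?exprn_ge0 // ltW.
have /existsP[i Fi] : [exists i, F i != 0].
  rewrite -negb_forall; apply/negP => /forallP F0.
  have /eqP := par; rewrite big1 => [|i _].
    by rewrite natrM eq_sym mulf_eq0 !gt_eqF.
  by rewrite (eqP (F0 i)) normr0 expr0n.
have : \sum_i `|F i ^+ 2 * (H i)^*| < \sum_i `|F i| ^+ 2 * (#|B|%:R / 2).
  rewrite (bigD1 i) //= [in X in _ < X](bigD1 i) //=.
  apply: ltr_leD; last by apply: ler_sum => ? _; exact: le.
  by rewrite normrM norm_conjC normrX ltr_pM2l // exprn_gt0 // normr_gt0.
rewrite -mulr_suml par => /(le_lt_trans (ler_norm_sum _ _ _)).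
move=> /(le_lt_trans FH_ge); rewrite natrM expr2 !mulrA ltxx //.
Qed.

(** The function h = f g^* is almost multiplicative, so multiplying its sum over
    S by h(a) amounts, up to |S| e, to translating S by a, and both S and S + a
    lie in T. *)
Lemma correlation_invariance (f : V -> C) (g : V -> C) (S T : {set V}) (a : V) (e : C) :
  (forall x, `|f x| = 1) -> unitary_hom g -> S \subset T ->
  (forall x, x \in S -> x + a \in T) ->
  (forall x, x \in S -> `|f (x + a) - f x * f a| <= e) ->
  `|f a - g a| * `|\sum_(x in S) f x * (g x)^*| <=
    #|S|%:R * e + (#|T| - #|S|).*2%:R.
Proof.
move=> f1 gU ST SaT fe; pose h x := f x * (g x)^*.
have h1 x : `|h x| = 1 by rewrite normrM norm_conjC f1 gU.1 mulr1.
have -> : `|f a - g a| = `|h a - 1|.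
  have -> : f a - g a = (h a - 1) * g a.
    by rewrite mulrBl mul1r -mulrA [(g a)^* * _]mulrC -normCK gU.1 expr1n mulr1.
  by rewrite normrM gU.1 mulr1.
rewrite -normrM -/h.
have -> : (h a - 1) * (\sum_(x in S) h x) =
    \sum_(x in S) (h x * h a - h (x + a)) +
    (\sum_(x in S) h (x + a) - \sum_(x in S) h x).
  rewrite sumrB -mulr_suml; ring.
apply: le_trans (ler_normD _ _) _; apply: lerD.
  rewrite mulr_natl -sumr_const; apply: le_trans (ler_norm_sum _ _ _) _.
  apply: ler_sum => x xS.
  have -> : h x * h a - h (x + a) = (f x * f a - f (x + a)) * (g (x + a))^*.
    by rewrite /h gU.2 rmorphM /=; ring.
  by rewrite normrM norm_conjC gU.1 mulr1 distrC; exact: fe.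
pose S' := [set x + a | x in S].
have S'T : S' \subset T by apply/fintype.subsetP => _ /imsetP[x xS ->]; exact: SaT.
have cS' : #|S'| = #|S| by rewrite card_imset //; exact: addIr.
have -> : \sum_(x in S) h (x + a) = \sum_(x in S') h x.
  by rewrite big_imset //= => x y _ _; exact: addIr.
have split (A : {set V}) : A \subset T ->
    \sum_(x in A) h x = \sum_(x in T) h x - \sum_(x in T :\: A) h x.
  move=> AT; rewrite [X in X - _](big_setID A) /= (finset.setIidPr AT); ring.
rewrite (split S) // (split S') //.
set a1 := \sum_(x in T :\: S') _; set a2 := \sum_(x in T :\: S) _.
have -> : \sum_(x in T) h x - a1 - (\sum_(x in T) h x - a2) = a2 - a1 by ring.
have bd (A : {set V}) : A \subset T -> `|\sum_(x in T :\: A) h x| <= (#|T| - #|A|)%:R.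
  move=> AT; apply: le_trans (ler_norm_sum _ _ _) _.
  by rewrite (eq_bigr _ (fun x _ => h1 x)) sumr_const cardsD (finset.setIidPr AT).
rewrite -addnn natrD; apply: le_trans (ler_normB _ _) _.
by apply: lerD; [exact: bd|rewrite -cS'; exact: bd].
Qed.

End correlation.

(** * Almost multiplicative functions are close to characters *)

Section sumsets.
Context (V : finZmodType) (A : {set V}).

Fixpoint multiple_set n : {set V} :=
  if n is m.+1 then [set x + a | x in multiple_set m, a in A] else [set 0].

Lemma multiple_setD m n x y : x \in multiple_set m -> y \in multiple_set n ->
  x + y \in multiple_set (m + n).
Proof.
move=> xm; elim: n y => [|n IH] y /=; first by rewrite inE addn0 => /eqP ->; rewrite addr0.
move=> /imset2P[z a zn aA ->]; rewrite addnS addrA.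
by apply: imset2_f => //; exact: IH.
Qed.

Hypothesis A0 : 0 \in A.

Lemma multiple_set0 n : 0 \in multiple_set n.
Proof.
elim: n => [|n IH] /=; first by rewrite inE.
by rewrite -[0]addr0 imset2_f.
Qed.

Lemma multiple_setS m n : (m <= n)%N -> multiple_set m \subset multiple_set n.
Proof.
move=> mn; apply/fintype.subsetP => x xm; rewrite -(subnKC mn) -[x]addr0.
by apply: multiple_setD => //; exact: multiple_set0.
Qed.

Lemma multiple_set1 : multiple_set 1 = A.
Proof.
apply/setP => x; apply/imset2P/idP => [[y a /set1P -> aA ->]|xA].
  by rewrite add0r.
by exists 0 x; rewrite ?inE ?add0r.
Qed.

(** By commutativity an element of (n + 1)A can be written as a sum of c_i d_i
    plus one element of A, with coefficients c_i between 0 and n. *)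
Lemma multiple_set_growth k (d : 'I_k -> V) :
  (forall a b, a \in A -> b \in A -> exists i, a + b - d i \in A) ->
  forall n, (#|multiple_set n.+1| <= n.+1 ^ k * #|A|)%N.
Proof.
move=> dA n.
pose pt (c : {ffun 'I_k -> 'I_n.+1}) := \sum_i d i *+ c i.
have sub : multiple_set n.+1 \subset [set pt c + a | c in [set: {ffun 'I_k -> 'I_n.+1}], a in A].
  suff : forall m, (m <= n)%N -> forall x, x \in multiple_set m.+1 ->
      exists c : 'I_k -> nat, (forall i, c i <= m)%N /\
        x - \sum_i d i *+ c i \in A.
    move=> /(_ n (leqnn n)) h; apply/fintype.subsetP => x /h[c [cn xA]].
    apply/imset2P; exists [ffun i => inord (c i)] (x - \sum_i d i *+ c i) => //.
    rewrite /pt addrC -[LHS](subrK (\sum_i d i *+ c i)); congr (_ + _).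
    by apply: eq_bigr => i _; rewrite ffunE inordK // ltnS.
  elim=> [|m IH] mn x.
    rewrite multiple_set1 => xA; exists (fun=> 0%N); split=> //.
    by rewrite big1 ?subr0.
  rewrite /= -/(multiple_set m.+1) => /imset2P[y a /(IH (ltnW mn))[c [cm yA]] aA ->].
  have [j jA] := dA _ _ yA aA.
  exists (fun i => c i + (i == j))%N; split=> [i|].
    by rewrite -addn1 leq_add // leq_b1.
  suff -> : \sum_i d i *+ (c i + (i == j)) = \sum_i d i *+ c i + d j.
    by move: jA; rewrite opprD addrA [y + a - _]addrAC.
  under eq_bigr do rewrite mulrnDr.
  rewrite big_split /=; congr (_ + _).
  by rewrite (bigD1 j) //= eqxx big1 ?addr0 // => i /negbTE ->.
apply: leq_trans (subset_leq_card sub) _.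
by rewrite curry_imset2X (leq_trans (leq_imset_card _ _)) // cardsX cardsT card_ffun !card_ord.
Qed.

End sumsets.

(** Precision 1/p requires a scale n whose boundary is at most |nA|/(8p); then M
    is chosen so that the error |2nA|/M of almost multiplicativity is at most
    |nA|/(4p), using the bound |(2N+1)A| <= (2N+1)^k |A|. *)
Lemma finite_stability (C : numClosedFieldType) (k p : nat) : (0 < p)%N ->
  exists N M, (0 < M)%N /\
  forall (V : finZmodType) (A : {set V}) (d : 'I_k -> V) (f : V -> C),
    0 \in A ->
    (forall a b, a \in A -> b \in A -> exists i, a + b - d i \in A) ->
    (forall x, `|f x| = 1) ->
    (forall x y, x \in multiple_set A N -> y \in multiple_set A N ->
      `|f (x + y) - f x * f y| <= M%:R^-1) ->
    exists2 g : V -> C, unitary_hom g & forall a, a \in A -> `|f a - g a| <= p%:R^-1.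
Proof.
move=> p0; have [|N HN] := @pigeonhole_growth k (8 * p); first by rewrite muln_gt0.
pose M := (4 * p * (N.*2.+1 ^ k))%N.
have M0 : (0 < M)%N by rewrite !muln_gt0 p0 expn_gt0.
have M2 : (2 <= M)%N by rewrite (@leq_trans (4 * p * 1)) ?leq_mul2l ?expn_gt0 ?orbT //; lia.
exists N.*2.+1, M; split=> // V A d f A0 dA f1 fD.
pose s n := #|multiple_set A n|.
have [|||n [n0 nN sn]] := HN s.
- by move=> i j ij; exact/subset_leq_card/multiple_setS.
- by rewrite /s multiple_set1; apply/card_gt0P; exists 0.
- by move=> i; rewrite {2}/s multiple_set1; exact: multiple_set_growth dA i.
have subN m x : (m <= N.*2.+1)%N -> x \in multiple_set A m ->
    x \in multiple_set A N.*2.+1.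
  by move=> mN; exact/fintype.subsetP/multiple_setS.
pose B := multiple_set A n; pose S := multiple_set A n.*2.
have [||||g gU gB] := @correlated_character C V f B S.
- exact: f1.
- by apply/card_gt0P; exists 0; exact: multiple_set0.
- by move=> a b aB bB; rewrite /S -addnn multiple_setD.
- move=> a b aB bB; apply: le_trans (fD _ _ _ _) _; [apply: (subN n)..|] => //; try lia.
  by rewrite lef_pV2 ?posrE ?ltr0n // ler_nat.
exists g => // a aA.
have h : `|f a - g a| * `|\sum_(x in S) f x * (g x)^*| <=
    #|S|%:R * M%:R^-1 + (s n.*2.+1 - s n.*2).*2%:R.
  apply: correlation_invariance => // [|x xS|x xS].
  - exact: multiple_setS.
  - exact: imset2_f.
  - apply: fD; [apply: (subN n.*2)|apply: (subN 1%N)] => //; try lia.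
    by rewrite multiple_set1.
have sS : (#|S| <= N.*2.+1 ^ k * s n)%N.
  apply: leq_trans (_ : (#|multiple_set A N.*2.+1| <= _)%N).
    by apply/subset_leq_card/multiple_setS => //; lia.
  apply: leq_trans (multiple_set_growth dA _) _; rewrite leq_mul2l.
  rewrite -(multiple_set1 A); apply/orP; right.
  exact/subset_leq_card/multiple_setS.
have sn0 : (0 : C) < (s n)%:R.
  by rewrite ltr0n; apply/card_gt0P; exists 0; exact: multiple_set0.
have p0' : (0 : C) < p%:R by rewrite ltr0n.
have e1 : #|S|%:R * M%:R^-1 <= (s n)%:R / (4 * p)%:R :> C.
  rewrite ler_pdivrMr ?ltr0n // mulrAC ler_pdivlMr ?ltr0n ?muln_gt0 ?p0 //.
  by rewrite -!natrM ler_nat /M; nia.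
have e2 : (s n.*2.+1 - s n.*2).*2%:R <= (s n)%:R / (4 * p)%:R :> C.
  rewrite ler_pdivlMr ?ltr0n ?muln_gt0 ?p0 // -natrM ler_nat; nia.
have {}h : `|f a - g a| * ((s n)%:R / 2) <= (s n)%:R / (4 * p)%:R + (s n)%:R / (4 * p)%:R.
  by apply: le_trans (le_trans h (lerD e1 e2)); rewrite ler_wpM2l.
rewrite -(@ler_pM2r _ ((s n)%:R / 2)) ?divr_gt0 //; apply: le_trans h _.
rewrite natrM le_eqVlt; apply/orP; left; apply/eqP.
by field; rewrite gt_eqF.
Qed.

Local Open Scope complex_scope.

(** * Finite groups carved out of a type *)

(** The elementary form in which the finite group has to be given in order to
    transfer the stability theorem to internal groups: finiteness is expressed
    by a bounded injective rank. *)
Record set_group (E : Type) := SetGroup {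
  sg_set : set E;
  sg_add : E -> E -> E;
  sg_zero : E;
  sg_opp : E -> E;
  sg_rank : E -> nat;
  sg_bound : nat;
  sg_set0 : sg_set sg_zero;
  sg_setN : forall x, sg_set x -> sg_set (sg_opp x);
  sg_setD : forall x y, sg_set x -> sg_set y -> sg_set (sg_add x y);
  sg_addA : forall x y z, sg_set x -> sg_set y -> sg_set z ->
    sg_add x (sg_add y z) = sg_add (sg_add x y) z;
  sg_addC : forall x y, sg_set x -> sg_set y -> sg_add x y = sg_add y x;
  sg_add0 : forall x, sg_set x -> sg_add sg_zero x = x;
  sg_addN : forall x, sg_set x -> sg_add (sg_opp x) x = sg_zero;
  sg_rank_le : forall x, sg_set x -> (sg_rank x <= sg_bound)%N;
  sg_rank_inj : forall x y, sg_set x -> sg_set y ->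
    sg_rank x = sg_rank y -> x = y }.

Section set_group_finZmodType.
Context (E : Type) (G : set_group E).

Definition sg_elt : Type := {x : E | sg_set G x}.
HB.instance Definition _ := gen_eqMixin sg_elt.
HB.instance Definition _ := gen_choiceMixin sg_elt.
Implicit Types x y z : sg_elt.

Lemma sg_elt_inj x y : sval x = sval y -> x = y.
Proof. exact: eq_sig_hprop. Qed.

Definition sg_elt0 : sg_elt := exist _ _ (sg_set0 G).
Definition sg_eltN x : sg_elt := exist _ _ (sg_setN (svalP x)).
Definition sg_eltD x y : sg_elt := exist _ _ (sg_setD (svalP x) (svalP y)).

Fact sg_eltDA : associative sg_eltD.
Proof. by move=> x y z; apply: sg_elt_inj; apply: sg_addA; exact: svalP. Qed.
Fact sg_eltDC : commutative sg_eltD.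
Proof. by move=> x y; apply: sg_elt_inj; apply: sg_addC; exact: svalP. Qed.
Fact sg_elt0D : left_id sg_elt0 sg_eltD.
Proof. by move=> x; apply: sg_elt_inj; apply: sg_add0; exact: svalP. Qed.
Fact sg_eltND : left_inverse sg_elt0 sg_eltN sg_eltD.
Proof. by move=> x; apply: sg_elt_inj; apply: sg_addN; exact: svalP. Qed.
HB.instance Definition _ :=
  GRing.isZmodule.Build sg_elt sg_eltDA sg_eltDC sg_elt0D sg_eltND.

Definition sg_code x : 'I_(sg_bound G).+1 := inord (sg_rank G (sval x)).
Definition sg_decode i : option sg_elt :=
  xget None [set o | exists2 x, o = Some x & sg_code x = i]%classic.

Fact sg_codeK : pcancel sg_code sg_decode.
Proof.
move=> x; rewrite /sg_decode.
case: xgetP => [_ _ [y -> yx]|/(_ (Some x))]; last by case; exists x.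
congr Some; apply: sg_elt_inj; apply: (@sg_rank_inj _ G); [exact: svalP..|].
have := congr1 val yx; rewrite /= !inordK // ltnS; apply: sg_rank_le; exact: svalP.
Qed.
HB.instance Definition _ := PCanIsCountable sg_codeK.
HB.instance Definition _ : fintype.isFinite sg_elt := PCanIsFinite sg_codeK.

Definition sg_finZmod : finZmodType := sg_elt.
End set_group_finZmodType.

Section set_stability.

Definition sumset_step E (add : E -> E -> E) (A S : set E) : set E :=
  [set z | exists x a, [/\ S x, A a & z = add x a]].

Fixpoint nfold (E : Type) (add : E -> E -> E) (zero : E) (A : set E) n : set E :=
  if n is m.+1 then sumset_step add A (nfold add zero A m) else [set zero].

(** A covering of Q by k translates of A, by recursion on k: since k is a standard
    number, its transfer unfolds to the same recursion. *)
Fixpoint covered E (add : E -> E -> E) (G A : set E) k (Q : set E) : Prop :=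
  if k is m.+1 then exists d, exists Q' : set E,
    G d /\ (covered add G A m Q' /\
      forall x, Q x -> Q' x \/ exists a, A a /\ x = add d a)
  else forall x, ~ Q x.

Lemma covered_fun E (add : E -> E -> E) (G A : set E) k (Q : set E) :
  covered add G A k Q -> exists d : 'I_k -> E, (forall i, G (d i)) /\
    forall x, Q x -> exists i a, A a /\ x = add (d i) a.
Proof.
elim: k Q => [|k IH] Q /=.
  move=> Q0; exists (fun i : 'I_0 => False_rect E (notF (ltn_ord i))).
  by split=> [[]|x /Q0].
move=> [d [Q' [Gd [/IH[d' [Gd' d'P]] QQ']]]].
exists (fun i => if unlift ord0 i is Some j then d' j else d).
split=> [i|x]; first by case: unlift.
move=> /QQ'[/d'P[i xi]|xd].
  by exists (lift ord0 i); rewrite liftK.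
by exists ord0; rewrite unlift_none.
Qed.

(** The strict precision 1/p comes from 1/(p + 1) in [finite_stability]. *)
Lemma set_stability (R : realType) (k p : nat) : (0 < p)%N ->
  exists N M, (0 < M)%N /\
  forall (E : Type) (G : set_group E) (A Q : set E) (f : E -> R[i]),
    (forall x, A x -> sg_set G x) -> A (sg_zero G) ->
    (forall x y, A x -> A y -> Q (sg_add G x y)) ->
    covered (sg_add G) (sg_set G) A k Q ->
    (forall x, `|f x| = 1) ->
    (forall x y, nfold (sg_add G) (sg_zero G) A N x ->
       nfold (sg_add G) (sg_zero G) A N y ->
      `|f (sg_add G x y) - f x * f y| < (M%:R^-1)%:C) ->
    exists g : E -> R[i], [/\ forall x, `|g x| = 1,
      forall x, ~ sg_set G x -> g x = 1,
      forall x y, sg_set G x -> sg_set G y -> g (sg_add G x y) = g x * g y &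
      forall a, A a -> `|g a - f a| < (p%:R^-1)%:C].
Proof.
move=> p0; have natC n : ((n%:R)^-1)%:C = n%:R^-1 :> R[i].
  by rewrite fmorphV rmorph_nat.
have [N [M [M0 H]]] := @finite_stability R[i] k p.+1 isT.
exists N, M; split=> // E G A Q f AG A0 AQ Acov f1 fD.
pose V := sg_finZmod G.
pose A' : {set V} := [set x : V | `[< A (sval x) >]]%SET.
have A'P x : x \in A' <-> A (sval x) by rewrite inE; split=> /asboolP.
have nP n x : x \in multiple_set A' n ->
    nfold (sg_add G) (sg_zero G) A n (sval x).
  elim: n x => [|n IH] x /=; first by rewrite inE => /eqP ->.
  move=> /imset2P[y a /IH yn /A'P Aa ->].
  by exists (sval y), (sval a).
have [d [Gd dP]] := covered_fun Acov.
pose d' i : V := exist _ (d i) (Gd i).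
have [||||g gU gf] := H V A' d' (fun x => f (sval x)).
- exact/A'P.
- move=> a b /A'P Aa /A'P Ab.
  have [|i [c [Ac e]]] := dP (sg_add G (sval a) (sval b)).
    exact: AQ.
  exists i; apply/A'P; suff -> : a + b - d' i = exist _ c (AG _ Ac) by [].
  apply/eqP; rewrite subr_eq [X in _ == X]addrC; apply/eqP; exact: sg_elt_inj.
- by move=> x; exact: f1.
- move=> x y /nP xn /nP yn; rewrite -natC; apply: ltW.
  exact: fD.
exists (fun x => if pselect (sg_set G x) is left Gx then g (exist _ x Gx) else 1).
have gE x (Gx : sg_set G x) : (if pselect (sg_set G x) is left Gx'
    then g (exist _ x Gx') else 1) = g (exist _ x Gx).
  by case: pselect => // Gx'; congr g; exact: sg_elt_inj.
split=> [x|x Gx|x y Gx Gy|a Aa].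
- by case: pselect => [Gx|_]; [exact: gU.1|exact: normr1].
- by case: pselect.
- rewrite (gE _ (sg_setD Gx Gy)) (gE _ Gx) (gE _ Gy) -gU.2; congr g.
  exact: sg_elt_inj.
- rewrite (gE _ (AG _ Aa)) distrC.
  have /gf : (exist _ a (AG _ Aa) : V) \in A' by exact/A'P.
  move=> /le_lt_trans; apply; rewrite natC ltf_pV2 ?posrE ?ltr0n //.
  by rewrite ltr_nat.
Qed.

End set_stability.

Local Open Scope classical_set_scope.

(** * Transfer of formulas by rewriting *)

(** The relations and operations that occur in transferred formulas are kept
    under a constant: the rules below then recognize them below the binder of a
    standard relation. *)
Definition scirc (R : realType) (x : R[i]) : Prop := unit_circle R x.
Definition snear (R : realType) (ε : R) (x y : R[i]) : Prop := `|x - y| < ε%:C.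

Section transfer_rules.
Context (X : Type) (R : realType) (U : nsuniverse X R).
Local Notation El := (El X R).
Local Notation rel Γ r e := (@rel_star X R U Γ r e).
Local Notation func Γ t f e := (@fun_star X R U Γ t f e).
Local Notation fR r := (fRel r (idvars _)).

Lemma rel_transfer Γ (r : env El Γ -> Prop) : (forall a, r a) ->
  forall e, rel Γ r e.
Proof.
move=> H e; have := @transfer X R U Γ (fR r) _ e.
by cbn; rewrite select_id; apply => a; cbn; rewrite select_id.
Qed.

(** A standard relation that is defined by a formula has as its extension the
    relation defined by the same formula in the nonstandard universe; the rules
    for the connectives and quantifiers are the instances of this fact. *)
Lemma rel_sat Γ (r : env El Γ -> Prop) (φ : Defs.form X R Γ) (e : env U Γ) :
  (forall a, r a <-> @sat _ _ (standard X R) Γ φ a) ->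
  rel Γ r e = @sat _ _ U Γ φ e.
Proof.
move=> h; apply/propext; rewrite -rel_star_sat.
by have -> : r = @sat _ _ (standard X R) Γ φ by apply/funext => a; apply/propext.
Qed.

Lemma rel_not Γ (r : env El Γ -> Prop) e : rel Γ (fun a => ~ r a) e = ~ rel Γ r e.
Proof.
rewrite (@rel_sat Γ _ (fNot (fR r))) => [|a]; cbn; by rewrite select_id.
Qed.

Lemma rel_and Γ (r q : env El Γ -> Prop) e :
  rel Γ (fun a => r a /\ q a) e = (rel Γ r e /\ rel Γ q e).
Proof.
by rewrite (@rel_sat Γ _ (fAnd (fR r) (fR q))) => [|a]; cbn; rewrite !select_id.
Qed.

Lemma rel_or Γ (r q : env El Γ -> Prop) e :
  rel Γ (fun a => r a \/ q a) e = (rel Γ r e \/ rel Γ q e).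
Proof.
by rewrite (@rel_sat Γ _ (fOr (fR r) (fR q))) => [|a]; cbn; rewrite !select_id.
Qed.

Lemma rel_imp Γ (r q : env El Γ -> Prop) e :
  rel Γ (fun a => r a -> q a) e = (rel Γ r e -> rel Γ q e).
Proof.
by rewrite (@rel_sat Γ _ (fImp (fR r) (fR q))) => [|a]; cbn; rewrite !select_id.
Qed.

Lemma rel_all s Γ (r : env El Γ -> El s -> Prop) e :
  rel Γ (fun a => forall x, r a x) e =
  forall x : U s, rel (s :: Γ) (fun b => r b.2 b.1) (x, e).
Proof.
rewrite (@rel_sat Γ _ (fAll (@fRel X R (s :: Γ) (s :: Γ) (fun b => r b.2 b.1) (idvars _)))).
  apply/propext; cbn -[select idvars]; split=> H x; have := H x; by rewrite select_id.
by move=> a; cbn -[select idvars]; split=> H x; have := H x; rewrite select_id.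
Qed.

Lemma rel_ex s Γ (r : env El Γ -> El s -> Prop) e :
  rel Γ (fun a => exists x, r a x) e =
  exists x : U s, rel (s :: Γ) (fun b => r b.2 b.1) (x, e).
Proof.
rewrite (@rel_sat Γ _ (fEx (@fRel X R (s :: Γ) (s :: Γ) (fun b => r b.2 b.1) (idvars _)))).
  apply/propext; cbn -[select idvars]; split=> -[x H]; exists x; move: H; by rewrite select_id.
by move=> a; cbn -[select idvars]; split=> -[x H]; exists x; move: H; rewrite select_id.
Qed.

Lemma rel_fun Γ s (f : env El Γ -> El s) e (y : U s) :
  rel (s :: Γ) (fun b => f b.2 = b.1) (y, e) = (func Γ s f e = y).
Proof.
pose w : env (var (s :: Γ)) Γ := env_map (fun t v => vs s v) (idvars Γ).
have wE F (x : F s) (a : env F Γ) : @select F (s :: Γ) Γ w (x, a) = a.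
  exact: select_idvars.
rewrite (@rel_sat (s :: Γ) _ (@fFun X R (s :: Γ) Γ s f w (vz _ _))).
  by cbn -[select]; rewrite wE.
by move=> [x a]; cbn -[select]; rewrite wE.
Qed.

Lemma rel_weaken s Γ (r : env El Γ -> Prop) (x : U s) e :
  rel (s :: Γ) (fun b => r b.2) (x, e) = rel Γ r e.
Proof.
pose w : env (var (s :: Γ)) Γ := env_map (fun t v => vs s v) (idvars Γ).
have wE F (y : F s) (a : env F Γ) : @select F (s :: Γ) Γ w (y, a) = a.
  exact: select_idvars.
rewrite (@rel_sat (s :: Γ) _ (@fRel X R (s :: Γ) Γ r w)).
  by cbn -[select]; rewrite wE.
by move=> [y a]; cbn -[select]; rewrite wE.
Qed.

(** The pivot of the rules for atomic formulas: the arguments of an atom are turned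
    into variables one at a time. *)
Lemma rel_comp s Γ (r : El s -> env El Γ -> Prop) (f : env El Γ -> El s) e :
  rel Γ (fun a => r (f a) a) e =
  rel (s :: Γ) (fun b => r b.1 b.2) (func Γ s f e, e).
Proof.
have : rel (s :: Γ) (fun b => f b.2 = b.1 ->
    (r (f b.2) b.2 -> r b.1 b.2) /\ (r b.1 b.2 -> r (f b.2) b.2))
    (func Γ s f e, e).
  by apply: rel_transfer => -[x a] /= <-.
rewrite rel_imp rel_fun => /(_ erefl); rewrite rel_and !rel_imp.
rewrite (@rel_weaken s Γ (fun a => r (f a) a)) => -[h1 h2].
by apply/propext; split.
Qed.

Lemma rel_eq s Γ (f g : env El Γ -> El s) e :
  rel Γ (fun a => f a = g a) e = (func Γ s f e = func Γ s g e).
Proof.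
rewrite (@rel_comp s Γ (fun y a => y = g a)).
transitivity (func Γ s g e = func Γ s f e); last by apply/propext; split.
rewrite -rel_fun; congr (rel _ _ _); apply/funext => b.
by apply/propext; split.
Qed.

Lemma select_weaken (F : ssort -> Type) s Γ Δ (v : env (var Δ) Γ) (x : F s)
    (a : env F Δ) :
  @select F (s :: Δ) Γ (env_map (fun t w => vs s w) v) (x, a) = select v a.
Proof. by rewrite /select env_map_comp. Qed.

(** The map v stands for a permutation, duplication or omission of variables;
    weakening is the case of the shift. *)
Lemma func_select t Γ Δ (f : env El Γ -> El t) (v : env (var Δ) Γ) (e : env U Δ) :
  func Δ t (fun a => f (select v a)) e = func Γ t f (select v e).
Proof.
rewrite -(@rel_fun Δ t (fun a => f (select v a))).
rewrite (@rel_sat (t :: Δ) _ (@fFun X R (t :: Δ) Γ t f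
  (env_map (fun t' w => vs t w) v) (vz _ _))).
  by cbn -[select]; rewrite select_weaken.
by move=> [y a]; cbn -[select]; rewrite select_weaken.
Qed.

Lemma rel_select Γ Δ (r : env El Γ -> Prop) (v : env (var Δ) Γ) (e : env U Δ) :
  rel Δ (fun a => r (select v a)) e = rel Γ r (select v e).
Proof. by rewrite (@rel_sat Δ _ (@fRel X R Δ Γ r v)). Qed.

Lemma func_weaken s t Γ (f : env El Γ -> El t) (x : U s) e :
  func (s :: Γ) t (fun b => f b.2) (x, e) = func Γ t f e.
Proof.
pose w : env (var (s :: Γ)) Γ := env_map (fun t v => vs s v) (idvars Γ).
have wE F (y : F s) (a : env F Γ) : @select F (s :: Γ) Γ w (y, a) = a.
  exact: select_idvars.
rewrite -[in RHS](wE _ x e) -func_select; congr (func _ _ _ _).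
by apply/funext => -[y a]; rewrite wE.
Qed.

Lemma func_comp s t Γ (g : El s -> env El Γ -> El t) (f : env El Γ -> El s) e :
  func Γ t (fun a => g (f a) a) e =
  func (s :: Γ) t (fun b => g b.1 b.2) (func Γ s f e, e).
Proof.
have : rel Γ (fun a => forall y, f a = y -> forall z, g y a = z ->
    g (f a) a = z) e by apply: rel_transfer => a _ <- _ <-.
rewrite rel_all => /(_ (func Γ s f e)); rewrite rel_imp rel_fun => /(_ erefl).
rewrite rel_all => /(_ (func (s :: Γ) t (fun b => g b.1 b.2) (func Γ s f e, e))).
rewrite rel_imp (@rel_fun (s :: Γ) t (fun b => g b.1 b.2)) => /(_ erefl).
rewrite (@rel_fun (s :: Γ) t (fun b => g (f b.2) b.2)).
by rewrite (@func_weaken s t Γ (fun a => g (f a) a)).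
Qed.

Lemma func_comp1 s t Γ (g : El s -> El t) (f : env El Γ -> El s) e :
  func Γ t (fun a => g (f a)) e = func [:: s] t (fun b => g b.1) (func Γ s f e, tt).
Proof.
rewrite (@func_comp s t Γ (fun y _ => g y)).
exact: (@func_select t [:: s] (s :: Γ) (fun b => g b.1) (vz _ _, tt)).
Qed.

Lemma rel_comp1 s Γ (r : El s -> Prop) (f : env El Γ -> El s) e :
  rel Γ (fun a => r (f a)) e = rel [:: s] (fun b => r b.1) (func Γ s f e, tt).
Proof.
rewrite (@rel_comp s Γ (fun y _ => r y)).
exact: (@rel_select [:: s] (s :: Γ) (fun b => r b.1) (vz _ _, tt)).
Qed.

Lemma func_comp2 s s' t Γ (g : El s -> El s' -> El t) (f : env El Γ -> El s)
    (f' : env El Γ -> El s') e :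
  func Γ t (fun a => g (f a) (f' a)) e =
  func [:: s; s'] t (fun b => g b.1 b.2.1) (func Γ s f e, (func Γ s' f' e, tt)).
Proof.
rewrite (@func_comp s t Γ (fun y a => g y (f' a))).
rewrite (@func_comp s' t (s :: Γ) (fun y a => g a.1 y) (fun b => f' b.2)).
rewrite func_weaken.
exact: (@func_select t [:: s; s'] (s' :: s :: Γ) (fun b => g b.1 b.2.1)
  (vs _ (vz _ _), (vz _ _, tt))).
Qed.

Lemma rel_comp2 s s' Γ (r : El s -> El s' -> Prop) (f : env El Γ -> El s)
    (f' : env El Γ -> El s') e :
  rel Γ (fun a => r (f a) (f' a)) e =
  rel [:: s; s'] (fun b => r b.1 b.2.1) (func Γ s f e, (func Γ s' f' e, tt)).
Proof.
rewrite (@rel_comp s Γ (fun y a => r y (f' a))).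
rewrite (@rel_comp s' (s :: Γ) (fun y a => r a.1 y) (fun b => f' b.2)).
rewrite func_weaken.
exact: (@rel_select [:: s; s'] (s' :: s :: Γ) (fun b => r b.1 b.2.1)
  (vs _ (vz _ _), (vz _ _, tt))).
Qed.

Definition smem s (S : El (sPow s)) (x : El s) : Prop := S x.
Definition sapp s t (f : El (sFun s t)) (x : El s) : El t := f x.

Lemma func_app s t Γ (f : env El Γ -> El (sFun s t)) (x : env El Γ -> El s) e :
  func Γ t (fun a => sapp (f a) (x a)) e = app (func Γ (sFun s t) f e) (func Γ s x e).
Proof. exact: (@func_comp2 (sFun s t) s t Γ (fun f x => f x)). Qed.

Lemma rel_mem s Γ (S : env El Γ -> El (sPow s)) (x : env El Γ -> El s) e :
  rel Γ (fun a => smem (S a) (x a)) e = inn (func Γ s x e) (func Γ (sPow s) S e).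
Proof. exact: (@rel_comp2 s (sPow s) Γ (fun x S => S x)). Qed.

Lemma func_const s Γ (c : El s) e : func Γ s (fun=> c) e = star U s c.
Proof. by rewrite -fun_star_const; exact: (@func_select s [::] Γ (fun=> c) tt). Qed.

(** [fun_star_proj] with the lookup computed, the form in which variables appear
    once the rules for quantifiers have been used. *)
Lemma pr0 s Γ (e : env U (s :: Γ)) : func (s :: Γ) s (fun a => a.1) e = e.1.
Proof. exact: (fun_star_proj (vz s Γ)). Qed.

Lemma pr1 s0 s Γ (e : env U (s0 :: s :: Γ)) :
  func (s0 :: s :: Γ) s (fun a => a.2.1) e = e.2.1.
Proof. exact: (fun_star_proj (vs s0 (vz s Γ))). Qed.

Lemma pr2 s0 s1 s Γ (e : env U [:: s0, s1, s & Γ]) :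
  func [:: s0, s1, s & Γ] s (fun a => a.2.2.1) e = e.2.2.1.
Proof. exact: (fun_star_proj (vs s0 (vs s1 (vz s Γ)))). Qed.

Lemma pr3 s0 s1 s2 s Γ (e : env U [:: s0, s1, s2, s & Γ]) :
  func [:: s0, s1, s2, s & Γ] s (fun a => a.2.2.2.1) e = e.2.2.2.1.
Proof. exact: (fun_star_proj (vs s0 (vs s1 (vs s2 (vz s Γ))))). Qed.

Lemma pr4 s0 s1 s2 s3 s Γ (e : env U [:: s0, s1, s2, s3, s & Γ]) :
  func [:: s0, s1, s2, s3, s & Γ] s (fun a => a.2.2.2.2.1) e = e.2.2.2.2.1.
Proof. exact: (fun_star_proj (vs s0 (vs s1 (vs s2 (vs s3 (vz s Γ)))))). Qed.

Lemma pr5 s0 s1 s2 s3 s4 s Γ (e : env U [:: s0, s1, s2, s3, s4, s & Γ]) :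
  func [:: s0, s1, s2, s3, s4, s & Γ] s (fun a => a.2.2.2.2.2.1) e = e.2.2.2.2.2.1.
Proof. exact: (fun_star_proj (vs s0 (vs s1 (vs s2 (vs s3 (vs s4 (vz s Γ))))))). Qed.

Lemma pr6 s0 s1 s2 s3 s4 s5 s Γ (e : env U [:: s0, s1, s2, s3, s4, s5, s & Γ]) :
  func [:: s0, s1, s2, s3, s4, s5, s & Γ] s (fun a => a.2.2.2.2.2.2.1) e = e.2.2.2.2.2.2.1.
Proof. exact: (fun_star_proj (vs s0 (vs s1 (vs s2 (vs s3 (vs s4 (vs s5 (vz s Γ)))))))). Qed.

Lemma pr7 s0 s1 s2 s3 s4 s5 s6 s Γ (e : env U [:: s0, s1, s2, s3, s4, s5, s6, s & Γ]) :
  func [:: s0, s1, s2, s3, s4, s5, s6, s & Γ] s (fun a => a.2.2.2.2.2.2.2.1) e = e.2.2.2.2.2.2.2.1.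
Proof. exact: (fun_star_proj (vs s0 (vs s1 (vs s2 (vs s3 (vs s4 (vs s5 (vs s6 (vz s Γ))))))))). Qed.

Lemma pr8 s0 s1 s2 s3 s4 s5 s6 s7 s Γ (e : env U [:: s0, s1, s2, s3, s4, s5, s6, s7, s & Γ]) :
  func [:: s0, s1, s2, s3, s4, s5, s6, s7, s & Γ] s (fun a => a.2.2.2.2.2.2.2.2.1) e = e.2.2.2.2.2.2.2.2.1.
Proof. exact: (fun_star_proj (vs s0 (vs s1 (vs s2 (vs s3 (vs s4 (vs s5 (vs s6 (vs s7 (vz s Γ)))))))))). Qed.

Lemma pr9 s0 s1 s2 s3 s4 s5 s6 s7 s8 s Γ (e : env U [:: s0, s1, s2, s3, s4, s5, s6, s7, s8, s & Γ]) :
  func [:: s0, s1, s2, s3, s4, s5, s6, s7, s8, s & Γ] s (fun a => a.2.2.2.2.2.2.2.2.2.1) e = e.2.2.2.2.2.2.2.2.2.1.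
Proof. exact: (fun_star_proj (vs s0 (vs s1 (vs s2 (vs s3 (vs s4 (vs s5 (vs s6 (vs s7 (vs s8 (vz s Γ))))))))))). Qed.

Lemma pr10 s0 s1 s2 s3 s4 s5 s6 s7 s8 s9 s Γ (e : env U [:: s0, s1, s2, s3, s4, s5, s6, s7, s8, s9, s & Γ]) :
  func [:: s0, s1, s2, s3, s4, s5, s6, s7, s8, s9, s & Γ] s (fun a => a.2.2.2.2.2.2.2.2.2.2.1) e = e.2.2.2.2.2.2.2.2.2.2.1.
Proof. exact: (fun_star_proj (vs s0 (vs s1 (vs s2 (vs s3 (vs s4 (vs s5 (vs s6 (vs s7 (vs s8 (vs s9 (vz s Γ)))))))))))). Qed.

Lemma pr11 s0 s1 s2 s3 s4 s5 s6 s7 s8 s9 s10 s Γ (e : env U [:: s0, s1, s2, s3, s4, s5, s6, s7, s8, s9, s10, s & Γ]) :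
  func [:: s0, s1, s2, s3, s4, s5, s6, s7, s8, s9, s10, s & Γ] s (fun a => a.2.2.2.2.2.2.2.2.2.2.2.1) e = e.2.2.2.2.2.2.2.2.2.2.2.1.
Proof. exact: (fun_star_proj (vs s0 (vs s1 (vs s2 (vs s3 (vs s4 (vs s5 (vs s6 (vs s7 (vs s8 (vs s9 (vs s10 (vz s Γ))))))))))))). Qed.

Lemma internal_rel s Γ (r : env El (s :: Γ) -> Prop) (e : env U Γ) :
  internal [set x | rel (s :: Γ) r (x, e)].
Proof.
have := @internal_definition X R U s Γ (fRel r (idvars (s :: Γ))) e.
rewrite (_ : [set x | _] = [set x | rel (s :: Γ) r (x, e)]) //.
by apply/seteqP; split=> x; cbn -[select idvars]; rewrite select_id.
Qed.

(** The ε-approximation that underlies the relation of being infinitely close. *)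
Definition near (ε : R) (a b : U sCplx) : Prop :=
  @rel_star _ _ U [:: sCplx; sCplx] (fun e => `|e.1 - e.2.1| < ε%:C) (a, (b, tt)).

Lemma rel_circ Γ (x : env El Γ -> El sCplx) e :
  rel Γ (fun a => scirc (x a)) e = in_circle (func Γ sCplx x e).
Proof. exact: (@rel_comp1 sCplx Γ (@scirc R)). Qed.

Lemma rel_near ε Γ (x y : env El Γ -> El sCplx) e :
  rel Γ (fun a => snear ε (x a) (y a)) e = near ε (func Γ sCplx x e) (func Γ sCplx y e).
Proof. exact: (@rel_comp2 sCplx sCplx Γ (snear ε)). Qed.

Lemma func_mul Γ (x y : env El Γ -> R[i]) e :
  func Γ sCplx (fun a => x a * y a) e = cmul (func Γ sCplx x e) (func Γ sCplx y e).
Proof. exact: (@func_comp2 sCplx sCplx sCplx Γ (fun x y => x * y)). Qed.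

Lemma rel_const Γ (P : Prop) e : rel Γ (fun=> P) e = P.
Proof.
apply/propext; split=> [h|p]; last exact: rel_transfer.
apply: contrapT => np; have : rel Γ (fun=> ~ P) e by exact: rel_transfer.
by rewrite rel_not.
Qed.

End transfer_rules.

(** * The nonstandard circle *)

Lemma arbitrarily_small_eq0 (R : realType) (z : R[i]) :
  (forall ε : R, 0 < ε -> `|z| < ε%:C) -> z = 0.
Proof.
move=> h; apply/eqP; rewrite -normr_le0.
have [r rE] : exists r, `|z| = r%:C by rewrite normc_def; eexists.
rewrite rE -(rmorph0 (real_complex R)) lecR; apply/ler_addgt0Pl => ε ε0.
by rewrite addr0 -lecR -rE ltW //; exact: h.
Qed.

Section nonstandard_circle.
Context (X : Type) (R : realType) (U : nsuniverse X R).
Local Notation C := sCplx.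
Local Notation near := (@near X R U).
Local Notation circ := (@in_circle X R U).
Local Notation star := (star U sCplx).
Local Notation prs := (pr0, pr1, pr2, pr3).
Local Notation rules := (rel_imp, rel_and, rel_not, rel_near, rel_circ,
   func_mul, func_const, rel_const).

Lemma near_trans ε ε' a b c : near ε a b -> near ε' b c -> near (ε + ε') a c.
Proof.
have := @rel_transfer X R U [:: C; C; C] (fun e => snear ε e.1 e.2.1 ->
  snear ε' e.2.1 e.2.2.1 -> snear (ε + ε') e.1 e.2.2.1) _ (a, (b, (c, tt))).
rewrite !rules ?prs; apply => -[x [y [z []]]] /=.
rewrite /snear rmorphD /= => h1 h2.
by rewrite (le_lt_trans (ler_distD y x z)) // ltrD.
Qed.

Lemma near_sym ε a b : near ε a b -> near ε b a.
Proof.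
have := @rel_transfer X R U [:: C; C] (fun e => snear ε e.1 e.2.1 ->
  snear ε e.2.1 e.1) _ (a, (b, tt)).
by rewrite !rules ?prs; apply => -[x [y []]] /=; rewrite /snear distrC.
Qed.

Lemma near_le ε ε' a b : ε <= ε' -> near ε a b -> near ε' a b.
Proof.
move=> le; have := @rel_transfer X R U [:: C; C] (fun e => snear ε e.1 e.2.1 ->
  snear ε' e.1 e.2.1) _ (a, (b, tt)).
rewrite !rules ?prs; apply => -[x [y []]] /=; rewrite /snear => /lt_le_trans.
by apply; rewrite lecR.
Qed.

Lemma near_refl ε a : 0 < ε -> near ε a a.
Proof.
move=> ε0; have := @rel_transfer X R U [:: C] (fun e => snear ε e.1 e.1) _ (a, tt).
rewrite !rules ?prs; apply => -[x []] /=.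
by rewrite /snear subrr normr0 ltcR.
Qed.

Lemma near_mul ε a b c : circ c -> near ε a b -> near ε (cmul c a) (cmul c b).
Proof.
have := @rel_transfer X R U [:: C; C; C] (fun e => scirc e.2.2.1 ->
  snear ε e.1 e.2.1 -> snear ε (e.2.2.1 * e.1) (e.2.2.1 * e.2.1)) _ (a, (b, (c, tt))).
rewrite !rules ?prs; apply => -[x [y [z []]]] /=.
by rewrite /snear -mulrBr normrM => ->; rewrite mul1r.
Qed.

Lemma near_star ε c d : near ε (star c) (star d) <-> `|c - d : R[i]| < ε%:C.
Proof.
rewrite -[X in _ <-> X](@rel_const X R U [::] _ tt) -/(snear ε c d).
by rewrite (@rel_near X R U ε [::] (fun=> c) (fun=> d)) !func_const.
Qed.

Lemma circ_star c : circ (star c) <-> `|c : R[i]| = 1.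
Proof.
rewrite -[X in _ <-> X](@rel_const X R U [::] _ tt) -/(scirc c).
by rewrite (@rel_circ X R U [::] (fun=> c)) !func_const.
Qed.

Lemma cmul_star c d : cmul (star c) (star d) = star (c * d).
Proof.
have := @func_const X R U sCplx [::] (c * d) tt.
by rewrite (@func_mul X R U [::] (fun=> c) (fun=> d)) !func_const.
Qed.

Lemma near_cmul2 ε ε' a b c d : circ b -> circ c ->
  near ε a b -> near ε' c d -> near (ε + ε') (cmul a c) (cmul b d).
Proof.
move=> b1 c1 ab cd; apply: near_trans (near_mul b1 cd).
by rewrite ![cmul _ c]cmulC; exact: near_mul.
Qed.

Lemma near_div ε a c : circ c -> near ε (cmul a (cinv c)) (star 1) <-> near ε a c.
Proof.
move=> c1; split=> h.
  have := near_mul c1 h; rewrite [cmul _ (star 1)]cmulC cmul1.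
  by rewrite [cmul a _]cmulC cmulA [cmul c _]cmulC cmulV // cmul1.
rewrite -(cmulV c1) cmulC; apply: near_mul => //; exact: in_circleV.
Qed.

(** The supremum of the r for which q r holds. *)
Lemma bracket_real (q : R -> Prop) :
  (exists r, q r) -> (exists r, ~ q r) ->
  (forall r r', r <= r' -> q r' -> q r) ->
  exists x, forall ε, 0 < ε -> q (x - ε) /\ ~ q (x + ε).
Proof.
move=> [r0 q0] [r1 q1] qm; pose S := [set r | q r].
have hS : has_sup S.
  split; first by exists r0.
  exists r1 => r qr; rewrite leNgt; apply/negP => r1r; apply: q1.
  exact: qm (ltW r1r) qr.
exists (sup S) => ε ε0; split.
  have [r Sr] := sup_adherent ε0 hS.
  by move=> /ltW/qm; apply.
move=> qx; have : sup S + ε <= sup S by apply: sup_upper_bound.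
by rewrite gerDl leNgt ε0.
Qed.

(** The real and the imaginary part of u are bracketed by suprema of standard
    numbers, which gives the standard part; its modulus is infinitely close to
    1, hence equal to 1. *)
Lemma standard_part_ex u : circ u -> exists c : R[i], `|c| = 1 /\ Defs.approx u (star c).
Proof.
move=> u1; pose P (p : R[i] -> R) r := @rel_star X R U [:: C] (fun e => r <= p e.1) (u, tt).
have br (p : R[i] -> R) : (forall z, `|p z|%:C <= `|z|) ->
    exists x, forall ε, 0 < ε -> P p (x - ε) /\ ~ P p (x + ε).
  move=> pz; have p1 z : scirc z -> -1 <= p z /\ p z <= 1.
    move=> z1; have := pz z; rewrite z1 -(rmorph1 (real_complex R)) lecR ler_norml.
    by move=> /andP.
  apply: (@bracket_real (P p)).
  - exists (- 1); have := @rel_transfer X R U [:: C] (fun e => scirc e.1 -> -1 <= p e.1) _ (u, tt).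
    rewrite !rules ?prs; apply => // -[z []] /= z1; exact: (p1 z z1).1.
  - exists 2; have := @rel_transfer X R U [:: C] (fun e => scirc e.1 -> ~ (2 <= p e.1)) _ (u, tt).
    rewrite !rules ?prs; apply => // -[z []] /= z1; apply/negP; rewrite -ltNge.
    by rewrite (le_lt_trans (p1 z z1).2) // ltr1n.
  - move=> r r' rr'; have := @rel_transfer X R U [:: C] (fun e => r' <= p e.1 -> r <= p e.1) _ (u, tt).
    rewrite !rules; apply => -[z []] /=; exact: le_trans.
have [x xP] := br (@complex.Re R) (@normc_ge_Re R).
have [|y yP] := br (@complex.Im R).
  by move=> z; rewrite normc_def lecR -[X in X <= _]sqrtr_sqr ler_wsqrtr // lerDr sqr_ge0.
have near_xy ε : 0 < ε -> near ε u (star (x +i* y)).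
  move=> ε0; have e3 : 0 < ε / 4 by rewrite divr_gt0.
  have [x1 x2] := xP _ e3; have [y1 y2] := yP _ e3.
  have := @rel_transfer X R U [:: C] (fun e => x - ε / 4 <= complex.Re e.1 ->
    ~ (x + ε / 4 <= complex.Re e.1) -> y - ε / 4 <= complex.Im e.1 ->
    ~ (y + ε / 4 <= complex.Im e.1) -> snear ε e.1 (x +i* y)) _ (u, tt).
  rewrite !rules ?prs; apply => // -[[a b] []] /= h1 /negP h2 h3 /negP h4.
  rewrite -ltNge in h2; rewrite -ltNge in h4.
  rewrite /snear normc_def /= ltcR.
  apply: (@le_lt_trans _ _ (`|a - x| + `|b - y|)).
    rewrite -[leRHS]ger0_norm ?addr_ge0 // -[leRHS]sqrtr_sqr ler_wsqrtr // [(`|_| + _) ^+ 2]sqrrD.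
    rewrite !real_normK ?num_real // addrAC lerDl mulrn_wge0 // mulr_ge0 //.
  have : `|a - x| <= ε / 4 by rewrite ler_distl h1 ltW.
  have : `|b - y| <= ε / 4 by rewrite ler_distl h3 ltW.
  lra.
exists (x +i* y); split=> //; apply/eqP; rewrite -subr_eq0; apply/eqP.
apply: arbitrarily_small_eq0 => ε ε0.
have := @rel_transfer X R U [:: C] (fun e => scirc e.1 -> snear ε e.1 (x +i* y) ->
  `| `|x +i* y| - 1| < ε%:C) _ (u, tt).
rewrite !rules ?prs; apply => //; last exact: near_xy.
move=> [z []] /= z1; rewrite /snear; apply: le_lt_trans.
by rewrite -z1 distrC; exact: ler_dist_dist.
Qed.

Lemma approx_star_inj u c d : Defs.approx u (star c) -> Defs.approx u (star d) -> c = d.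
Proof.
move=> uc ud; apply/eqP; rewrite -subr_eq0; apply/eqP.
apply: arbitrarily_small_eq0 => ε ε0; apply/near_star.
have e0 : 0 < ε / 2 by rewrite divr_gt0.
rewrite [ε](splitr ε); exact: near_trans (near_sym (uc _ e0)) (ud _ e0).
Qed.

Lemma stdpartE u c : Defs.approx u (star c) -> stdpart u = c.
Proof.
move=> uc; rewrite /stdpart; case: xgetP => [d _ /= ud|/(_ c)//].
exact: approx_star_inj ud uc.
Qed.

Lemma stdpart_norm u : circ u -> `|stdpart u| = 1.
Proof. by move=> /standard_part_ex[c [c1 /stdpartE ->]]. Qed.

Lemma stdpart_approx u : circ u -> Defs.approx u (star (stdpart u)).
Proof. by move=> /standard_part_ex[c [c1 uc]]; rewrite (stdpartE uc). Qed.

Lemma stdpart_mul u v : circ u -> circ v ->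
  stdpart (cmul u v) = stdpart u * stdpart v.
Proof.
move=> u1 v1; apply: stdpartE => ε ε0; rewrite -cmul_star.
have e0 : 0 < ε / 2 by rewrite divr_gt0.
rewrite [ε](splitr ε); apply: near_cmul2 => //; last 2 first.
- exact: stdpart_approx.
- exact: stdpart_approx.
- by apply/circ_star; exact: stdpart_norm.
Qed.

Lemma near_stdpart ε η u v : circ u -> circ v -> ε < η ->
  near ε u v -> `|stdpart u - stdpart v| < η%:C.
Proof.
move=> u1 v1 εη uv; apply/near_star.
have e0 : 0 < (η - ε) / 2 by rewrite divr_gt0 // subr_gt0.
have -> : η = (η - ε) / 2 + (ε + (η - ε) / 2) by lra.
apply: near_trans (near_sym (stdpart_approx u1 e0)) _.
exact: near_trans uv (stdpart_approx v1 e0).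
Qed.

Lemma stdpart_near ε η u v : circ u -> circ v -> ε < η ->
  `|stdpart u - stdpart v| < ε%:C -> near η u v.
Proof.
move=> u1 v1 εη /near_star uv.
have e0 : 0 < (η - ε) / 2 by rewrite divr_gt0 // subr_gt0.
have -> : η = (η - ε) / 2 + (ε + (η - ε) / 2) by lra.
apply: near_trans (stdpart_approx u1 e0) _.
exact: near_trans uv (near_sym (stdpart_approx v1 e0)).
Qed.

End nonstandard_circle.

(** If |h - 1| <= 1/2 everywhere, then |h(2x) - 1| = |h(x) - 1| |h(x) + 1| is at
    least 3/2 |h(x) - 1|.  Iterating, |h(x) - 1| (3/2)^n <= 1/2 for all n; the
    proof uses 1 + n/2 in place of (3/2)^n. *)
Lemma no_small_subgroup (R : realType) (V : zmodType) (H : set V) (h : V -> R[i]) :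
  subgroup H -> (forall x, H x -> `|h x| = 1) ->
  (forall x y, H x -> H y -> h (x + y) = h x * h y) ->
  (forall x, H x -> `|h x - 1| <= (2^-1)%:C) -> forall x, H x -> h x = 1.
Proof.
move=> [H0 HB] h1 hD hle x Hx.
have HD y z : H y -> H z -> H (y + z).
  by move=> Hy Hz; rewrite -[z]opprK; apply: (HB _ (- z)) => //; rewrite -[- z]add0r; exact: HB.
have geom n : forall y, H y -> `|h y - 1| * (1 + n%:R / 2) <= 1 / 2.
  elim: n => [|n IH] y Hy.
    by rewrite mul0r addr0 mulr1 mul1r; have := hle y Hy; rewrite fmorphV rmorph_nat.
  have := IH _ (HD y y Hy Hy); rewrite hD //.
  have -> : h y * h y - 1 = (h y - 1) * (h y + 1) by ring.
  rewrite normrM; apply: le_trans.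
  rewrite -mulrA ler_wpM2l //.
  have h32 : 3 / 2 <= `|h y + 1|.
    have -> : h y + 1 = 2 - (1 - h y) by ring.
    apply: le_trans (lerB_dist _ _); rewrite distrC ger0_norm ?ler0n //.
    have := hle y Hy; rewrite fmorphV rmorph_nat => hy.
    rewrite lerBrDr -lerBrDl; apply: le_trans hy _.
    by rewrite le_eqVlt; apply/orP; left; apply/eqP; field.
  apply: (@le_trans _ _ (3 / 2 * (1 + n%:R / 2))).
    rewrite -subr_ge0; have -> : 3 / 2 * (1 + n%:R / 2) - (1 + n.+1%:R / 2) = n%:R / 4 :> R[i].
      by rewrite -natr1; field.
    by rewrite divr_ge0 ?ler0n.
  by rewrite ler_wpM2r // addr_ge0 ?divr_ge0 ?ler0n.
apply/eqP; rewrite -subr_eq0; apply/eqP; apply: arbitrarily_small_eq0 => ε ε0.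
have [r rE] : exists r, `|h x - 1| = r%:C by rewrite normc_def; eexists.
rewrite rE ltcR ltNge; apply/negP => le.
have r0 : 0 < r by exact: lt_le_trans le.
have := geom (Num.bound r^-1) x Hx.
have -> : `|h x - 1| * (1 + (Num.bound r^-1)%:R / 2) = (r * (1 + (Num.bound r^-1)%:R / 2))%:C.
  by rewrite rE rmorphM rmorphD /= rmorph1 rmorphM fmorphV !rmorph_nat.
have -> : 1 / 2 = (1 / 2)%:C :> R[i] by rewrite rmorphM fmorphV /= rmorph1 rmorph_nat.
rewrite lecR => hb.
have : r^-1 < (Num.bound r^-1)%:R.
  by apply: archi_boundP; rewrite invr_ge0 ltW.
rewrite -(ltr_pM2l r0) divff ?gt_eqF //; nra.
Qed.

(** * The stability theorem for internal groups *)

Definition sle (m n : nat) : Prop := (m <= n)%N.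

Section internal_stability.
Context (X : Type) (R : realType) (U : nsuniverse X R).
Local Notation El := (El X R).
Local Notation C := sCplx.
Local Notation near := (@near X R U).
Local Notation circ := (@in_circle X R U).
Local Notation star := (star U sCplx).
Local Notation prs := (pr0, pr1, pr2, pr3, pr4, pr5, pr6, pr7, pr8, pr9, pr10, pr11).
Local Notation rules := (rel_imp, rel_and, rel_or, rel_not, rel_near, rel_circ,
   rel_eq, rel_mem, func_mul, func_const, func_app, rel_const).

Context (G : higroup U).
Local Notation s := (gsort G).
Local Notation add := (app2 (gadd G)).

(** The extension of [covered] for standard k. *)
Fixpoint covered_star (A : U (sPow s)) k (Q : U (sPow s)) : Prop :=
  if k is m.+1 then exists d, exists Q',
    inn d (gset G) /\ (covered_star A m Q' /\
      forall x, inn x Q -> inn x Q' \/ exists a, inn a A /\ x = add d a)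
  else forall x, ~ inn x Q.

Local Notation Γc := [:: sPow s; sPow s; sPow s; sFun s (sFun s s)].

Lemma rel_covered_star (A Q : U (sPow s)) k :
  @rel_star X R U Γc (fun e => covered (e.2.2.2.1 : El s -> El s -> El s) e.2.2.1 e.2.1 k e.1)
    (Q, (A, (gset G, (gadd G, tt)))) <-> covered_star A k Q.
Proof.
elim: k Q => [|k IH] Q.
  rewrite -[X in X <-> _]/(@rel_star X R U Γc (fun e => forall x, ~ smem e.1 x) _).
  by rewrite rel_all; split=> h x; have := h x; rewrite !rules ?prs.
rewrite -[X in X <-> _]/(@rel_star X R U Γc (fun e => exists d, exists Q' : El (sPow s),
  smem e.2.2.1 d /\ (covered (e.2.2.2.1 : El s -> El s -> El s) e.2.2.1 e.2.1 k Q' /\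
   forall x, smem e.1 x -> smem Q' x \/
     exists a, smem e.2.1 a /\ x = sapp (sapp e.2.2.2.1 d) a)) _).
pose r (e : env El Γc) : Prop :=
  covered (e.2.2.2.1 : El s -> El s -> El s) e.2.2.1 e.2.1 k e.1.
have inner d Q' : @rel_star X R U [:: sPow s, s & Γc] (fun b =>
     covered (b.2.2.2.2.2.1 : El s -> El s -> El s) b.2.2.2.2.1 b.2.2.2.1 k b.1)
   (Q', (d, (Q, (A, (gset G, (gadd G, tt)))))) <-> covered_star A k Q'.
  rewrite -IH.
  by have <- := @rel_select X R U Γc [:: sPow s, s & Γc] r
    (vz _ _, (vs _ (vs _ (vs _ (vz _ _))), (vs _ (vs _ (vs _ (vs _ (vz _ _)))),
      (vs _ (vs _ (vs _ (vs _ (vs _ (vz _ _))))), tt))))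
    (Q', (d, (Q, (A, (gset G, (gadd G, tt)))))).
rewrite rel_ex; split=> [[d]|[d [Q' [Gd [/inner cQ' H]]]]].
  rewrite rel_ex => -[Q']; rewrite !rules ?prs /= => -[Gd].
  move=> [/inner cQ']; rewrite rel_all => H; exists d, Q'; split=> //; split=> // x.
  have := H x; rewrite !rules ?prs /= rel_ex => {}H /H[?|[a]]; first by left.
  by rewrite !rules ?prs /= => -[Aa xa]; right; exists a.
exists d; rewrite rel_ex; exists Q'; rewrite !rules ?prs /=; split=> //.
split=> //; rewrite rel_all => x; rewrite !rules ?prs /= => /H[?|[a [Aa xa]]]; [by left|right].
by rewrite rel_ex; exists a; rewrite !rules ?prs.
Qed.

Definition nfold_star (A : U (sPow s)) n : U (sPow s) :=
  @fun_star X R U [:: sPow s; sFun s (sFun s s); s] (sPow s)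
    (fun e => nfold (e.2.1 : El s -> El s -> El s) e.2.2.1 e.1 n)
    (A, (gadd G, (gzero G, tt))).

(** For a standard number n of summands, an external set that is closed under
    adding elements of A and contains 0, such as G_f, contains the n-fold sum. *)
Lemma nfold_star_min (A : U (sPow s)) (S : set (U s)) n : S (gzero G) ->
  (forall x a, S x -> inn a A -> S (add x a)) -> ext (nfold_star A n) `<=` S.
Proof.
move=> S0 SA; elim: n => [|n IH] z.
  have := @rel_transfer X R U [:: s; sPow s; sFun s (sFun s s); s]
    (fun e => smem (nfold (e.2.2.1 : El s -> El s -> El s) e.2.2.2.1 e.2.1 0) e.1 ->
      e.2.2.2.1 = e.1) _ (z, (A, (gadd G, (gzero G, tt)))).
  rewrite !rules ?prs /= (@func_weaken X R U s (sPow s) [:: sPow s; sFun s (sFun s s); s]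
    (fun e => nfold (e.2.1 : El s -> El s -> El s) e.2.2.1 e.1 0)).
  by move=> h zA; rewrite -h // => a; exact: esym.
pose r (e : env El [:: s; sPow s; sFun s (sFun s s); s]) :=
  smem (nfold (e.2.2.1 : El s -> El s -> El s) e.2.2.2.1 e.2.1 n.+1) e.1 ->
  exists x a, smem (nfold (e.2.2.1 : El s -> El s -> El s) e.2.2.2.1 e.2.1 n) x
    /\ (smem e.2.1 a /\ e.1 = sapp (sapp e.2.2.1 x) a).
have rT : forall e, r e.
  by move=> a [x [b [xn Ab ->]]]; exists x, b.
have := rel_transfer rT (z, (A, (gadd G, (gzero G, tt)))).
rewrite /r !rules ?prs /= (@func_weaken X R U s (sPow s) [:: sPow s; sFun s (sFun s s); s]
    (fun e => nfold (e.2.1 : El s -> El s -> El s) e.2.2.1 e.1 n.+1)).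
move=> /[apply]; rewrite rel_ex => -[x].
rewrite rel_ex => -[a]; rewrite !rules ?prs /= => -[xn [Aa ->]]; apply: SA => //.
apply: IH; move: xn.
rewrite (@func_weaken X R U s (sPow s) [:: s; s; sPow s; sFun s (sFun s s); s]
    (fun e => nfold (e.2.2.2.1 : El s -> El s -> El s) e.2.2.2.2.1 e.2.2.1 n)).
rewrite (@func_weaken X R U s (sPow s) [:: s; sPow s; sFun s (sFun s s); s]
    (fun e => nfold (e.2.2.1 : El s -> El s -> El s) e.2.2.2.1 e.2.1 n)).
by rewrite (@func_weaken X R U s (sPow s) [:: sPow s; sFun s (sFun s s); s]
    (fun e => nfold (e.2.1 : El s -> El s -> El s) e.2.2.1 e.1 n)).
Qed.

Local Notation Γ := [:: sFun s C; sPow s; sPow s; sPow s; sFun s (sFun s s); s;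
  sFun s s; sNat; sFun s sNat].
(** [set_stability] as a standard relation between all its data, with the group
    laws written out so that they can be transferred. *)
Definition stability_statement (k N M p : nat) (e : env El Γ) : Prop :=
  let f := e.1 in let A := e.2.1 in let Q := e.2.2.1 in let G := e.2.2.2.1 in
  let add := e.2.2.2.2.1 in let zero := e.2.2.2.2.2.1 in
  let opp := e.2.2.2.2.2.2.1 in let n := e.2.2.2.2.2.2.2.1 in
  let h := e.2.2.2.2.2.2.2.2.1 in
  smem G zero ->
  (forall x, smem G x -> smem G (sapp opp x)) ->
  (forall x y, smem G x -> smem G y -> smem G (sapp (sapp add x) y)) ->
  (forall x y z, smem G x -> smem G y -> smem G z ->
     sapp (sapp add x) (sapp (sapp add y) z) = sapp (sapp add (sapp (sapp add x) y)) z) ->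
  (forall x y, smem G x -> smem G y -> sapp (sapp add x) y = sapp (sapp add y) x) ->
  (forall x, smem G x -> sapp (sapp add zero) x = x) ->
  (forall x, smem G x -> sapp (sapp add (sapp opp x)) x = zero) ->
  (forall x, smem G x -> sle (sapp h x) n) ->
  (forall x y, smem G x -> smem G y -> sapp h x = sapp h y -> x = y) ->
  (forall x, smem A x -> smem G x) ->
  smem A zero ->
  (forall x y, smem A x -> smem A y -> smem Q (sapp (sapp add x) y)) ->
  covered (add : El s -> El s -> El s) G A k Q ->
  (forall x, scirc (sapp f x)) ->
  (forall x y, smem (nfold (add : El s -> El s -> El s) zero A N) x ->
     smem (nfold (add : El s -> El s -> El s) zero A N) y ->
     snear M%:R^-1 (sapp f (sapp (sapp add x) y)) (sapp f x * sapp f y)) ->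
  exists g : El (sFun s C), (forall x, scirc (sapp g x)) /\
    ((forall x, ~ smem G x -> sapp g x = 1) /\
    ((forall x y, smem G x -> smem G y -> sapp g (sapp (sapp add x) y) = sapp g x * sapp g y) /\
    forall a, smem A a -> snear p%:R^-1 (sapp g a) (sapp f a))).

Lemma rel_le Γ' (x y : env El Γ' -> El sNat) e :
  @rel_star X R U Γ' (fun a => sle (x a) (y a)) e =
  leN (@fun_star X R U Γ' sNat x e) (@fun_star X R U Γ' sNat y e).
Proof. exact: (@rel_comp2 X R U sNat sNat Γ' sle). Qed.

Lemma internal_stability (k p : nat) : (0 < p)%N -> exists N M, (0 < M)%N /\
  forall (A Q : U (sPow s)) (f : U (sFun s C)),
   ext A `<=` ext (gset G) -> inn (gzero G) A ->
   (forall x y, inn x A -> inn y A -> inn (add x y) Q) ->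
   covered_star A k Q -> (forall x, circ (app f x)) ->
   (forall x y, inn x (nfold_star A N) -> inn y (nfold_star A N) ->
     near M%:R^-1 (app f (add x y)) (cmul (app f x) (app f y))) ->
   exists γ : char G, forall a, inn a A -> near p%:R^-1 (app (sval γ) a) (app f a).
Proof.
move=> p0; have [N [M [M0 H]]] := @set_stability R k p p0; exists N, M; split=> // A Q f AG A0 AQ Acov f1 fD.
have T : forall e, stability_statement k N M p e.
  rewrite /stability_statement => -[f' [A' [Q' [G' [add' [zero' [opp' [n' [h' []]]]]]]]]] /=.
  move=> a1 a2 a3 a4 a5 a6 a7 a8 a9 a10 a11 a12 a13 a14 a15.
  have [g [g1 g2 g3 g4]] := H _ (SetGroup a1 a2 a3 a4 a5 a6 a7 a8 a9) A' Q' f' a10 a11 a12 a13 a14 a15.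
  by exists g; split=> //; split=> //; split=> //.
have [n [h hP]] := ghyperfinite G.
have := rel_transfer T (f, (A, (Q, (gset G, (gadd G, (gzero G, (gopp G, (n, (h, tt))))))))).
rewrite /stability_statement !rel_imp rel_ex.
case=> [|||||||||||||||g].
- by rewrite !rules ?prs; exact: gset0.
- by rewrite rel_all => x; rewrite !rules ?prs; exact: gsetN.
- by rewrite rel_all => x; rewrite rel_all => y; rewrite !rules ?prs; exact: gsetD.
- rewrite rel_all => x; rewrite rel_all => y; rewrite rel_all => z.
  rewrite !rules ?prs; exact: gaddA.
- by rewrite rel_all => x; rewrite rel_all => y; rewrite !rules ?prs; exact: gaddC.
- by rewrite rel_all => x; rewrite !rules ?prs; exact: gadd0.
- by rewrite rel_all => x; rewrite !rules ?prs; exact: gaddN.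
- rewrite rel_all => x; rewrite !rules rel_le func_app ?prs => Gx.
  by case: hP => hf _ _; have [] := hf x Gx.
- rewrite rel_all => x; rewrite rel_all => y; rewrite !rules ?prs => Gx Gy hxy.
  by case: hP => _ hi _; exact: hi (mem_set Gx) (mem_set Gy) hxy.
- by rewrite rel_all => x; rewrite !rules ?prs; exact: AG.
- by rewrite !rules ?prs.
- by rewrite rel_all => x; rewrite rel_all => y; rewrite !rules ?prs; exact: AQ.
- pose v : env (var Γ) Γc := (vs _ (vs _ (vz _ _)), (vs _ (vz _ _),
    (vs _ (vs _ (vs _ (vz _ _))), (vs _ (vs _ (vs _ (vs _ (vz _ _)))), tt)))).
  pose r (e : env El Γc) : Prop :=
    covered (e.2.2.2.1 : El s -> El s -> El s) e.2.2.1 e.2.1 k e.1.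
  suff : @rel_star X R U Γ (fun a => r (select v a))
    (f, (A, (Q, (gset G, (gadd G, (gzero G, (gopp G, (n, (h, tt))))))))) by [].
  by rewrite rel_select; exact/rel_covered_star.
- by rewrite rel_all => x; rewrite !rules ?prs; exact: f1.
- pose v : env (var [:: s, s & Γ]) [:: sPow s; sFun s (sFun s s); s] :=
    (vs _ (vs _ (vs _ (vz _ _))),
      (vs _ (vs _ (vs _ (vs _ (vs _ (vs _ (vz _ _)))))),
       (vs _ (vs _ (vs _ (vs _ (vs _ (vs _ (vs _ (vz _ _))))))), tt))).
  rewrite rel_all => x; rewrite rel_all => y.
  rewrite !rules ?prs /=.
  have E := @func_select X R U (sPow s) _ _
    (fun e : env El [:: sPow s; sFun s (sFun s s); s] =>
       nfold (e.2.1 : El s -> El s -> El s) e.2.2.1 e.1 N) v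
    (y, (x, (f, (A, (Q, (gset G, (gadd G, (gzero G, (gopp G, (n, (h, tt))))))))))).
  rewrite [X in inn x X -> _]E [X in _ -> inn y X -> _]E.
  exact: fD.
rewrite !rel_and !rel_all => -[g1 [g2 [g3 g4]]].
have gchar : is_char (G := G) g.
  split=> [x|x|x y].
  - by have := g1 x; rewrite !rules ?prs.
  - by have := g2 x; rewrite !rules ?prs.
  - by have := g3 x; rewrite rel_all => /(_ y); rewrite !rules ?prs.
exists (exist _ g gchar) => a; have := g4 a; rewrite !rules ?prs /=; exact.
Qed.

End internal_stability.

(** * Internal sets and saturation *)

Lemma set_seq_cons (I : eqType) (i : I) (l : seq I) :
  [set` i :: l] = i |` [set` l].
Proof.
apply/seteqP; split=> j /=; rewrite inE; first by case/predU1P=> [->|]; [left|right].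
by case=> [->|->]; rewrite ?eqxx ?orbT.
Qed.

Section internal_sets.
Context (X : Type) (R : realType) (U : nsuniverse X R).
Local Notation El := (El X R).
Local Notation C := sCplx.
Local Notation near := (@near X R U).
Local Notation star := (star U sCplx).
Local Notation prs := (pr0, pr1, pr2, pr3, pr4, pr5, pr6).
Local Notation rules := (rel_imp, rel_and, rel_or, rel_not, rel_near, rel_circ,
   rel_eq, rel_mem, func_mul, func_const, func_app, rel_const).

Lemma internalU s (S S' : set (U s)) : internal S -> internal S' -> internal (S `|` S').
Proof.
move=> iS iS'; rewrite -[_ `|` _]setCK setCU.
by apply: internalC; apply: internalI; apply: internalC.
Qed.

Lemma internal0 s : U (sPow s) -> internal (set0 : set (U s)).
Proof.
move=> A; rewrite -(setICr (ext A)).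
by apply: internalI; [exists A|apply: internalC; exists A].
Qed.

Section group.
Context (G : higroup U).
Local Notation s := (gsort G).
Local Notation iG := (@internal_in X R U _ (elt G) sval).

Lemma internal_setI (A B : set (elt G)) : iG A -> iG B -> iG (A `&` B).
Proof.
move=> [a ->] [b ->]; have [c cE] : internal (ext a `&` ext b).
  by apply: internalI; [exists a|exists b].
by exists c; rewrite -cE.
Qed.

Lemma internal_setU (A B : set (elt G)) : iG A -> iG B -> iG (A `|` B).
Proof.
move=> [a ->] [b ->]; have [c cE] : internal (ext a `|` ext b).
  by apply: internalU; [exists a|exists b].
by exists c; rewrite -cE.
Qed.

Lemma internal_setC (A : set (elt G)) : iG A -> iG (~` A).
Proof.
move=> [a ->]; have [c cE] : internal (~` ext a) by apply: internalC; exists a.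
by exists c; rewrite -cE.
Qed.

Lemma internal_opp (A : set (elt G)) : iG A -> iG (-%R @^-1` A).
Proof.
move=> [a ->]; have [b bE] : internal (app (gopp G) @^-1` ext a).
  by apply: internal_preim; exists a.
by exists b; rewrite -bE.
Qed.

(** Internal subsets of G can be coded by internal sets without elements outside
    G, which is needed to quantify over their elements internally. *)
Lemma internal_gset (A : set (elt G)) : iG A -> exists a, 
  A = sval @^-1` ext a /\ ext a `<=` ext (gset G).
Proof.
move=> [a ->]; have [c cE] : internal (ext a `&` ext (gset G)).
  by apply: internalI; [exists a|exists (gset G)].
exists c; rewrite -cE; split=> [|x []//].
by apply/seteqP; split=> [x ax|x []//]; split=> //; exact: svalP.
Qed.

Lemma internal_sum (A B : set (elt G)) : iG A -> iG B ->
  iG [set x + y | x in A & y in B].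
Proof.
move=> /internal_gset[a [-> aG]] /internal_gset[b [-> bG]].
have [c cE] := @internal_rel X R U s [:: sFun s (sFun s s); sPow s; sPow s]
  (fun e => exists x, exists y, smem e.2.2.1 x /\ (smem e.2.2.2.1 y /\
    e.1 = sapp (sapp e.2.1 x) y)) (gadd G, (a, (b, tt))).
exists c; rewrite -cE; apply/seteqP; split=> [_ [x ax [y bY <-]]|z].
  rewrite /preimage/= rel_ex; exists (sval x); rewrite rel_ex; exists (sval y).
  by rewrite !rules ?prs; do 2!split=> //.
rewrite /preimage/= rel_ex => -[x]; rewrite rel_ex => -[y]; rewrite !rules ?prs /= => -[ax [bY zE]].
exists (exist _ x (aG _ ax)) => //; exists (exist _ y (bG _ bY)) => //.
exact: elt_inj.
Qed.

Lemma internal_bigU (I : Type) (l : seq {classic I}) (A : I -> set (elt G)) :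
  (forall i, i \in l -> iG (A i)) -> iG (\bigcup_(i in [set` l]) A i).
Proof.
elim: l => [|i l IH] H.
  rewrite set_nil bigcup_set0; have [z zE] := internal0 (gset G).
  by exists z; rewrite -zE.
rewrite set_seq_cons bigcup_setU1; apply: internal_setU.
  by apply: H; rewrite inE eqxx.
by apply: IH => j jl; apply: H; rewrite inE jl orbT.
Qed.

End group.

Definition piecewise s (A : U (sPow s)) (u : U C) (f : U (sFun s C)) : U (sFun s C) :=
  @fun_star X R U [:: sPow s; C; sFun s C] (sFun s C)
    (fun e x => if `[< smem e.1 x >] then e.2.1 else sapp e.2.2.1 x) (A, (u, (f, tt))).

Lemma app_piecewise_in s (A : U (sPow s)) u f x : inn x A -> app (piecewise A u f) x = u.
Proof.
pose F (e : env El [:: sPow s; C; sFun s C]) : El (sFun s C) :=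
  fun x => if `[< smem e.1 x >] then e.2.1 else sapp e.2.2.1 x.
have := @rel_transfer X R U [:: s; sPow s; C; sFun s C] (fun e => smem e.2.1 e.1 ->
  sapp (F e.2) e.1 = e.2.2.1) _ (x, (A, (u, (f, tt)))).
rewrite !rules ?prs (@func_weaken X R U s _ _ F); apply => -[y [B [v [g []]]]] /=.
by move=> yB; rewrite /sapp /F /=; case: asboolP.
Qed.

Lemma app_piecewise_out s (A : U (sPow s)) u f x :
  ~ inn x A -> app (piecewise A u f) x = app f x.
Proof.
pose F (e : env El [:: sPow s; C; sFun s C]) : El (sFun s C) :=
  fun x => if `[< smem e.1 x >] then e.2.1 else sapp e.2.2.1 x.
have := @rel_transfer X R U [:: s; sPow s; C; sFun s C] (fun e => ~ smem e.2.1 e.1 ->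
  sapp (F e.2) e.1 = sapp e.2.2.2.1 e.1) _ (x, (A, (u, (f, tt)))).
rewrite !rules ?prs (@func_weaken X R U s _ _ F); apply => -[y [B [v [g []]]]] /=.
by move=> yB; rewrite /sapp /F /=; case: asboolP.
Qed.

(** Being an internal character is itself expressed by a formula. *)
Lemma internal_near_chars (G : higroup U) (ε : R) (A : U (sPow (gsort G)))
    (f : U (sFun (gsort G) C)) : internal
  [set g | is_char (G := G) g /\ forall x, inn x A -> near ε (app g x) (app f x)].
Proof.
set s := gsort G.
have [c cE] := @internal_rel X R U (sFun s C)
  [:: sPow s; sFun s (sFun s s); sPow s; sFun s C]
  (fun e => (forall x, scirc (sapp e.1 x)) /\ 
   ((forall x, ~ smem e.2.1 x -> sapp e.1 x = 1 :> El C) /\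
   ((forall x y, smem e.2.1 x -> smem e.2.1 y ->
     sapp e.1 (sapp (sapp e.2.2.1 x) y) = sapp e.1 x * sapp e.1 y :> El C) /\
   (forall x, smem e.2.2.2.1 x -> snear ε (sapp e.1 x) (sapp e.2.2.2.2.1 x)))))
  (gset G, (gadd G, (A, (f, tt)))).
exists c; rewrite -cE; apply/seteqP; split=> g; rewrite /mkset !rel_and !rel_all.
  move=> [[g1 g2 g3] g4]; split; [|split; [|split]] => x.
  - by have := g1 x; rewrite !rules ?prs.
  - by have := g2 x; rewrite !rules ?prs.
  - by rewrite rel_all => y; have := g3 x y; rewrite !rules ?prs.
  - by have := g4 x; rewrite !rules ?prs; exact.
move=> [g1 [g2 [g3 g4]]]; split; [split=> [x|x|x y]|move=> x].
- by have := g1 x; rewrite !rules ?prs.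
- by have := g2 x; rewrite !rules ?prs.
- by have := g3 x; rewrite rel_all => /(_ y); rewrite !rules ?prs.
- by have := g4 x; rewrite !rules ?prs; exact.
Qed.
Lemma char_stdpart_hom (G : higroup U) (γ : char G) (x y : elt G) :
  stdpart (app (sval γ) (sval (x + y))) =
  stdpart (app (sval γ) (sval x)) * stdpart (app (sval γ) (sval y)).
Proof.
have [γ1 _ γD] := svalP γ.
rewrite -stdpart_mul //; congr stdpart; rewrite -γD //; exact: svalP.
Qed.

End internal_sets.

Section saturation.
Context (X : Type) (R : realType) (K : Type) (U : satuniverse X R K).

(** Saturation with the index kept, so that data attached to the members of an
    admissible family can be used on its finite subfamilies. *)
Lemma saturated_family s (I : Type) (F : set I) (W : I -> U (sPow s)) :
  admissible K F ->
  (forall l : seq {classic I}, (forall a, a \in l -> F a) ->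
     exists x, forall a, a \in l -> ext (W a) x) ->
  exists x, forall a, F a -> ext (W a) x.
Proof.
move=> FK H; have [|D finD DF|x xP] := @saturated X R K U s (W @` F).
- exact: admissible_image.
- have /finite_seqP[l lD] := finD : finite_set (D : set {classic _}).
  have {}DF : [set` l] `<=` W @` F by rewrite -lD.
  have [l' [l'F ll']] : exists l' : seq {classic I}, (forall a, a \in l' -> F a) /\
      forall b, b \in l -> exists2 a, a \in l' & W a = b.
    elim: l {lD} DF => [|b l IH] DF; first by exists [::].
    have [|l' [l'F ll']] := IH.
      by move=> c cl; apply: DF; rewrite /= inE [c \in l]cl orbT.
    have [a Fa Wab] : (W @` F) b by apply: DF; rewrite /= inE eqxx.
    exists ((a : {classic I}) :: l'); split=> [c|c]; rewrite inE => /predU1P[->//|].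
    - exact: l'F.
    - by exists a => //; rewrite inE eqxx.
    - by move=> /ll'[a' a'l' <-]; exists a' => //; rewrite inE a'l' orbT.
  have [x xP] := H l' l'F; exists x; rewrite lD => b /ll'[a al' <-]; exact: xP.
- by exists x => a Fa; apply: xP; exists a.
Qed.

Lemma admissible_set1 (I : Type) (a : I) : admissible K [set a].
Proof.
apply/negP => h; apply: (kappa_uncountable (U)).
by apply: sub_countable h _; exact: finite_set_countable.
Qed.

Lemma internalT s : U (sPow s) -> exists t : U (sPow s), ext t = setT.
Proof.
move=> A; have [t tE] : internal (ext A `|` ~` ext A).
  by apply: internalU; [exists A|apply: internalC; exists A].
by exists t; rewrite -tE setUCr.
Qed.

(** An intersection over the empty family is the whole sort, which is internal;
    a one-element family is admissible because κ is uncountable. *)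
Lemma monadic_nonempty s (A : U (sPow s)) (S : set (U s)) : monadic S ->
  exists F : set (U (sPow s)), [/\ admissible K F, F !=set0 & S = \bigcap_(a in F) ext a].
Proof.
move=> [F FK ->]; have [F0|/set0P F0] := eqVneq F set0; last by exists F.
have [t tT] := internalT A.
exists [set t]; split; [exact: admissible_set1|by exists t|].
by rewrite F0 bigcap_set0 bigcap_set1 tT.
Qed.

End saturation.

(** * Lifting continuous characters *)

Lemma subgroupN (V : zmodType) (H : set V) x : subgroup H -> H x -> H (- x).
Proof. by move=> [H0 HB] Hx; rewrite -[- x]add0r; exact: HB. Qed.

Lemma subgroupD (V : zmodType) (H : set V) x y : subgroup H -> H x -> H y -> H (x + y).
Proof.
by move=> sH Hx Hy; rewrite -[y]opprK; apply: sH.2 => //; exact: subgroupN.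
Qed.

Section triplet.
Context (X : Type) (R : realType) (K : Type) (U : satuniverse X R K) (T : triplet U).
Local Notation G := (elt T).
Local Notation G0 := (lower (pair0f T)).
Local Notation Gf := (upper (pair0f T)).
Local Notation s := (gsort T).
Local Notation C := sCplx.
Local Notation near := (@near X R U).
Local Notation circ := (@in_circle X R U).
Local Notation star := (star U sCplx).
Local Notation internalG := (@internalG X R K U T).

Let sG0 : subgroup G0 := lower_subgroup (pair0f T).
Let sGf : subgroup Gf := upper_subgroup (pair0f T).

Lemma internal_core : exists B : set G,
  [/\ internalG B, G0 `<=` B, B `<=` Gf & forall x, B x -> B (- x)].
Proof.
have [||C [G0C CGf]] := monadic_galactic_separation (g := gset T)
    (lower_monadic T) (upper_galactic T).
- by move=> _ [y /lower_upper Gy <-]; exists y.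
- by move=> _ [y _ <-]; exact: svalP.
pose B : set G := sval @^-1` ext C.
have C1 : G0 `<=` B by move=> x G0x; apply: G0C; exists x.
have C2 : B `<=` Gf by move=> x Cx; have [y Gfy /elt_inj <-] := CGf _ Cx.
have iB : internalG B by exists C.
exists (B `&` (-%R @^-1` B)); split.
- by apply: internal_setI => //; exact: internal_opp.
- by move=> x G0x; split; apply: C1 => //; exact: subgroupN.
- by move=> x [/C2].
- by move=> x [Cx CNx]; split=> //; rewrite /preimage /= opprK.
Qed.

Lemma internal_symmetric_hull (A : set G) : internalG A -> A `<=` Gf ->
  exists B, [/\ internalG B, A `<=` B, G0 `<=` B, B `<=` Gf & forall x, B x -> B (- x)].
Proof.
move=> iA AGf; have [C [iC G0C CGf CN]] := internal_core.
exists (C `|` (A `|` -%R @^-1` A)); split.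
- by do 2 apply: internal_setU => //; exact: internal_opp.
- by move=> x Ax; right; left.
- by move=> x /G0C; left.
- move=> x [/CGf//|[/AGf//|/AGf h]].
  by rewrite -[x]opprK; exact: subgroupN.
- move=> x [/CN|[Ax|ANx]]; [by left|right; right|by right; left].
  by rewrite /preimage /= opprK.
Qed.

Lemma galactic_exhaustion : exists F : set (U (sPow s)),
  [/\ admissible K F, forall x, Gf x -> exists2 a, F a & inn (sval x) a &
      forall a, F a -> ext a `<=` sval @` Gf].
Proof.
have [F FK E] := upper_galactic T; exists F; split=> //.
- move=> x Gfx; have : (\bigcup_(A in F) ext A) (sval x) by rewrite -E; exists x.
  by move=> [a Fa ax]; exists a.
- by move=> a Fa x ax; rewrite E; exists a.
Qed.

(** The translates used already are removed from q, which keeps it internal. *)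
Lemma finite_cover_covered_star (b : U (sPow s)) (q : U (sPow s)) (l : seq {classic G}) :
  ext q `<=` ext (gset T) ->
  (forall x : G, inn (sval x) q -> exists2 d, d \in l & exists2 y, inn (sval y) b & x = d + y) ->
  exists k, covered_star b k q.
Proof.
elim: l q => [|d l IH] q qG ql.
  by exists 0%N => x qx; have [d] := ql (exist _ x (qG _ qx)) qx.
have [d' d'E] := @internalG_shift X R K U T (d : G) (sval @^-1` ext b) (ex_intro _ b erefl).
have [q' q'E] : internal (ext q `&` ~` ext d').
  by apply: internalI; [exists q|apply: internalC; exists d'].
have [||k kP] := IH q'.
- by rewrite -q'E => x [/qG].
- move=> x; rewrite -[inn _ q']/(ext q' _) -q'E => -[qx nd].
  have [e] := ql x qx; rewrite inE => /predU1P[->|el] [y yb xE]; last by exists e => //; exists y.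
  exfalso; apply: nd; rewrite -[ext d' _]/((sval @^-1` ext d') x) -d'E.
  by exists y.
exists k.+1, (sval (d : G)), q'; split; first exact: (svalP (d : G)).
split=> // x qx; have [d'x|nd] := pselect (ext d' x).
  right; have : (sval @^-1` ext d') (exist _ x (qG _ qx) : G) by [].
  rewrite -d'E => -[y yb /(congr1 sval) /= <-].
  by exists (sval y).
by left; rewrite -[inn _ _]/(ext q' x) -q'E.
Qed.

Hypothesis hT : condensing T.

Lemma condensing_seq (A B : set G) : internalG A -> A `<=` Gf ->
    internalG B -> G0 `<=` B -> (forall x, B x -> B (- x)) ->
  exists l : seq {classic G}, forall x, A x -> exists2 d, d \in l & exists2 y, B y & x = d + y.
Proof.
move=> iA AGf iB G0B BN; have [D finD AD] := hT iA AGf iB G0B BN.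
have /finite_seqP[l lD] := finD : finite_set (D : set {classic G}).
exists l => x /AD[d Dd [y By <-]]; exists d; last by exists y.
by have : [set` l] d by rewrite -lD.
Qed.

Section lifting.
(* A character of G_f that is continuous with respect to G_0.  It is an external
   object, defined on all of G for convenience. *)
Variable c : G -> R[i].
Hypothesis c1 : forall x, `|c x| = 1.
Hypothesis cD : forall x y, Gf x -> Gf y -> c (x + y) = c x * c y.
Hypothesis cC : forall ε, 0 < ε -> exists B, [/\ internalG B, G0 `<=` B &
  forall x, B x -> Gf x -> `|c x - 1| < ε%:C].

(** Near G_0, on an internal symmetric set B, the character c is within ε of 1.
    Finitely many translates of B cover A, and an internal function that is
    constant on pieces of these translates approximates c. *)
Lemma internal_lift ε (A : set G) : 0 < ε -> internalG A -> A `<=` Gf ->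
  exists f : U (sFun s C), (forall x, circ (app f x)) /\
    forall x, A x -> near ε (app f (sval x)) (star (c x)).
Proof.
move=> ε0 iA AGf; have [B1 [iB1 G0B1 cB1]] := cC ε0.
have [B2 [iB2 G0B2 B2Gf B2N]] := internal_core.
pose B := (B1 `&` -%R @^-1` B1) `&` B2.
have [|||l lP] := @condensing_seq A B iA AGf.
- apply: internal_setI => //; apply: internal_setI => //; exact: internal_opp.
- move=> x G0x; split; last exact: G0B2.
  by split; apply: G0B1 => //; exact: subgroupN.
- move=> x [[B1x B1Nx] B2x]; split; last exact: B2N.
  by split=> //; rewrite /preimage /= opprK.
have iB : internalG B.
  apply: internal_setI => //; apply: internal_setI => //; exact: internal_opp.
suff [f [f1 fP]] : exists f : U (sFun s C), (forall x, circ (app f x)) /\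
    forall x, Gf x -> (exists2 d, d \in l & exists2 y, B y & x = d + y) ->
      near ε (app f (sval x)) (star (c x)).
  by exists f; split=> // x Ax; apply: fP; [exact: AGf|exact: lP].
elim: l {lP} => [|d l [f [f1 fP]]].
  exists (fone U s); split=> [x|x _ []//].
  by rewrite app_fone; exact: in_circle1.
have [d' d'E] := @internalG_shift X R K U T (d : G) B iB.
exists (piecewise d' (star (c d)) f); split=> [x|x Gfx].
  have [xd|xd] := pselect (inn x d'); last by rewrite app_piecewise_out.
  by rewrite app_piecewise_in //; apply/circ_star; exact: c1.
have [xd _|xd [e]] := pselect (inn (sval x) d').
  rewrite app_piecewise_in //; apply/near_star.
  have : (sval @^-1` ext d') x by [].
  rewrite -d'E => -[y [[By _] /B2Gf Gfy] xE].
  have dE : (d : G) = x - y by rewrite -xE addrK.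
  have Gfd : Gf d by rewrite dE; exact: sGf.2.
  rewrite -xE cD // -[X in X - _]mulr1 -mulrBr normrM c1 mul1r distrC.
  exact: cB1.
rewrite inE => /predU1P[->|el] [y By xE].
  exfalso; apply: xd; rewrite -[inn _ _]/((sval @^-1` ext d') x) -d'E.
  by exists y.
by rewrite app_piecewise_out //; apply: fP => //; exists e => //; exists y.
Qed.

(** The stability theorem applies to a symmetric internal B containing A and
    G_0, because the condensing property covers B + B by finitely many translates
    of B.  Three approximations of precision 1/(3M) make f multiplicative up to
    1/M; the precision 1/p is then lost twice, from c to f and from f to γ. *)
Lemma approximate_on (p : nat) (A : set G) : (0 < p)%N -> internalG A -> A `<=` Gf ->
  exists γ : char T, forall x, A x -> near (2 * p%:R^-1) (app (sval γ) (sval x)) (star (c x)).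
Proof.
move=> p0 iA AGf; have [B [iB AB G0B BGf BN]] := internal_symmetric_hull iA AGf.
have [b [bE bG]] := internal_gset iB.
have iBB : internalG [set x + y | x in B & y in B] by exact: internal_sum.
have [q [qE qG]] := internal_gset iBB.
have BBGf : [set x + y | x in B & y in B] `<=` Gf.
  by move=> _ [x /BGf Bx [y /BGf By <-]]; exact: subgroupD.
have [l lP] := condensing_seq iBB BBGf iB G0B BN.
have [|k kP] := @finite_cover_covered_star b q l qG.
  move=> x qx; have [|d dl [y By xE]] := lP x; first by rewrite qE.
  by exists d => //; exists y => //; rewrite bE in By.
have [N [M [M0 H]]] := @internal_stability X R U T k p p0.
have bGf : ext (nfold_star b N) `<=` sval @` Gf.
  apply: nfold_star_min => [|_ a [x Gfx <-] ab].
    by exists 0 => //; exact: sGf.1.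
  exists (x + (exist _ a (bG _ ab) : G)) => //; apply: subgroupD => //.
  by apply: BGf; rewrite bE.
pose I : set G := sval @^-1` ext (nfold_star b N).
have iI : internalG I by exists (nfold_star b N).
have IGf : I `<=` Gf by move=> x /bGf[y Gfy /elt_inj <-].
pose J := (I `|` [set x + y | x in I & y in I]) `|` B.
have iJ : internalG J.
  by apply: internal_setU => //; apply: internal_setU => //; exact: internal_sum.
have JGf : J `<=` Gf.
  by move=> _ [[/IGf//|[x /IGf Ix [y /IGf Iy <-]]]|/BGf//]; exact: subgroupD.
pose ε : R := Num.min p%:R^-1 (M%:R^-1 / 3).
have ε0 : 0 < ε by rewrite lt_min invr_gt0 ltr0n p0 divr_gt0 // invr_gt0 ltr0n.
have [f [f1 fP]] := internal_lift ε0 iJ JGf.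
have [||||||γ γP] := H b q f.
- by move=> x /bG.
- by rewrite -[inn _ _]/((sval @^-1` ext b) (0 : G)) -bE; apply: G0B; exact: sG0.1.
- move=> x y bx bY; pose x' : G := exist _ x (bG _ bx).
  pose y' : G := exist _ y (bG _ bY).
  have : (sval @^-1` ext q) (x' + y').
    rewrite -qE; exists x'; first by rewrite bE.
    by exists y' => //; rewrite bE.
  by [].
- exact: kP.
- exact: f1.
- move=> x' y' Ix' Iy'; have [x Gfx xx'] := bGf _ Ix'.
  have [y Gfy yy'] := bGf _ Iy'; rewrite -xx' in Ix' *; rewrite -yy' in Iy' *.
  have h1 := fP x (or_introl (or_introl Ix')).
  have h2 := fP y (or_introl (or_introl Iy')).
  have Jxy : J (x + y) by left; right; exists x => //; exists y.
  have := fP _ Jxy; rewrite cD // -cmul_star => h3.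
  have c1' z : circ (star (c z)) by apply/circ_star.
  have := near_trans h3 (near_cmul2 (f1 _) (c1' y) (near_sym h1) (near_sym h2)).
  apply: near_le; have : ε <= M%:R^-1 / 3 by rewrite ge_min lexx orbT.
  lra.
exists γ => x Ax; have Bx := AB _ Ax.
apply: (@near_le _ _ _ (p%:R^-1 + ε)).
  by rewrite mulr_natl mulr2n lerD2l ge_min lexx.
apply: near_trans (γP _ _) (fP _ _); last by right.
by rewrite bE in Bx.
Qed.

(** Saturation over an admissible family exhausting G_f.  As c is external, the
    internal sets used consist of the characters close on a to an internal
    approximation f_a of c: 1/8 from γ to c and 1/8 from c to f_a put γ within
    1/4 of f_a, and a common element is within 1/4 + 1/8 of c. *)
Lemma approximate_everywhere :
  exists γ : char T, forall x, Gf x -> near (3 / 8) (app (sval γ) (sval x)) (star (c x)).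
Proof.
have [F [FK GfF FGf]] := galactic_exhaustion.
pose S (a : U (sPow s)) : set G := sval @^-1` ext a.
have iS a : internalG (S a) by exists a.
have SGf a : F a -> S a `<=` Gf by move=> /FGf h x /h[y Gfy /elt_inj <-].
have /choice[f fP] : forall a, exists f : U (sFun s C), F a -> 
    (forall x, circ (app f x)) /\ forall x, S a x -> near (8%:R^-1) (app f (sval x)) (star (c x)).
  move=> a; have [Fa|nFa] := pselect (F a); last by exists (fone U s).
  have [|f fP] := @internal_lift 8%:R^-1 (S a) _ (iS a) (SGf a Fa); first by rewrite invr_gt0.
  by exists f.
have /choice[W WE] := fun a => @internal_near_chars X R U T (4%:R^-1) a (f a).
have [l lF|g gP] := @saturated_family X R K U _ _ F W FK.
  have [||γ γP] := @approximate_on 16 (\bigcup_(a in [set` l]) S a) isT.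
  - by apply: internal_bigU => a _; exact: iS.
  - by move=> x [a /= al]; apply: SGf; exact: lF.
  exists (sval γ) => a al; rewrite -WE; split=> [|x ax]; first exact: svalP.
  have Fa := lF a al; have [y Gfy yx] := FGf a Fa x ax.
  rewrite -yx in ax *; have := γP y (ex_intro2 _ _ a al ax).
  have := (fP a Fa).2 y ax => h1 h2.
  apply: near_le (near_trans h2 (near_sym h1)); lra.
have gch : is_char (G := T) g.
  have [a Fa _] := GfF 0 sGf.1.
  by have := gP a Fa; rewrite -WE => -[].
exists (exist _ g gch) => x Gfx; have [a Fa ax] := GfF x Gfx.
have := gP a Fa; rewrite -WE => -[_ /(_ _ ax) h1].
apply: near_le (near_trans h1 ((fP a Fa).2 x ax)); lra.
Qed.

(** The quotient of the standard part of γ by c is a character of G_f staying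
    within 1/2 of 1. *)
Lemma character_lift :
  exists γ : char T, forall x, Gf x -> stdpart (app (sval γ) (sval x)) = c x.
Proof.
have [γ γP] := approximate_everywhere; exists γ => x Gfx.
have [γ1 _ _] := svalP γ; have cn0 y : c y != 0 by rewrite -normr_eq0 c1 oner_neq0.
apply: (divIf (cn0 x)); rewrite divff //.
pose h (y : G) := stdpart (app (sval γ) (sval y)) / c y.
suff : h x = 1 by [].
apply: no_small_subgroup (sGf) _ _ _ _ Gfx; rewrite /h.
- by move=> y _; rewrite normrM normfV c1 stdpart_norm // invr1 mulr1.
- by move=> y z Gfy Gfz; rewrite char_stdpart_hom cD // invfM mulrACA.
- move=> y Gfy; have -> : stdpart (app (sval γ) (sval y)) / c y - 1 =
      (stdpart (app (sval γ) (sval y)) - c y) / c y.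
    by rewrite mulrBl divff.
  rewrite normrM normfV c1 invr1 mulr1.
  have c1' : circ (star (c y)) by apply/circ_star.
  have cE : stdpart (star (c y)) = c y.
    by apply: stdpartE => ε ε0; exact: near_refl.
  apply: ltW; rewrite -cE; apply: near_stdpart (γP y Gfy) => //; lra.
Qed.

End lifting.
End triplet.

(** * Compact-open neighbourhoods of a character *)

Section complex_distance.
Context (R : realType).

(** The norm of a complex number is itself complex; its real part is the distance
    as a real number. *)
Definition cdist (z w : R[i]) : R := complex.Re `|z - w|.

Lemma cdistE z w : `|z - w| = (cdist z w)%:C.
Proof. by rewrite /cdist normc_def. Qed.

Lemma cdist_triangle v z w : cdist z w <= cdist z v + cdist v w.
Proof. by rewrite -lecR rmorphD /= -!cdistE ler_distD. Qed.

Lemma cdistC z w : cdist z w = cdist w z.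
Proof. by rewrite /cdist distrC. Qed.

Lemma cdistxx z : cdist z z = 0.
Proof. by rewrite /cdist subrr normr0. Qed.

Lemma nbhs_cdist (c : R[i]^o) (S : set R[i]^o) :
  nbhs c S <-> exists2 ε : R, 0 < ε & forall z, cdist z c < ε -> S z.
Proof.
split=> [/nbhs_ballP[e /= e0 eS]|[ε ε0 εS]].
  have : e = (complex.Re e)%:C.
    by move: e0; rewrite ltcE /= => /andP[/eqP]; case: e {eS} => a b /= ->.
  move=> eE; rewrite eE in e0 eS; exists (complex.Re e); first by rewrite -ltcR.
  by move=> z zc; apply: eS; rewrite -ball_normE /= cdistE ltcR cdistC.
apply/nbhs_ballP; exists ε%:C; first by rewrite /= ltcR.
by move=> z; rewrite -ball_normE /= cdistE ltcR cdistC; exact: εS.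
Qed.

End complex_distance.

Section compact_open.
Context (R : realType) (A : PreTopologicalZmodule.type).
Implicit Types χ ξ : pontryagin R A.

Definition pvalue χ (p : A) : R[i] := cval (pval χ p).

Lemma pvalue_near χ p (ε : R) : 0 < ε -> \forall q \near p, cdist (pvalue χ q) (pvalue χ p) < ε.
Proof.
move=> ε0; have := @continuous_val R A χ p.
move=> /(_ [set z | cdist z (pvalue χ p) < ε]); apply.
by apply/nbhs_cdist; exists ε.
Qed.

Lemma circle_ball_open (c : R[i]) (ε : R) :
  open [set z : circle R | cdist (cval z) c < ε].
Proof.
exists [set z : R[i]^o | cdist z c < ε] => //.
rewrite openE => z /= zc; apply/nbhs_cdist; exists (ε - cdist z c).
  by rewrite subr_gt0.
move=> w wz; apply: le_lt_trans (cdist_triangle z _ _) _; lra.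
Qed.

Lemma circle_nbhs (O : set (circle R)) (z : circle R) : open O -> O z ->
  exists2 ε : R, 0 < ε & forall w, cdist (cval w) (cval z) < ε -> O w.
Proof.
move=> [B oB <-] Bz; have /nbhs_cdist[ε ε0 εB] : nbhs (cval z) B.
  by apply: open_nbhs_nbhs.
by exists ε => // w; exact: εB.
Qed.

(** A basic compact-open neighbourhood prescribes one open set for a whole
    compact set, so K is cut near each of its points x to the compact set of the
    p with χ(p) close to χ(x). *)
Lemma compact_ball_nbhs χ (K : set A) (ε : R) : compact K -> 0 < ε ->
  nbhs χ [set ξ | forall p, K p -> cdist (pvalue ξ p) (pvalue χ p) < ε].
Proof.
move=> cK ε0; have e4 : 0 < ε / 4 by rewrite divr_gt0.
move/compact_near_coveringP/near_covering_withinP : (cK) => covK.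
have := covK _ (nbhs χ) (fun ξ p => cdist (pvalue ξ p) (pvalue χ p) < ε) _; apply => x Kx.
pose Cx := [set p | cdist (pvalue χ p) (pvalue χ x) <= ε / 4].
pose O := [set z : circle R | cdist (cval z) (pvalue χ x) < ε / 2].
have clC : closed Cx.
  rewrite -[Cx]setCK; apply: open_closedC; rewrite openE => p /negP.
  rewrite -ltNge => px.
  have : 0 < cdist (pvalue χ p) (pvalue χ x) - ε / 4 by rewrite subr_gt0.
  move=> /(pvalue_near χ p); apply: filterS => q qp /=; apply/negP; rewrite -ltNge.
  have := cdist_triangle (pvalue χ q) (pvalue χ p) (pvalue χ x); rewrite (cdistC (pvalue χ p) (pvalue χ q)).
  rewrite /= in qp; lra.
have cKC : compact (K `&` Cx) by exact: compact_closedI.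
pose N := [set ξ : pontryagin R A | pval ξ @` (K `&` Cx) `<=` O].
have nN : nbhs χ N.
  apply: open_nbhs_nbhs; split.
    exists [set g : {compact-open, A -> circle R} | g @` (K `&` Cx) `<=` O] => //.
    by apply: compact_open_open => //; exact: circle_ball_open.
  move=> _ [p [_ Cp] <-]; rewrite /O /=; apply: le_lt_trans Cp _; lra.
exists ([set p | cdist (pvalue χ p) (pvalue χ x) < ε / 4], N).
  by split=> //; exact: pvalue_near.
move=> [p ξ] [/= px Nξ] Kp.
have : O (pval ξ p) by apply: Nξ; exists p => //; split=> //; exact: ltW.
rewrite /O /= => h; apply: le_lt_trans (cdist_triangle (pvalue χ x) _ _) _.
rewrite [X in _ + X]cdistC /pvalue in px *; rewrite /pvalue; lra.
Qed.

(** The filter generated by the sets of functions uniformly close to χ on a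
    compact set converges to χ in the compact-open topology. *)
Lemma open_compact_ball (O : set (pontryagin R A)) χ : open O -> O χ ->
  exists K : set A, exists ε : R, [/\ compact K, 0 < ε &
    forall ξ, (forall p, K p -> cdist (pvalue ξ p) (pvalue χ p) < ε) -> O ξ].
Proof.
move=> [B oB <-] Bχ.
pose F : set_system {compact-open, A -> circle R} := fun S => exists K : set A, exists ε : R,
  [/\ compact K, 0 < ε & forall g : A -> circle R,
      (forall p, K p -> cdist (cval (g p)) (pvalue χ p) < ε) -> S g].
have FF : Filter F.
  split.
  - by exists set0, 1; split=> //; exact: compact0.
  - move=> P Q [K [ε [cK ε0 PK]]] [K' [ε' [cK' ε0' QK]]].
    exists (K `|` K'), (Num.min ε ε'); split.
    + exact: compactU.
    + by rewrite lt_min ε0.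
    + move=> g gK; split; [apply: PK => p Kp|apply: QK => p Kp].
        by have := gK p (or_introl Kp); rewrite lt_min => /andP[].
      by have := gK p (or_intror Kp); rewrite lt_min => /andP[].
  - move=> P Q PQ [K [ε [cK ε0 PK]]]; exists K, ε; split=> // g /PK; exact: PQ.
have Fχ : F --> (pval χ : {compact-open, A -> circle R}).
  apply/compact_open_cvgP => K O' cK oO' χK.
  (* A Lebesgue number for the compact set K and the open set O'. *)
  have : \forall ε \near (0 : R)^'+, K `<=` (fun p => forall z : circle R,
      cdist (cval z) (pvalue χ p) < ε -> O' z).
    move/compact_near_coveringP/near_covering_withinP : (cK) => covK.
    apply: covK => x Kx.
    have [|η η0 ηO] := @circle_nbhs O' (pval χ x) oO'; first by apply: χK; exists x.
    have η2 : 0 < η / 2 by rewrite divr_gt0.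
    exists ([set p | cdist (pvalue χ p) (pvalue χ x) < η / 2], [set ε | ε < η / 2]).
      split; [exact: pvalue_near|exact: nbhs_right_lt].
    move=> [p ε] [/= px εη] Kp z zp; apply: ηO.
    apply: le_lt_trans (cdist_triangle (pvalue χ p) _ _) _.
    rewrite /pvalue in px zp *; lra.
  move=> h; have [ε [ε0 εK]] : exists ε : R, 0 < ε /\ K `<=` (fun p => forall z : circle R,
      cdist (cval z) (pvalue χ p) < ε -> O' z).
    have : \forall ε \near (0 : R)^'+, 0 < ε by exact: nbhs_right_gt.
    move=> h0; have PF : ProperFilter (0 : R)^'+ by exact: at_right_proper_filter.
    have h1 := @filterI _ _ PF _ _ h0 h.
    by have [ε [? ?]] := filter_ex h1; exists ε.
  exists K, ε; split=> // g gK _ [p Kp <-]; exact: (εK p Kp _ (gK p Kp)).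
have [K [ε [cK ε0 BK]]] : F B by apply: Fχ; exact: open_nbhs_nbhs.
by exists K, ε; split=> // ξ ξK; exact: BK.
Qed.

End compact_open.

(** * The topology of the observable trace *)

Section pairs.
Context (X : Type) (R : realType) (U : nsuniverse X R).
Local Notation El := (El X R).
Local Notation func Γ t f e := (@fun_star X R U Γ t f e).

Definition sfst s t (p : El (sProd s t)) : El s := p.1.
Definition ssnd s t (p : El (sProd s t)) : El t := p.2.
Definition nfst s t (p : U (sProd s t)) : U s :=
  func [:: sProd s t] s (fun e => sfst e.1) (p, tt).
Definition nsnd s t (p : U (sProd s t)) : U t :=
  func [:: sProd s t] t (fun e => ssnd e.1) (p, tt).

Lemma func_fst s t Γ (p : env El Γ -> El (sProd s t)) e :
  func Γ s (fun a => sfst (p a)) e = nfst (func Γ (sProd s t) p e).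
Proof. exact: (@func_comp1 X R U (sProd s t) s Γ (@sfst s t)). Qed.

Lemma func_snd s t Γ (p : env El Γ -> El (sProd s t)) e :
  func Γ t (fun a => ssnd (p a)) e = nsnd (func Γ (sProd s t) p e).
Proof. exact: (@func_comp1 X R U (sProd s t) t Γ (@ssnd s t)). Qed.

Lemma npair_ex s t (x : U s) (y : U t) : exists p, nfst p = x /\ nsnd p = y.
Proof.
have := @rel_transfer X R U [:: s; t] (fun e => exists p : El (sProd s t),
  sfst p = e.1 /\ ssnd p = e.2.1) _ (x, (y, tt)).
rewrite rel_ex; case=> [|p].
  by move=> e; exists (e.1, e.2.1).
by rewrite rel_and !rel_eq func_fst func_snd pr0 pr1 pr2 => -[h1 h2]; exists p; split; [exact: h1|exact: h2].
Qed.

End pairs.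

Section triplet.
Context (X : Type) (R : realType) (K : Type) (U : satuniverse X R K) (T : triplet U).
Local Notation El := (El X R).
Local Notation G := (elt T).
Local Notation G0 := (lower (pair0f T)).
Local Notation s := (gsort T).
Local Notation near := (@near X R U).
Local Notation star := (star U sCplx).
Local Notation internalG := (@internalG X R K U T).
Local Notation add := (app2 (gadd T)).

Let sG0 : subgroup G0 := lower_subgroup (pair0f T).

Lemma monadic_base : exists F : set (U (sPow s)), [/\ admissible K F,
  forall a x, F a -> G0 x -> inn (sval x) a,
  F !=set0 & forall x, (forall a, F a -> inn x a) -> exists2 y, G0 y & sval y = x].
Proof.
have [F [FK F0 E]] := monadic_nonempty (gset T) (lower_monadic T).
exists F; split=> // [a x Fa G0x|x xF].
  have : (\bigcap_(a in F) ext a) (sval x) by rewrite -E; exists x.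
  by apply.
have : (sval @` G0) x by rewrite E.
by move=> [y G0y yx]; exists y.
Qed.

Lemma internal_bigI (I : Type) (l : seq {classic I}) (A : I -> set G) :
  (forall i, i \in l -> internalG (A i)) -> internalG (\bigcap_(i in [set` l]) A i).
Proof.
move=> h; rewrite -[\bigcap_(i in _) _]setCK setC_bigcap.
apply: internal_setC; apply: internal_bigU => i il; apply: internal_setC.
exact: h.
Qed.

(** The halving of neighbourhoods: were it impossible, saturation applied to
    internal sets of pairs would give x, y in G_0 with x - y outside B. *)
Lemma internal_half (B : set G) : internalG B -> G0 `<=` B ->
  exists D, [/\ internalG D, G0 `<=` D, forall x, D x -> D (- x) &
    forall x y, D x -> D y -> B (x - y)].
Proof.
move=> [b BE] G0B; rewrite {}BE in G0B *.
have [F [FK FG0 [a0 Fa0] FP]] := monadic_base.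
pose S (a : U (sPow s)) : set G := sval @^-1` ext a.
suff [D [iD G0D DB]] : exists D, [/\ internalG D, G0 `<=` D &
    forall x y, D x -> D y -> (sval @^-1` ext b) (x - y)].
  exists (D `&` -%R @^-1` D); split.
  - by apply: internal_setI => //; exact: internal_opp.
  - by move=> x G0x; split; apply: G0D => //; exact: subgroupN.
  - by move=> x [Dx DNx]; split=> //; rewrite /preimage /= opprK.
  - by move=> x y [Dx _] [Dy _]; exact: DB.
apply: contrapT => noD.
have /choice[W WE] := fun a => @internal_rel X R U (sProd s s)
  [:: sPow s; sPow s; sPow s; sFun s (sFun s s); sFun s s]
  (fun e => smem e.2.1 (sfst e.1) /\ (smem e.2.1 (ssnd e.1) /\
    ~ smem e.2.2.1 (sapp (sapp e.2.2.2.2.1 (sfst e.1)) (sapp e.2.2.2.2.2.1 (ssnd e.1)))))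
  (a, (b, (gset T, (gadd T, (gopp T, tt))))).
have {}WE a p : ext (W a) p <-> [/\ inn (nfst p) a, inn (nsnd p) a &
    ~ inn (add (nfst p) (app (gopp T) (nsnd p))) b].
  rewrite -WE /mkset !rel_and rel_not !rel_mem !func_app func_fst func_snd.
  rewrite !(pr0, pr1, pr2, pr3, pr4, pr5) /=.
  by split=> [[? [? ?]]|[? ? ?]].
have [l lF|p pP] := @saturated_family X R K U _ _ F W FK.
  apply: contrapT => nop; apply: noD; exists (\bigcap_(a in [set` l]) S a); split.
  - by apply: internal_bigI => a _; exists a.
  - by move=> x G0x a /= al; apply: FG0 => //; exact: lF.
  - move=> x y Dx Dy; apply: contrapT => nb; apply: nop.
    have [p [px py]] := npair_ex (sval x) (sval y).
    by exists p => a al; apply/WE; rewrite px py; split=> //; [exact: Dx|exact: Dy].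
have [x G0x xp] := FP (nfst p) (fun a Fa => let: And3 h _ _ := (WE a p).1 (pP a Fa) in h).
have [y G0y yp] := FP (nsnd p) (fun a Fa => let: And3 _ h _ := (WE a p).1 (pP a Fa) in h).
have /WE[_ _] := pP a0 Fa0; apply.
rewrite -xp -yp; exact: (G0B (x - y) (sG0.2 _ _ G0x G0y)).
Qed.

End triplet.

Lemma ultrafilter_seq_union (T : Type) (F : set_system T) (I : Type)
    (l : seq {classic I}) (S : I -> set T) : UltraFilter F ->
  F (\bigcup_(i in [set` l]) S i) -> exists2 i, i \in l & F (S i).
Proof.
move=> FU; apply: contraPP => noF.
have FC i : i \in l -> F (~` S i).
  move=> il; have [FS|//] := in_ultra_setVsetC (S i) FU.
  by exfalso; apply: noF; exists i.
move=> FU'; have : F (\bigcap_(i in [set` l]) ~` S i).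
  elim: l FC {FU' noF} => [|i l IH] FC; first by rewrite set_nil bigcap_set0; exact: filterT.
  rewrite set_seq_cons bigcap_setU1; apply: filterI; first by apply: FC; rewrite inE eqxx.
  by apply: IH => j jl; apply: FC; rewrite inE jl orbT.
move=> FI; have PF : ProperFilter F by exact: ultra_proper.
have := @filterI _ F PF _ _ FU' FI; rewrite -setC_bigcup setICr.
exact: (@filter_not_empty _ F).
Qed.

Lemma filter_seq_bigI (T : Type) (F : set_system T) (I : Type)
    (l : seq {classic I}) (S : I -> set T) : Filter F ->
  (forall i, i \in l -> F (S i)) -> F (\bigcap_(i in [set` l]) S i).
Proof.
move=> FF; elim: l => [|i l IH] H; first by rewrite set_nil bigcap_set0; exact: filterT.
rewrite set_seq_cons bigcap_setU1; apply: filterI; first by apply: H; rewrite inE eqxx.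
by apply: IH => j jl; apply: H; rewrite inE jl orbT.
Qed.

Section quotient.
Local Open Scope quotient_scope.
Context (V : zmodType) (P : subpair V).

Lemma cls_eq (x y : upperT P) : cls x = cls y <-> lower P (val x - val y).
Proof.
have E : (\pi x == \pi y :> Quotient.quot (@lower_pred V P)) = (x - y \in @lower_pred V P).
  by rewrite Quotient.idealrBE.
have vB : val (x - y) = val x - val y by exact: raddfB.
split=> [xy|lxy].
  have : x - y \in @lower_pred V P by rewrite -E; apply/eqP.
  by rewrite /in_mem /= /lower_pred vB => /set_mem.
by apply/eqP; rewrite [_ == _]E /in_mem /= /lower_pred vB; exact: mem_set.
Qed.

Lemma clsD (x y : upperT P) : cls (x + y) = cls x + cls y.
Proof. exact: raddfD. Qed.

Lemma cls0 : cls (0 : upperT P) = 0.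
Proof. exact: raddf0. Qed.

Lemma cls_surj (p : trace P) : exists x, cls x = p.
Proof. by exists (repr p); exact: reprK. Qed.

Definition mkup x (h : upper P x) : upperT P := exist _ x (mem_set h).

Lemma valP_up (x : upperT P) : upper P (val x).
Proof. exact: set_mem (valP x). Qed.

End quotient.

Section triplet.
Context (X : Type) (R : realType) (K : Type) (U : satuniverse X R K) (T : triplet U).
Local Notation G := (elt T).
Local Notation G0 := (lower (pair0f T)).
Local Notation Gf := (upper (pair0f T)).
Local Notation s := (gsort T).
Local Notation near := (@near X R U).
Local Notation star := (star U sCplx).
Local Notation internalG := (@internalG X R K U T).

Let sGf : subgroup Gf := upper_subgroup (pair0f T).

Definition flat_set (A : set G) : set (obs T) := [set cls x | x in [set x | A (val x)]].

Lemma obs_nbhs (x : upperT (pair0f T)) (Y : set (obs T)) : nbhs (cls x : obs T) Y ->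
  exists A, [/\ internalG A, forall z, G0 z -> A (val x + z) &
     forall y : upperT (pair0f T), A (val y) -> Y (cls y)].
Proof.
move=> [Z [oZ Zx ZY]]; have [A iA [xA AZ]] := oZ x Zx.
exists A; split=> // [z G0z|y /AZ[u Zu uy]]; first by apply: xA; exists z.
by apply: ZY; rewrite (_ : y = u) //; apply: val_inj.
Qed.

(** The internal sets need not lie in G_f, as they can be intersected with a
    translate of an internal set between G_0 and G_f. *)
Lemma nbhs_obs (Y : set (obs T)) :
  (forall x : upperT (pair0f T), Y (cls x) -> exists A, [/\ internalG A,
     forall z, G0 z -> A (val x + z) &
     forall y : upperT (pair0f T), A (val y) -> Y (cls y)]) -> open Y.
Proof.
move=> H; rewrite -[open Y]/(@obs_open X R K U T Y) => x Yx.
have [A [iA xA AY]] := H x Yx.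
have [B [iB G0B BGf BN]] := internal_core T.
exists (A `&` [set val x + b | b in B]).
  by apply: internal_setI => //; exact: internalG_shift.
split=> [_ [z G0z <-]|y [Ay [b /BGf Gfb xb]]].
  by split; [exact: xA|exists z => //; exact: G0B].
have Gfy : Gf y by rewrite -xb; apply: subgroupD => //; exact: valP_up.
by exists (mkup Gfy) => //; exact: AY.
Qed.

Hypothesis hT : condensing T.

(** The condensing property is total boundedness and saturation is completeness.
    An ultrafilter on the image of A, lifted to A by representatives, contains
    for each a of a family defining G_0 a translate d + D with D - D inside a;
    by saturation these translates have a common point x in A, to whose class
    the ultrafilter converges. *)
Lemma flat_compact (A : set G) : internalG A -> A `<=` Gf -> compact (flat_set A).
Proof.
move=> iA AGf; rewrite compact_ultra => F FU FA.
have [F0 [FK FG0 [a0 Fa0] FP]] := monadic_base T.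
pose S (a : U (sPow s)) : set G := sval @^-1` ext a.
have /choice[D DP] : forall a, exists D : set G, F0 a ->
    [/\ internalG D, G0 `<=` D, forall x, D x -> D (- x) &
    forall x y, D x -> D y -> S a (x - y)].
  move=> a; have [Fa|nFa] := pselect (F0 a); last by exists set0.
  have [||D DP] := @internal_half X R K U T (S a); [by exists a| |by exists D].
  by move=> x G0x; exact: FG0.
have /choice[r rP] : forall p : obs T, exists y : G, flat_set A p ->
    A y /\ exists2 x : upperT (pair0f T), val x = y & cls x = p.
  move=> p.
  have [[x Ax xp]|np] := pselect (flat_set A p); last by exists 0.
  by exists (val x) => _; split=> //; exists x.
pose E a d : set G := [set d + y | y in D a] `&` A.
have iE a d : F0 a -> internalG (E a d).
  by move=> /DP[iD _ _ _]; apply: internal_setI => //; exact: internalG_shift.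
have /choice[d dP] : forall a, exists d, F0 a -> F (r @^-1` E a d).
  move=> a; have [Fa|nFa] := pselect (F0 a); last by exists 0.
  have [iD G0D DN _] := DP a Fa.
  have [l lP] := condensing_seq hT iA AGf iD G0D DN.
  have [d _ Fd] : exists2 d, d \in l & F (r @^-1` E a d).
    apply: ultrafilter_seq_union; apply: filterS FA => p Ap.
    have [Ar _] := rP p Ap; have [d dl [y Dy rE]] := lP _ Ar.
    by exists d => //; split=> //; exists y.
  by exists d.
have /choice[W WE] : forall a, exists w, F0 a -> E a (d a) = sval @^-1` ext w /\
    ext w `<=` ext (gset T).
  move=> a; have [Fa|nFa] := pselect (F0 a); last by exists (gset T).
  by have [w wE] := internal_gset (iE a (d a) Fa); exists w.
have FI (l : seq {classic U (sPow s)}) : (forall a, a \in l -> F0 a) ->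
    F (\bigcap_(a in [set` l]) (r @^-1` E a (d a))).
  by move=> lF; apply: filter_seq_bigI => a al; apply: dP; exact: lF.
have [l lF|x' xP] := @saturated_family X R K U _ _ F0 W FK.
  have [p pP] := filter_ex (FI l lF).
  exists (sval (r p)) => a al; have [WE1 _] := WE a (lF a al).
  have := pP a al; by rewrite /preimage /= WE1.
have Gx' : ext (gset T) x' by have [_ h] := WE a0 Fa0; apply: h; exact: xP.
pose x : G := exist _ x' Gx'.
have xE a : F0 a -> E a (d a) x.
  by move=> Fa; have [-> _] := WE a Fa; exact: xP.
have Ax : A x by have [_] := xE a0 Fa0.
pose xu := mkup (AGf x Ax).
exists (cls xu); split; first by exists xu.
move=> Y /obs_nbhs[B [iB xB BY]].
have [l [lF lB]] : exists l : seq {classic U (sPow s)}, (forall a, a \in l -> F0 a) /\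
    forall z : G, (forall a, a \in l -> S a z) -> B (x + z).
  apply: contrapT => nol.
  have [B' [B'E B'G]] := internal_gset (internalG_shift (- x) (internal_setC iB)).
  have /choice[V VE] : forall a, exists v, ext v = ext a `&` ext B'.
    by move=> a; have [v vE] : internal (ext a `&` ext B');
      [apply: internalI; [exists a|exists B']|exists v].
  have [l lF|z' zP] := @saturated_family X R K U _ _ F0 V FK.
    apply: contrapT => noz; apply: nol; exists l; split=> // z zl.
    apply: contrapT => nB; apply: noz; exists (sval z) => a al; rewrite VE; split.
      exact: zl.
    suff : (sval @^-1` ext B') z by [].
    by rewrite -B'E; exists (x + z) => //; rewrite addKr.
  have [z G0z zz'] : exists2 z, G0 z & sval z = z'.
    by apply: FP => a Fa; have := zP a Fa; rewrite VE => -[].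
  have : (sval @^-1` ext B') z by have := zP a0 Fa0; rewrite VE -zz' => -[].
  by rewrite -B'E => -[y nBy yz]; apply: nBy; rewrite -[y](addKr (- x)) opprK yz; exact: xB.
have FF : ProperFilter F by exact: ultra_proper.
have FS := @filterI _ F FF _ _ (FI l lF) FA; apply: filterS FS => p [pl Ap].
have [Arp [u ur <-]] := rP p Ap; apply: BY; rewrite ur -[r p](subrK x) addrC.
apply: lB => a al; have [_ _ _ DB] := DP a (lF a al).
have [[y Dy yE] _] := pl a al; have [[z Dz zE] _] := xE a (lF a al).
by rewrite -yE -zE opprD addrACA subrr add0r; exact: DB.
Qed.

End triplet.

(** * The canonical map *)

Lemma arbitrarily_close_eq (R : realType) (z w : R[i]) :
  (forall ε : R, 0 < ε -> cdist z w < ε) -> z = w.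
Proof.
move=> h; apply/eqP; rewrite -subr_eq0; apply/eqP.
by apply: arbitrarily_small_eq0 => ε ε0; rewrite cdistE ltcR; exact: h.
Qed.

Section chars.
Context (X : Type) (R : realType) (U : nsuniverse X R) (G : higroup U).
Local Notation near := (@near X R U).
Local Notation star := (star U sCplx).
Local Notation ev γ x := (app (sval γ) (sval x)).
Local Notation st γ x := (stdpart (ev γ x)).

Lemma char_circ (γ : char G) (x : elt G) : in_circle (ev γ x).
Proof. by have [γ1 _ _] := svalP γ. Qed.

Lemma near_st (ε η : R) (γ δ : char G) (x : elt G) : ε < η ->
  near ε (ev γ x) (ev δ x) -> cdist (st γ x) (st δ x) < η.
Proof.
move=> εη h; rewrite -ltcR -cdistE; apply: near_stdpart h => //; exact: char_circ.
Qed.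

Lemma st_near (ε η : R) (γ δ : char G) (x : elt G) : ε < η ->
  cdist (st γ x) (st δ x) < ε -> near η (ev γ x) (ev δ x).
Proof.
move=> εη h; apply: (@stdpart_near X R U ε) => //; try exact: char_circ.
by rewrite cdistE ltcR.
Qed.

Lemma ev_sub (γ δ : char G) (x : elt G) : ev (γ - δ) x = cmul (ev γ x) (cinv (ev δ x)).
Proof. by rewrite /= app_fmul app_finv. Qed.

Lemma polarB (γ δ : char G) (A : set (elt G)) :
  polar A (γ - δ) <-> forall x, A x -> st γ x = st δ x.
Proof.
split=> [h x Ax|h x Ax ε ε0].
  apply: arbitrarily_close_eq => ε ε0; apply: (@near_st (ε / 2)); first lra.
  apply/(near_div _ _ (char_circ δ x)); rewrite -ev_sub; apply: h => //.
  by rewrite divr_gt0.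
suff : near ε (ev (γ - δ) x) (star 1) by [].
rewrite ev_sub; apply/near_div; first exact: char_circ.
have e2 : 0 < ε / 2 by rewrite divr_gt0.
apply: (@st_near (ε / 2)); first lra.
by rewrite (h x Ax) cdistxx.
Qed.

Lemma polar_st (γ : char G) (A : set (elt G)) :
  polar A γ <-> forall x, A x -> st γ x = 1.
Proof.
have st0 x : st (0 : char G) x = 1.
  by rewrite /= app_fone; apply: stdpartE => ε ε0; exact: near_refl.
rewrite -[γ]subr0 polarB; split=> h x /h; rewrite subr0 => ->; rewrite ?st0 //.
Qed.

(** The absence of small subgroups turns closeness within 1/2 on a subgroup into
    infinite closeness. *)
Lemma near_subgroup_polar (γ δ : char G) (H : set (elt G)) : subgroup H ->
  (forall x, H x -> cdist (st γ x) (st δ x) < 2^-1) -> polar H (γ - δ).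
Proof.
move=> sH h; apply/polar_st => x Hx.
have st1 (ε : char G) (y : elt G) : `|st ε y| = 1 by rewrite stdpart_norm //; exact: char_circ.
have stB (y : elt G) : st (γ - δ) y * st δ y = st γ y.
  rewrite -stdpart_mul; [|exact: char_circ..].
  by rewrite -(app_fmul (sval (γ - δ)) (sval δ)) -[fmul _ _]/(sval (γ - δ + δ)) subrK.
apply: (@no_small_subgroup R (elt G) H (fun y => st (γ - δ) y)) Hx => //.
  by move=> y z _ _; exact: char_stdpart_hom.
move=> y Hy; have -> : `|st (γ - δ) y - 1| = `|st γ y - st δ y|.
  by rewrite -(stB y) -[X in _ * _ - X]mul1r -mulrBl normrM st1 mulr1.
by rewrite cdistE lecR ltW // h.
Qed.

End chars.

Section flat.
Context (X : Type) (R : realType) (K : Type) (U : satuniverse X R K) (T : triplet U).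
Local Notation G := (elt T).
Local Notation P := (pair0f T).
Local Notation G0 := (lower (pair0f T)).
Local Notation Gf := (upper (pair0f T)).
Local Notation s := (gsort T).
Local Notation C := sCplx.
Local Notation near := (@near X R U).
Local Notation star := (star U sCplx).
Local Notation internalG := (@internalG X R K U T).
Local Notation ev γ x := (app (sval γ) (sval x)).
Local Notation st γ x := (stdpart (ev γ x)).
Local Notation dualT := (upperT (dual_pair (pair0f T))).

Let sGf : subgroup Gf := upper_subgroup (pair0f T).

Lemma st_cls (γ : dualT) (x y : upperT P) :
  cls x = cls y -> st (val γ) (val x) = st (val γ) (val y).
Proof.
move=> /cls_eq G0xy; have /polar_st γ0 : polar G0 (val γ) := valP_up γ.
by rewrite -[val x](subrK (val y)) char_stdpart_hom (γ0 _ G0xy) mul1r.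
Qed.

Lemma flat_norm (γ : dualT) (p : obs T) :
  unit_circle R (st (val γ) (val (repr p : upperT P))).
Proof. by rewrite /unit_circle /= stdpart_norm //; exact: char_circ. Qed.

(** The character γ^flat of the observable trace, with the value at a class read
    off at a representative. *)
Definition flat_fun (γ : dualT) : {compact-open, obs T -> circle R} :=
  fun p => circle_of (flat_norm γ p).

Lemma flat_funE (γ : dualT) (x : upperT P) :
  cval (flat_fun γ (cls x)) = st (val γ) (val x).
Proof. by apply: st_cls; exact: reprK. Qed.

Lemma flat_cchar (γ : dualT) : continuous_char (flat_fun γ).
Proof.
split; last first.
  move=> p q; have [x <-] := cls_surj p; have [y <-] := cls_surj q.
  by rewrite -clsD !flat_funE -char_stdpart_hom.
apply: continuous_circle => p; have [x <-] := cls_surj p => S /nbhs_cdist[ε ε0 εS].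
apply: filterS (_ : nbhs (cls x : obs T) [set q | cdist (cval (flat_fun γ q)) (cval (flat_fun γ (cls x))) < ε]).
  by move=> q; exact: εS.
apply: open_nbhs_nbhs; split; last by rewrite /= cdistxx.
apply: nbhs_obs => y /= yx.
pose η := ε - cdist (cval (flat_fun γ (cls y))) (cval (flat_fun γ (cls x))).
have η0 : 0 < η by rewrite subr_gt0.
have [c cE] := @internal_rel X R U s [:: sFun s C; s]
  (fun e => snear (η / 2) (sapp e.2.1 e.1) (sapp e.2.1 e.2.2.1)) (sval (val γ), (sval (val y), tt)).
have {}cE z : ext c (sval z) <-> near (η / 2) (ev (val γ) z) (ev (val γ) (val y)).
  by rewrite -cE /mkset rel_near !func_app pr0 pr1 pr2.
exists (sval @^-1` ext c); split; first by exists c.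
  move=> z G0z; apply/cE; apply: (@stdpart_near X R U (η / 4)); try exact: char_circ; first lra.
  have /polar_st γ0 : polar G0 (val γ) := valP_up γ.
  by rewrite char_stdpart_hom (γ0 z G0z) mulr1 cdistE cdistxx ltcR divr_gt0.
move=> z /cE yz /=; apply: le_lt_trans (cdist_triangle (cval (flat_fun γ (cls y))) _ _) _.
suff : cdist (cval (flat_fun γ (cls z))) (cval (flat_fun γ (cls y))) < η by rewrite /η; lra.
rewrite !flat_funE -ltcR -cdistE; apply: near_stdpart yz; try exact: char_circ; lra.
Qed.

Definition flat (γ : dualT) : pontryagin R (obs T) := pont (flat_cchar γ).

Lemma flatE (γ : dualT) (x : upperT P) : pvalue (flat γ) (cls x) = st (val γ) (val x).
Proof. exact: flat_funE. Qed.

Lemma flat_inj (γ δ : dualT) : flat γ = flat δ <-> cls γ = cls δ.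
Proof.
rewrite cls_eq -[lower _ _]/(polar Gf (val γ - val δ)) polarB.
split=> [fγδ x Gfx|h].
  by have := congr1 (fun χ => pvalue χ (cls (mkup Gfx) : obs T)) fγδ; rewrite !flatE.
apply: pval_inj => p; have [x <-] := cls_surj p.
by rewrite -!/(pvalue _ _) !flatE; apply: h; exact: valP_up.
Qed.

Definition canonical_map (q : dual_obs T) : pontryagin R (obs T) := flat (repr q).

Lemma canonical_map_cls γ : canonical_map (cls γ) = flat γ.
Proof. by apply/flat_inj; exact: reprK. Qed.

Lemma canonical_mapD : {morph canonical_map : a b / a + b}.
Proof.
move=> a b; have [γ <-] := cls_surj a; have [δ <-] := cls_surj b.
rewrite -clsD !canonical_map_cls; apply: pval_inj => p; have [x <-] := cls_surj p.
rewrite -[RHS]/(pvalue (flat γ) (cls x) * pvalue (flat δ) (cls x)).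
rewrite -[LHS]/(pvalue (flat (γ + δ)) (cls x)) !flatE.
rewrite -stdpart_mul; [|exact: char_circ..].
by rewrite -app_fmul.
Qed.

Lemma canonical_map_inj : injective canonical_map.
Proof.
move=> a b; have [γ <-] := cls_surj a; have [δ <-] := cls_surj b.
by rewrite !canonical_map_cls => /flat_inj.
Qed.

Hypothesis hT : condensing T.

(** The pullback of ξ to G_f, extended by 1, is continuous with respect to G_0
    and lifts to an internal character by [character_lift]. *)
Lemma flat_surj (ξ : pontryagin R (obs T)) : exists γ, flat γ = ξ.
Proof.
pose d (u : upperT P) : R[i] := pvalue ξ (cls u : obs T).
pose c (x : G) : R[i] := if pselect (Gf x) is left h then d (mkup h) else 1.
have cE x (h : Gf x) : c x = d (mkup h).
  rewrite /c; case: pselect => // h'; congr d; exact: val_inj.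
have ξD p q : pvalue ξ (p + q) = pvalue ξ p * pvalue ξ q := (pvalP ξ).2 p q.
have ξ1 p : `|pvalue ξ p| = 1 := cvalP _.
have ξ0 : pvalue ξ 0 = 1.
  have n0 : pvalue ξ 0 != 0 by rewrite -normr_eq0 ξ1 oner_neq0.
  by apply: (mulfI n0); rewrite -ξD addr0 mulr1.
have [|x y Gfx Gfy|ε ε0|γ γP] := @character_lift X R K U T hT c.
- by move=> x; rewrite /c; case: pselect => h; rewrite /d ?ξ1 ?normr1.
- rewrite (cE _ Gfx) (cE _ Gfy) (cE _ (subgroupD sGf Gfx Gfy)) /d -ξD -clsD -!/(d _).
  by congr d; exact: val_inj.
- have /obs_nbhs[B [iB G0B Bξ]] : nbhs (cls (0 : upperT P) : obs T)
      [set q | cdist (pvalue ξ q) (pvalue ξ (cls 0)) < ε] by exact: pvalue_near.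
  exists B; split=> // [x G0x|x Bx Gfx]; first by have := G0B x G0x; rewrite add0r.
  have := Bξ (mkup Gfx) Bx; rewrite /= cls0 ξ0 -/(d _).
  by rewrite (cE _ Gfx) cdistE ltcR.
have γ0 : polar G0 γ.
  apply/polar_st => x G0x; rewrite γP; last exact: lower_upper.
  rewrite (cE _ (lower_upper G0x)) /d -ξ0 -cls0; congr (pvalue ξ _).
  by apply/cls_eq; rewrite /= subr0.
exists (@mkup _ (dual_pair P) γ γ0); apply: pval_inj => p; have [x <-] := cls_surj p.
rewrite -!/(pvalue _ _) flatE /= γP; last exact: valP_up.
by rewrite (cE _ (valP_up x)) -/(d x); congr d; exact: val_inj.
Qed.

Lemma canonical_map_bij : bijective canonical_map.
Proof.
have /choice[g gP] : forall ξ, exists q, canonical_map q = ξ.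
  by move=> ξ; have [γ <-] := flat_surj ξ; exists (cls γ); exact: canonical_map_cls.
by exists g => // q; apply: canonical_map_inj; rewrite gP.
Qed.

End flat.

(** * The canonical map is a homeomorphism *)

Section topology.
Context (X : Type) (R : realType) (K : Type) (U : satuniverse X R K) (T : triplet U).
Local Notation G := (elt T).
Local Notation P := (pair0f T).
Local Notation G0 := (lower (pair0f T)).
Local Notation Gf := (upper (pair0f T)).
Local Notation s := (gsort T).
Local Notation near := (@near X R U).
Local Notation internalG := (@internalG X R K U T).
Local Notation ev γ x := (app (sval γ) (sval x)).
Local Notation dualT := (upperT (dual_pair (pair0f T))).

Let sG0 : subgroup G0 := lower_subgroup (pair0f T).
Let sGf : subgroup Gf := upper_subgroup (pair0f T).

(** The image of x + B is not open in general, but it contains the open set of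
    the classes of those y with y + D inside x + B for some internal D
    containing G_0. *)
Lemma flat_set_nbhs (x : upperT P) (B : set G) : internalG B -> G0 `<=` B ->
  nbhs (cls x : obs T) (flat_set [set val x + b | b in B]).
Proof.
move=> iB G0B; pose xB := [set val x + b | b in B].
pose cond (y : upperT P) := exists D, [/\ internalG D, G0 `<=` D &
  forall d, D d -> xB (val y + d)].
exists [set cls y | y in cond]; split.
- apply: nbhs_obs => u [y [D [iD G0D Dx]] uy].
  have [D' [iD' G0D' DN DD]] := internal_half iD G0D.
  exists [set val y + d | d in D']; split; first exact: internalG_shift.
    move=> z G0z; have /cls_eq G0uy := esym uy.
    exists (val u - val y + z); last by rewrite addrA addrCA subrr addr0.
    by apply: G0D'; exact: subgroupD.
  move=> v [d Dd dv]; exists v => //; exists D'; split=> // d' Dd'.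
  rewrite -dv -addrA; apply: Dx; rewrite -[d']opprK; apply: DD => //; exact: DN.
- by exists x => //; exists B; split=> // d Bd; exists d.
- move=> _ [y [D [_ G0D Dx]] <-]; exists y => //.
  by rewrite /= -[val y]addr0; apply: Dx; apply: G0D; exact: sG0.1.
Qed.

(** A covering argument along the directed family of the internal subsets of
    G_f, since each point has the image of one of them as a neighbourhood. *)
Lemma compact_flat_set (Q : set (obs T)) : compact Q ->
  exists A, [/\ internalG A, A `<=` Gf & Q `<=` flat_set A].
Proof.
have [B [iB G0B BGf BN]] := internal_core T.
pose F : set_system (set G) := fun S => exists A0, [/\ internalG A0, A0 `<=` Gf &
  forall A, internalG A -> A `<=` Gf -> A0 `<=` A -> S A].
have FF : Filter F.
  split; first by exists B.
  - move=> S S' [A [iA AGf AS]] [A' [iA' AGf' AS']]; exists (A `|` A'); split.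
    + exact: internal_setU.
    + by move=> x [/AGf|/AGf'].
    + move=> D iD DGf AD; split; [apply: AS|apply: AS'] => // x Ax; apply: AD;
        [by left|by right].
  - move=> S S' SS' [A [iA AGf AS]]; exists A; split=> // D iD DGf AD.
    exact/SS'/AS.
move=> /compact_near_coveringP/(_ _ F (fun A p => flat_set A p) FF) h.
have [|A [iA AGf /(_ A iA AGf (@subset_refl _ A))]] := h; last by exists A.
move=> p _; have [x <-] := cls_surj p.
have xBGf : [set val x + b | b in B] `<=` Gf.
  by move=> _ [b /BGf Gfb <-]; apply: subgroupD => //; exact: valP_up.
have ixB : internalG [set val x + b | b in B] by exact: internalG_shift.
exists (flat_set [set val x + b | b in B],
        [set A | internalG A /\ [set val x + b | b in B] `<=` A]); last first.
  by move=> [q A] [/= [y xBy <-] [_ xBA]]; exists y => //; exact: xBA.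
split; last by exists [set val x + b | b in B]; split.
exact: flat_set_nbhs.
Qed.

Hypothesis hT : condensing T.

(** Let w be an internal set with γ + G_f^~ inside w, all of whose characters
    lie in G_0^~ and have their class in Y.
    The internal sets of the characters within 1/4 of γ on a, for a in a family
    exhausting G_f, intersect in γ + G_f^~, so by saturation finitely many of
    them already lie in w; and the image of the union of the corresponding sets
    a is compact. *)
Lemma canonical_map_open (Y : set (dual_obs T)) : dual_obs_open Y -> open (@canonical_map X R K U T @` Y).
Proof.
move=> oY; rewrite openE => _ [q Yq <-]; have [γ γq] := cls_surj q.
rewrite -{q}γq in Yq *; rewrite canonical_map_cls /interior.
have [_ [w ->] [γw wY]] := oY γ Yq.
have [F [FK GfF FGf]] := galactic_exhaustion T.
have /choice[W WE] : forall a : U (sPow s), exists v, ext v =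
    [set g | is_char (G := T) g /\ forall x, inn x a -> near 4^-1 (app g x) (app (sval (val γ)) x)]
    `&` ~` ext w.
  move=> a; have [v vE] : internal ([set g | is_char (G := T) g /\
      forall x, inn x a -> near 4^-1 (app g x) (app (sval (val γ)) x)] `&` ~` ext w).
    apply: internalI; first exact: internal_near_chars.
    by apply: internalC; exists w.
  by exists v.
have [l [lF lw]] : exists l : seq {classic U (sPow s)}, (forall a, a \in l -> F a) /\
    forall δ : char T, (forall a, a \in l -> forall x, inn x a ->
      near 4^-1 (app (sval δ) x) (app (sval (val γ)) x)) -> ext w (sval δ).
  apply: contrapT => nol.
  have [l lF|g gP] := @saturated_family X R K U _ _ F W FK.
    apply: contrapT => nog; apply: nol; exists l; split=> // δ δl.
    apply: contrapT => nw; apply: nog; exists (sval δ) => a al; rewrite WE; split=> //.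
    by split; [exact: svalP|exact: δl].
  have [a0 Fa0 _] := GfF 0 sGf.1.
  have gch : is_char (G := T) g by have := gP a0 Fa0; rewrite WE => -[[]].
  pose δ : char T := exist _ g gch.
  have δγ : polar Gf (δ - val γ).
    apply: near_subgroup_polar => // x Gfx; have [a Fa ax] := GfF x Gfx.
    have := gP a Fa; rewrite WE => -[[_ /(_ _ ax) h] _].
    apply: (@near_st X R U T 4^-1) => //; lra.
  have : ext w (sval δ) by apply: γw; exists (δ - val γ) => //; rewrite addrC subrK.
  by have := gP a0 Fa0; rewrite WE => -[].
pose A : set G := \bigcup_(a in [set` l]) (sval @^-1` ext a).
have cA : compact (flat_set A).
  apply: flat_compact => //; first by apply: internal_bigU => a _; exists a.
  by move=> x [a /= al /(FGf a (lF a al))[y Gfy /elt_inj <-]].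
have e8 : 0 < 8^-1 :> R by rewrite invr_gt0.
apply: filterS (compact_ball_nbhs (flat γ) cA e8) => ξ ξA.
have [δ δξ] := flat_surj hT ξ; rewrite -δξ in ξA *.
have wδ : ext w (sval (val δ)).
  apply: lw => a al x' ax'; have [x Gfx xx'] := FGf a (lF a al) x' ax'.
  rewrite -xx' in ax' *; apply: (@st_near X R U T 8^-1); first lra.
  have := ξA (cls (mkup Gfx)); rewrite !flatE; apply.
  by exists (mkup Gfx) => //; exists a.
have [y Yy yδ] := wY _ wδ; exists (cls y) => //.
by rewrite canonical_map_cls (_ : y = δ) //; exact: val_inj.
Qed.

(** A compact set Q is contained in the image of an internal A that may be taken
    to contain G_0.  The internal set of the characters within η of γ on A then
    consists of elements of G_0^~: as η <= 1/4, small subgroups are excluded. *)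
Lemma canonical_map_open_inv (Y : set (dual_obs T)) : open (@canonical_map X R K U T @` Y) -> dual_obs_open Y.
Proof.
move=> oY γ Yγ; have Yγflat : (@canonical_map X R K U T @` Y) (flat γ).
  by exists (cls γ) => //; exact: canonical_map_cls.
have [Q [ε [cQ ε0 εY]]] := open_compact_ball oY Yγflat.
have [A0 [iA0 A0Gf QA0]] := compact_flat_set cQ.
have [A [iA A0A G0A AGf _]] := internal_symmetric_hull iA0 A0Gf.
have [a [aE aG]] := internal_gset iA.
pose η := Num.min (ε / 2) 4^-1.
have η0 : 0 < η by rewrite lt_min divr_gt0 // invr_gt0 ltr0n.
have ηε : η <= ε / 2 by rewrite ge_min lexx.
have η4 : η <= 4^-1 by rewrite ge_min lexx orbT.
have [w wE] := @internal_near_chars X R U T η a (sval (val γ)).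
exists (sval @^-1` ext w); first by exists w.
rewrite -wE; split=> [_ [δ δ0 <-]|δ [_ δγ]].
  have /polarB h : polar Gf (val γ + δ - val γ) by rewrite addrC addKr.
  split=> [|x ax]; first exact: svalP.
  have Ax : A (exist _ x (aG _ ax)) by rewrite aE.
  apply: (@st_near X R U T (η / 2) η (val γ + δ) (val γ) (exist _ x (aG _ ax))); first lra.
  by rewrite h ?cdistxx ?divr_gt0 //; exact: AGf.
have δγ' x : A x -> near η (ev δ x) (ev (val γ) x) by rewrite aE => ax; exact: δγ.
have δ0 : polar G0 δ.
  have : polar G0 (δ - val γ).
    apply: near_subgroup_polar => // x /G0A Ax; apply: near_st (δγ' x Ax); lra.
  move=> h; rewrite -[δ](subrK (val γ)).
  by apply: (subgroupD (polar_subgroup _) h); exact: valP_up γ.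
pose y : dualT := @mkup _ (dual_pair P) δ δ0.
exists y => //.
have [z Yz zy] : (@canonical_map X R K U T @` Y) (flat y).
  apply: εY => p /QA0[x A0x <-]; rewrite !flatE /=.
  have Ax := A0A _ A0x; apply: near_st (δγ' _ Ax); lra.
by rewrite /= (_ : cls y = z) //; apply: canonical_map_inj; rewrite canonical_map_cls.
Qed.

End topology.

Theorem theorem2p1p4 (X : Type) (R : realType) (K : Type)
    (U : satuniverse X R K) (T : triplet U) (hT : condensing T) :
  exists Phi : dual_obs T -> pontryagin R (obs T),
    [/\ forall (gamma : upperT (dual_pair (pair0f T)))
               (x : upperT (pair0f T)),
          cval (pval (Phi (cls gamma)) (cls x)) =
          stdpart (app (sval (val gamma)) (sval (val x))),
        {morph Phi : a b / a + b},
        bijective Phi &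
        forall Y : set (dual_obs T), dual_obs_open Y <-> open (Phi @` Y)].
Proof.
exists (@canonical_map X R K U T); split.
- by move=> γ x; rewrite canonical_map_cls; exact: flatE.
- exact: canonical_mapD.
- exact: canonical_map_bij.
- by move=> Y; split; [exact: canonical_map_open|exact: canonical_map_open_inv].
Qed.
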